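(* Let $G_0$ be a graph with at least one edge, and let $W$ be the standardized number of copies of $G_0$ in the Erdős–Rényi random graph $G(n,p)$, $p\in(0,1)$, $q=1-p$. Assume $n\ge 4v_{G_0}^2$. Then for all $t\ge0$, $$\Big|\frac{\mathbb{P}(W>t)}{1-\Phi(t)}-1\Big|\le 50\,c_{G_0}\exp\big(c_{G_0}\,t^2\,s(t)\big)\,(1+t^2)\,s(t),$$ where $$s(t)=\Big(1+\frac{t}{\min\{\sqrt{\Psi_{\min}},1\}}\Big)\frac{1}{\sqrt{q\Psi_{\min}}}\exp\Big(\frac{5Dt}{\sigma}\Big),\qquad c_{G_0}=\frac{2^{\frac92+\frac{15}{2}e_{G_0}}\,(v_{G_0}!)^4\,e_{G_0}}{\operatorname{aut}(G_0)^{3/2}}.$$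
   Context: In $G(n,p)$ on $n$ vertices each of the $\binom n2$ possible edges is present independently with probability $p$ (which may depend on $n$). A copy of $G_0$ in $G(n,p)$ is a subgraph isomorphic to $G_0$; copies are identified by their edge sets. Let $\mathcal{M}$ be the set of edge sets $\Gamma$ of the complete graph $K_n$ that form a copy of $G_0$ (i.e. the graph spanned by $\Gamma$ is isomorphic to $G_0$ with isolated vertices removed), and let $N=\sum_{\Gamma\in\mathcal{M}}\mathbf 1\{\text{all edges of }\Gamma\text{ present}\}$ be the number of copies; $\sigma^2:=\operatorname{Var}(N)$ and $W=(N-\mathbb{E}N)/\sigma$. $D$ is the number of $\Gamma'\in\mathcal{M}$ with $\Gamma'\cap\Gamma\neq\emptyset$ for a fixed $\Gamma\in\mathcal{M}$ (independent of $\Gamma$ by symmetry). $v_H$, $e_H$, $\operatorname{aut}(H)$ denote the number of vertices, edges and automorphisms of a graph $H$; $\Psi_{\min}:=\min\{n^{v_H}p^{e_H}: H\subset G_0,\ e_H\ge1\}$. $\Phi$ is the standard normal distribution function. *)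

(* Defs.v *)
From HB Require Import structures.
From mathcomp Require Import all_boot all_order all_algebra all_fingroup.
From mathcomp Require Import all_classical all_reals all_analysis.
Unset Printing Implicit Defensive.
Import Order.TTheory GRing.Theory Num.Theory.
Local Open Scope ring_scope.

Definition simple_graph (V : finType) (g : rel V) : Prop :=
  symmetric g /\ irreflexive g.

Definition gedges (V : finType) (g : rel V) : {set {set V}} :=
  [set [set x; y] | x in V, y in V & g x y].

Definition nvert (V : finType) : nat := #|V|.
Definition nedges (V : finType) (g : rel V) : nat := #|gedges V g|.

Definition nonisolated (V : finType) (g : rel V) : {set V} :=
  [set x | [exists y, g x y]].

Definition aut (V : finType) (g : rel V) : nat :=
  #|[set s : {perm V} | [forall x, forall y, g (s x) (s y) == g x y]]|.

Definition Kedges (n : nat) : {set {set 'I_n}} := [set e : {set 'I_n} | #|e| == 2].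

(* Gamma is (the edge set of) a copy of g in K_n: the graph spanned by Gamma
   is the image of G0 minus isolated vertices under a map injective on the
   non-isolated vertices. *)
Definition is_copy (V : finType) (g : rel V) (n : nat) (Gam : {set {set 'I_n}}) : bool :=
  [exists f : {ffun V -> 'I_n},
     [forall x in nonisolated V g, forall y in nonisolated V g, (f x == f y) ==> (x == y)]
     && (Gam == [set f @: (e : {set V}) | e in gedges V g])].

Definition copies (V : finType) (g : rel V) (n : nat) : {set {set {set 'I_n}}} :=
  [set Gam | is_copy V g n Gam].

Section Gnp.
Variable R : realType.

(* outcome omega = set of present edges *)
Definition gnp_prob (n : nat) (p : R) (om : {set {set 'I_n}}) : R :=
  if om \subset Kedges n then p ^+ #|om| * (1 - p) ^+ (#|Kedges n| - #|om|) else 0.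

Definition gnp_E (n : nat) (p : R) (X : {set {set 'I_n}} -> R) : R :=
  \sum_(om : {set {set 'I_n}}) gnp_prob n p om * X om.

Definition gnp_P (n : nat) (p : R) (A : {set {set 'I_n}} -> bool) : R :=
  \sum_(om : {set {set 'I_n}} | A om) gnp_prob n p om.

Definition Ncopies (V : finType) (g : rel V) (n : nat) (om : {set {set 'I_n}}) : R :=
  (#|[set Gam in copies V g n | Gam \subset om]|)%:R.

Definition meanN (V : finType) (g : rel V) (n : nat) (p : R) : R :=
  gnp_E n p (Ncopies V g n).

Definition varN (V : finType) (g : rel V) (n : nat) (p : R) : R :=
  gnp_E n p (fun om => (Ncopies V g n om - meanN V g n p) ^+ 2).

Definition sigmaN (V : finType) (g : rel V) (n : nat) (p : R) : R :=
  Num.sqrt (varN V g n p).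

Definition Wstd (V : finType) (g : rel V) (n : nat) (p : R) (om : {set {set 'I_n}}) : R :=
  (Ncopies V g n om - meanN V g n p) / sigmaN V g n p.

Definition Dcount (V : finType) (g : rel V) (n : nat) (Gam : {set {set 'I_n}}) : nat :=
  #|[set Gam' in copies V g n | Gam' :&: Gam != finset.set0]|.

(* Psi_min = min over subgraphs H=(S,F) of G0 with e_H >= 1 of n^{v_H} p^{e_H};
   G0 itself is such a subgraph when it has an edge, so it is a valid seed. *)
Definition is_subgraph_ne (V : finType) (g : rel V) (H : {set V} * {set {set V}}) : bool :=
  [&& H.2 \subset gedges V g, [forall e in H.2, e \subset H.1] & H.2 != finset.set0].

Definition Psi_min (V : finType) (g : rel V) (n : nat) (p : R) : R :=
  \big[Num.min/ (n%:R ^+ #|V| * p ^+ nedges V g)]_(H | is_subgraph_ne V g H)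
     (n%:R ^+ #|H.1| * p ^+ #|H.2|).

Definition Phi (t : R) : R := fine (normal_prob 0 1 `]-oo, t]%classic).

Definition cG0 (V : finType) (g : rel V) : R :=
  powR 2 (9 / 2 + 15 / 2 * (nedges V g)%:R) * ((#|V|)`!%:R) ^+ 4 * (nedges V g)%:R
  / powR (aut V g)%:R (3 / 2).

Definition s_fun (V : finType) (g : rel V) (n : nat) (p : R)
   (Gam : {set {set 'I_n}}) (t : R) : R :=
  (1 + t / Num.min (Num.sqrt (Psi_min V g n p)) 1)
  * (Num.sqrt ((1 - p) * Psi_min V g n p))^-1
  * expR (5 * (Dcount V g n Gam)%:R * t / sigmaN V g n p).

End Gnp.

(* Main.v *)
(** Stein's method combined with difference calculus for independent Bernoulli
    variables.  Let q = 1 - p, let D_a be the difference operator in the edge a,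
    and write W = sum_a (X_a - p) T_a by the Clark-Ocone formula.  Integration by
    parts, E (X_a - p) G = p q E D_a G, turns Stein's equation for 1{w <= t} into
      |P(W <= t) - Phi(t)| <= E |1 - U| |f'(W)| + E |R| |W f(W) + 1{W > t}|,
    where U = sum_a p q T_a D_a W has mean 1 and R = sum_a (X_a - p) T_a D_a W.
    Both 1 - U and R are sums of terms (X_a - p) 1{S present} indexed by pairs of
    overlapping copies.  Their second moments weighted by exp(l W) reduce to sums
    over chains of overlapping copies, each link of which costs a factor of order
    E N / Psi_min, and are compared with the variance bound
    sigma^2 >= q (E N)^2 / (2^e Psi_min).  The same estimates control
    M(l) = E exp(l W) through M'(l) = E W exp(l W).  The weight f'(W) grows like
    W exp(W^2 / 2) below t, so it is cut into unit slabs, on each of which it is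
    dominated by one exponential.  If c s(t) >= 1/2 the claim follows from the
    Mills ratio alone. *)
Require Import Defs.
From HB Require Import structures.
From mathcomp Require Import all_boot all_order all_algebra all_fingroup.
From mathcomp Require Import all_classical all_reals all_analysis.
From mathcomp Require Import ring lra.
From mathcomp Require Import fintype finset bigop.
Import Order.TTheory GRing.Theory Num.Theory.
Import numFieldNormedType.Exports.
Local Open Scope ring_scope.

Set Implicit Arguments.
Unset Strict Implicit.

(** * The normal distribution *)

(** The error is relative to 1 - Phi t, so a factor [Phi (- t)] must survive every estimate. Below t
    the Stein solution already carries it. Above t only a constant is available; there exp (t (W -
    t)) >= 1 supplies exp (- t^2) against a moment generating function of order exp (t^2 / 2), and
    Mills' ratio turns the rest into [Phi (- t)]. Hence every moment is needed under the weight exp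
    (l W) with 0 <= l <= t. The indicator makes f' jump, so no Lipschitz bound on f' is available.
    The Taylor error of f is bounded instead by the increment of a nondecreasing function h; as T_a
    >= 0, integration by parts read backwards turns the weighted sum of these increments into E R
    h(W). Under the weight exp (l W) the terms of a Clark-Ocone sum are no longer orthogonal. For
    two terms on disjoint unions, two integrations by parts leave a mixed second difference of exp
    (l W), which is small; terms on overlapping unions are few enough for absolute values. At most
    six copies are forced present in a second moment, which shifts W by 6 D / sigma; the square root
    leaves 3 D, within the 5 D of the claim. *)

Section Normal.
Variable R : realType.
Implicit Types (x y w t : R).
Local Open Scope classical_set_scope.
Local Open Scope ring_scope.

Lemma mvt_is_derive (f df : R -> R) (a b : R) : a <= b ->
  (forall x, is_derive x 1 f (df x)) ->
  exists2 c, a <= c <= b & f b - f a = df c * (b - a).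
Proof.
move=> ab d.
have [|c] := @MVT_segment R f df a b ab (fun x _ => d x).
- apply: continuous_subspaceT => x.
  apply/differentiable_continuous/derivable1_diffP.
  exact: (@ex_derive _ _ _ _ _ _ _ (d x)).
- by rewrite in_itv /= => h e; exists c.
Qed.

Lemma is_derive_nondecreasing (f df : R -> R) (b : R) :
  (forall x, is_derive x 1 f (df x)) -> (forall x, x <= b -> 0 <= df x) ->
  forall x y, x <= y -> y <= b -> f x <= f y.
Proof.
move=> d h x y xy yb; have [c /andP[_ cy] e] := mvt_is_derive xy d.
by rewrite -subr_ge0 e mulr_ge0 ?subr_ge0// h// (le_trans cy).
Qed.

(** The scheme behind the Mills inequalities below: the expression has asymptotically nonnegative
    values at minus infinity and a nonnegative derivative. The limit is stated with epsilon so that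
    it can be checked by elementary bounds. *)
Lemma ge0_of_nondecreasing (f : R -> R) (b : R) :
  (forall x y, x <= y -> y <= b -> f x <= f y) ->
  (forall e : R, 0 < e -> exists A : R, forall x, x <= A -> - e <= f x) ->
  forall x, x <= b -> 0 <= f x.
Proof.
move=> mono lim x xb; rewrite leNgt; apply/negP => fx.
have [|A hA] := lim (- f x / 2); first lra.
have := hA (Num.min A x); rewrite ge_min lexx => /(_ isT).
have := mono (Num.min A x) x; rewrite ge_min lexx orbT => /(_ isT xb).
lra.
Qed.

Definition npdf x : R := normal_pdf 0 1 x.

Lemma npdfE x : npdf x = (Num.sqrt (pi *+ 2))^-1 * expR (- x ^+ 2 / 2).
Proof.
rewrite /npdf normal_pdfE ?oner_eq0// /normal_peak /normal_fun expr1n mul1r subr0.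
by rewrite mulr2n.
Qed.

Lemma sqrt2pi_gt0 : 0 < Num.sqrt (pi *+ 2 : R).
Proof. by rewrite sqrtr_gt0 mulrn_wgt0// pi_gt0. Qed.

Lemma sqrt2pi_le3 : Num.sqrt (pi *+ 2 : R) <= 3.
Proof.
have -> : 3 = Num.sqrt (3 ^+ 2 : R) by rewrite sqrtr_sqr ger0_norm.
by apply: ler_wsqrtr; have := @pihalf_lt2 R; lra.
Qed.

Lemma sqrt2pi_ge2 : 2 <= Num.sqrt (pi *+ 2 : R).
Proof.
have -> : 2 = Num.sqrt (2 ^+ 2 : R) by rewrite sqrtr_sqr ger0_norm.
by apply: ler_wsqrtr; have := @pi_ge2 R; lra.
Qed.

Lemma npdf_gt0 x : 0 < npdf x.
Proof. by rewrite npdfE mulr_gt0 ?expR_gt0// invr_gt0 sqrt2pi_gt0. Qed.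

Lemma npdfN x : npdf (- x) = npdf x.
Proof. by rewrite !npdfE sqrrN. Qed.

Lemma npdf_inv x : (npdf x)^-1 = Num.sqrt (pi *+ 2) * expR (x ^+ 2 / 2).
Proof. by rewrite npdfE invfM invrK -expRN mulNr opprK. Qed.

Lemma is_derive_npdf x : is_derive x 1 npdf (- x * npdf x).
Proof.
have -> : npdf = (fun y => (Num.sqrt (pi *+ 2))^-1 * expR (- y ^+ 2 / 2)).
  by apply/funext => y; rewrite npdfE.
apply: is_derive_eq; rewrite /GRing.scale /=.
by field; rewrite lt0r_neq0 ?sqrt2pi_gt0.
Qed.

Lemma is_derive_Phi x : is_derive x 1 (Phi R) (npdf x).
Proof.
have [||||d e] := @continuous_FTC1 R npdf -oo%O x (x + 1).
- by rewrite ltrDl.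
- apply: (integrableS _ _ (@classical_sets.subsetT _ _)) => //.
  by apply: integrable_normal_pdf; rewrite oner_eq0.
- by rewrite ltNyr.
- exact/continuous_normal_pdf/oner_neq0.
apply: DeriveDef; first exact: d.
by rewrite -derive1E; exact: e.
Qed.

Lemma Phi_ge0 x : 0 <= Phi R x.
Proof. by rewrite /Phi fine_ge0. Qed.

(** The identity is made a random variable so that the known limits of [cdf] at both ends pass to
    [Phi]. *)
Let idR : measurableTypeR R -> R := idfun.
#[local] HB.instance Definition _ :=
  @isMeasurableFun.Build _ _ _ _ idR (@measurable_id _ _ [set: _]%classic).

Let Phi_cdf x : (Phi R x)%:E = cdf (idR : {RV (normal_prob 0 1 : probability _ R) >-> R}) x.
Proof.
rewrite /Phi /cdf /distribution /pushforward /= preimage_id fineK//.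
exact: fin_num_measure.
Qed.

Lemma Phi_Ny e : 0 < e -> exists A : R, forall x, x <= A -> Phi R x <= e.
Proof.
move=> e0.
have : Phi R x @[x --> -oo%R] --> (0 : R).
  have := cvg_cdfNy0 (idR : {RV (normal_prob 0 1 : probability _ R) >-> R}).
  rewrite (_ : cdf _ = EFin \o Phi R); last by apply/funext => x; rewrite -Phi_cdf.
  by move/fine_cvg.
move/cvgrPdist_le => /(_ e e0) [A [_ hA]].
exists (A - 1) => x xA; have := hA x; rewrite sub0r normrN ger0_norm ?Phi_ge0//; apply.
by move: xA; lra.
Qed.

Lemma Phi_y e : 0 < e -> exists A : R, forall x, A <= x -> 1 - e <= Phi R x.
Proof.
move=> e0.
have : Phi R x @[x --> +oo%R] --> (1 : R).
  have := cvg_cdfy1 (idR : {RV (normal_prob 0 1 : probability _ R) >-> R}).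
  rewrite (_ : cdf _ = EFin \o Phi R); last by apply/funext => x; rewrite -Phi_cdf.
  by move/fine_cvg.
move/cvgrPdist_le => /(_ e e0) [A [_ hA]].
exists (A + 1) => x xA; have /(_ _)/wrap[] := hA x; first by move: xA; lra.
by rewrite ler_norml; lra.
Qed.
End Normal.

(** * Mills ratio inequalities *)

Section Mills.
Variable R : realType.
Implicit Types (e x y w t : R).
Local Notation Phi := (Phi R).
Local Notation npdf := (@npdf R).

#[local] Instance is_derive_Phi_inst x : is_derive x 1 Phi (npdf x) := is_derive_Phi x.
#[local] Instance is_derive_npdf_inst x : is_derive x 1 npdf (- x * npdf x) := is_derive_npdf x.

Lemma Phi_le1 x : Phi x <= 1.
Proof.
rewrite /Defs.Phi -lee_fin fineK ?fin_num_measure//; exact: probability_le1.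
Qed.

(** The function y -> Phi y + Phi (- y) has zero derivative. Its constant value is read off far to
    the left, where each summand is within a third of the supposed gap of its limit. *)
Lemma Phi_sym x : Phi (- x) = 1 - Phi x.
Proof.
pose f y := Phi y + Phi (- y).
have d : forall y, is_derive y 1 f 0.
  move=> y; have dN : is_derive y 1 (Phi \o -%R) (- npdf (- y)).
    by apply: is_derive_eq; rewrite /GRing.scale /=; ring.
  have -> : 0 = npdf y + - npdf (- y) by rewrite npdfN subrr.
  exact: (is_deriveD (is_derive_Phi y) dN).
have fc a b : a <= b -> f a = f b.
  by move=> ab; have [c _ e] := mvt_is_derive ab d; move: e; rewrite mul0r; lra.
have f1 a : f a = f 0 by case: (leP a 0) => [/fc|/ltW/fc].
suff : f 0 = 1 by have := f1 x; rewrite /f; lra.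
apply/eqP; rewrite -subr_eq0 -normr_eq0 eq_le normr_ge0 andbT leNgt.
apply/negP => h0; set e := `|f 0 - 1| in h0 *.
have e2 : 0 < e / 3 by lra.
have [A hA] := @Phi_Ny R _ e2; have [B hB] := @Phi_y R _ e2.
pose y := Num.min A (- B).
have yA : y <= A by rewrite /y !ge_min lexx.
have yB : B <= - y by rewrite lerNr /y !ge_min lexx orbT.
have := f1 y; have := hA _ yA; have := hB _ yB; have := Phi_le1 (- y); have := Phi_ge0 y.
have : e = f 0 - 1 \/ e = 1 - f 0.
  by rewrite /e; case: (leP 0 (f 0 - 1)) => [/ger0_norm|/ltr0_norm] ->; [left|right; ring].
by rewrite /f => -[]; lra.
Qed.

(** Squaring exp (x^2 / 4) >= x^2 / 4 and using sqrt (2 pi) >= 2 gives 1 / npdf x >= x^4 / 8, so x^2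
    >= 8 / e is enough. The lemma supplies the behaviour at minus infinity in the next two
    inequalities of Mills type. *)
Lemma npdf_tail e : 0 < e ->
  exists2 A : R, A <= -1 & forall x, x <= A -> x ^+ 2 * npdf x <= e.
Proof.
move=> e0; have he : 0 < 8 / e by rewrite divr_gt0.
exists (- (8 / e + 1)); first by move: he; generalize (8 / e); move=> *; lra.
move=> x xA; have hx : 8 / e <= x ^+ 2.
  move: he xA; generalize (8 / e) => y y0 xy.
  have : (y + 1) * (y + 1) <= - x * - x by apply: ler_pM; lra.
  nra.
have x8 : 8 <= x ^+ 2 * e by rewrite -ler_pdivrMr.
have {hx he xA} x0 : 0 <= x ^+ 2 by exact: sqr_ge0.
have E1 := expR_ge1Dx (x ^+ 2 / 4).
have S2 := sqrt2pi_ge2 R.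
have Pi : x ^+ 2 * x ^+ 2 / 8 <= (npdf x)^-1.
  have -> : (npdf x)^-1 = Num.sqrt (pi *+ 2) * (expR (x ^+ 2 / 4) * expR (x ^+ 2 / 4)).
    by rewrite npdf_inv -expRD; congr (_ * expR _); field.
  move: E1 S2 x0; generalize (expR (x ^+ 2 / 4)) => u.
  generalize (x ^+ 2) => v; generalize (Num.sqrt (pi *+ 2 : R)) => z uv z2 v0.
  have h1 : (v / 4) * (v / 4) <= u * u by apply: ler_pM; lra.
  have h2 : 0 <= u * u by apply: mulr_ge0; lra.
  have : 2 * (u * u) <= z * (u * u) by rewrite ler_wpM2r.
  lra.
have P0 := npdf_gt0 x.
have : x ^+ 2 * x ^+ 2 / 8 * npdf x <= 1 by rewrite -ler_pdivlMr// mul1r.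
have x2 : 0 < x ^+ 2.
  by rewrite lt_neqAle x0 andbT eq_sym; apply/eqP => x20; move: x8; rewrite x20 mul0r; lra.
move: x8 P0 x2; generalize (x ^+ 2) => v; generalize (npdf x) => f v8 f0 v0 h.
rewrite -(ler_pM2l v0); apply: (le_trans _ v8); lra.
Qed.

Lemma Phi_le_npdf x : x <= -1 -> Phi x <= npdf x.
Proof.
move=> x1; rewrite -subr_ge0.
apply: (@ge0_of_nondecreasing R (fun y => npdf y - Phi y) (-1)) => //.
  apply: (@is_derive_nondecreasing R (fun y => npdf y - Phi y) (fun y => - y * npdf y - npdf y)).
  by move=> y y1; have := npdf_gt0 y; generalize (npdf y) => f f0; nra.
move=> e e0; have [A hA] := @Phi_Ny R _ e0; exists A => y /hA.
by have := npdf_gt0 y; lra.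
Qed.

Lemma npdfD_mulPhi_ge0 x : 0 <= npdf x + x * Phi x.
Proof.
apply: (@ge0_of_nondecreasing R (fun y => npdf y + y * Phi y) x) => //.
  apply: (@is_derive_nondecreasing R (fun y => npdf y + y * Phi y) (fun y => Phi y)).
    by move=> y; apply: is_derive_eq; rewrite /GRing.scale /=; ring.
  by move=> y _; exact: Phi_ge0.
move=> e e0; have [A A1 hA] := npdf_tail e0; exists A => y yA.
have := hA _ yA; have y1 : y <= -1 by lra.
have yy : 0 <= y ^+ 2 + y by nra.
have := mulr_ge0 yy (ltW (npdf_gt0 y)).
have h1 : 0 <= - y by lra.
have h2 : 0 <= npdf y - Phi y by rewrite subr_ge0 Phi_le_npdf.
by have := mulr_ge0 h1 h2; have := npdf_gt0 y; lra.
Qed.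

(** The derivative is twice the quantity of [npdfD_mulPhi_ge0]. Divided by [npdf x], this expression
    is itself the derivative of x * Phi x / npdf x, whose monotonicity Stein's method needs. *)
Lemma mills_aux x : 0 <= (1 + x ^+ 2) * Phi x + x * npdf x.
Proof.
apply: (@ge0_of_nondecreasing R (fun y => (1 + y ^+ 2) * Phi y + y * npdf y) x) => //.
  apply: (@is_derive_nondecreasing R (fun y => (1 + y ^+ 2) * Phi y + y * npdf y) (fun y => 2 * (npdf y + y * Phi y))).
    by move=> y; apply: is_derive_eq; rewrite /GRing.scale /=; ring.
  by move=> y _; have := npdfD_mulPhi_ge0 y; lra.
move=> e e0; have [A A1 hA] := npdf_tail e0; exists A => y yA.
have := hA _ yA; have y1 : y <= -1 by lra.
have yy : 0 <= y ^+ 2 + y by nra.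
have := mulr_ge0 yy (ltW (npdf_gt0 y)).
have := mulr_ge0 (sqr_ge0 y) (Phi_ge0 y).
by have := Phi_ge0 y; lra.
Qed.

(** The reflected Mills ratio: [mpsi (- t)] is (1 - Phi t) / npdf t. It solves psi' = 1 + w psi, the
    homogeneous part of Stein's equation up to a constant source. *)
Definition mpsi w : R := Phi w / npdf w.

Lemma mpsi_ge0 w : 0 <= mpsi w.
Proof. by rewrite divr_ge0 ?Phi_ge0// ltW// npdf_gt0. Qed.

Lemma is_derive_mpsi w : is_derive w 1 mpsi (1 + w * mpsi w).
Proof.
have n0 : npdf w != 0 by rewrite lt0r_neq0// npdf_gt0.
rewrite /mpsi; apply: is_derive_eq; rewrite /GRing.scale /=.
by field.
Qed.

#[local] Instance is_derive_mpsi_inst w : is_derive w 1 mpsi (1 + w * mpsi w) := is_derive_mpsi w.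

Lemma mul_mpsi_geN1 w : -1 <= w * mpsi w.
Proof.
rewrite /mpsi mulrA ler_pdivlMr ?npdf_gt0//.
by have := npdfD_mulPhi_ge0 w; lra.
Qed.

Lemma mul_mpsi_nondecreasing : {homo (fun w => w * mpsi w) : x y / x <= y}.
Proof.
move=> x y xy.
apply: (@is_derive_nondecreasing R (fun w => w * mpsi w) (fun w => mpsi w + w * (1 + w * mpsi w)) y) => //.
  by move=> w; apply: is_derive_eq; rewrite /GRing.scale /=; ring.
move=> w _; have P0 := npdf_gt0 w.
have -> : mpsi w + w * (1 + w * mpsi w) = ((1 + w ^+ 2) * Phi w + w * npdf w) / npdf w.
  by rewrite /mpsi; field; rewrite lt0r_neq0.
by rewrite divr_ge0 ?mills_aux// ltW.
Qed.

Lemma mpsi_nondecreasing : {homo mpsi : x y / x <= y}.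
Proof.
move=> x y xy; apply: (@is_derive_nondecreasing R mpsi (fun w => 1 + w * mpsi w) y) => //.
by move=> w _; have := mul_mpsi_geN1 w; lra.
Qed.

(** For t >= 1, [mills_aux] gives the ratio t / (1 + t^2), at least 1 / (2 (1 + t)); for t <= 1
    monotonicity compares with [mpsi (-1)], which is at least 1/2. *)
Lemma mills_lower t : 0 <= t -> npdf t <= 2 * (1 + t) * Phi (- t).
Proof.
move=> t0.
suff : (2 * (1 + t))^-1 <= mpsi (- t).
  rewrite /mpsi npdfN ler_pdivlMr ?npdf_gt0// mulrC ler_pdivrMr; first lra.
  lra.
have [t1|/ltW t1] := leP t 1.
  have h1 := mills_aux (-1).
  have : 2^-1 <= mpsi (-1).
    by rewrite /mpsi ler_pdivlMr ?npdf_gt0//; lra.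
  move=> h; apply: le_trans (mpsi_nondecreasing (_ : -1 <= - t)); last lra.
  by apply: le_trans h; rewrite lef_pV2 ?posrE; lra.
have h1 := mills_aux (- t); have P0 := npdf_gt0 t.
rewrite /mpsi npdfN ler_pdivlMr// mulrC ler_pdivrMr; last lra.
move: h1; rewrite npdfN sqrrN => h1.
have : 0 <= Phi (- t) by exact: Phi_ge0.
nra.
Qed.
End Mills.

(** * Stein's equation *)

Section SteinSolution.
Variable R : realType.
Implicit Types (a b t w : R).
Local Notation Phi := (Phi R).
Local Notation npdf := (@npdf R).

(* The solution f of f'(w) - w f(w) = 1{w <= t} - Phi(t). *)
Definition stein_f t w : R :=
  if w <= t then Phi (- t) * mpsi w else Phi t * mpsi (- w).
Definition stein_g t w : R := w * stein_f t w.
Definition stein_f' t w : R := stein_g t w + (w <= t)%R%:R - Phi t.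

Lemma mpsi_diff a b : a <= b ->
  (b - a) * (1 + a * mpsi a) <= mpsi b - mpsi a <= (b - a) * (1 + b * mpsi b).
Proof.
move=> ab; have [c /andP[ac cb] ->] := mvt_is_derive ab (@is_derive_mpsi R).
rewrite [(1 + c * mpsi c) * _]mulrC; have ba : 0 <= b - a by rewrite subr_ge0.
by apply/andP; split; apply: ler_wpM2l => //; rewrite lerD2l mul_mpsi_nondecreasing.
Qed.

Lemma stein_f_ge t w : t <= w -> stein_f t w = Phi t * mpsi (- w).
Proof.
rewrite /stein_f; case: ifP => // wt tw; have -> : w = t :> R by lra.
by rewrite /mpsi npdfN; ring.
Qed.

Lemma stein_g_nondecreasing t : {homo stein_g t : a b / a <= b}.
Proof.
have lo a b : a <= b -> b <= t -> stein_g t a <= stein_g t b.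
  move=> ab bt; rewrite /stein_g /stein_f bt (le_trans ab bt) (mulrCA a) (mulrCA b).
  by rewrite ler_wpM2l ?Phi_ge0// mul_mpsi_nondecreasing.
have hi a b : a <= b -> t <= a -> stein_g t a <= stein_g t b.
  move=> ab ta; rewrite /stein_g !stein_f_ge ?(le_trans ta)// (mulrCA a) (mulrCA b).
  rewrite ler_wpM2l ?Phi_ge0//.
  have : (- b) * mpsi (- b) <= (- a) * mpsi (- a).
    by apply: mul_mpsi_nondecreasing; rewrite lerN2.
  lra.
move=> a b ab; case: (leP b t) => [|/ltW tb]; first exact: lo.
case: (leP t a) => [|/ltW at_]; first exact: hi.
exact: le_trans (lo _ _ at_ (lexx _)) (hi _ _ tb (lexx _)).
Qed.

(** A mean value bracket that survives the kink at t, proved on each side and added at t. The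
    increasing part [stein_g] and the decreasing indicator are evaluated at opposite ends. *)
Lemma stein_f_diff t a b : a <= b ->
  (b - a) * (stein_g t a + (b <= t)%R%:R - Phi t) <= stein_f t b - stein_f t a
    <= (b - a) * (stein_g t b + (a <= t)%R%:R - Phi t).
Proof.
have Ps := Phi_sym t; have Q0 := Phi_ge0 (- t); have P0 := Phi_ge0 t.
have lo x y : x <= y -> y <= t ->
  (y - x) * (stein_g t x + 1 - Phi t) <= stein_f t y - stein_f t x
    <= (y - x) * (stein_g t y + 1 - Phi t).
  move=> xy yt; have := mpsi_diff xy.
  rewrite /stein_g /stein_f yt (le_trans xy yt).
  move=> /andP[/(ler_wpM2l Q0) h1 /(ler_wpM2l Q0) h2].
  have E u v : (y - x) * (u * (Phi (- t) * v) + 1 - Phi t) =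
    Phi (- t) * ((y - x) * (1 + u * v)) by rewrite Ps; ring.
  by rewrite !E; move: h1 h2; rewrite mulrBr => -> ->.
have hi x y : x <= y -> t <= x ->
  (y - x) * (stein_g t x - Phi t) <= stein_f t y - stein_f t x
    <= (y - x) * (stein_g t y - Phi t).
  move=> xy tx; have yx : - y <= - x by rewrite lerN2.
  have := mpsi_diff yx.
  rewrite /stein_g !stein_f_ge ?(le_trans tx)//.
  move=> /andP[/(ler_wpM2l P0) h1 /(ler_wpM2l P0) h2].
  by apply/andP; split; lra.
move=> ab; case: (leP b t) => bt; first by rewrite (le_trans ab bt); exact: lo.
have tb := ltW bt.
case: (leP a t) => at_; last first.
  by rewrite !addr0; exact: hi _ _ ab (ltW at_).
have /andP[h1 h2] := lo _ _ at_ (lexx t); have /andP[h3 h4] := hi _ _ tb (lexx t).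
have ga : stein_g t a <= stein_g t t by exact: stein_g_nondecreasing.
have gb : stein_g t t <= stein_g t b by exact: stein_g_nondecreasing.
rewrite /= addr0; have t1 : 0 <= t - a by lra.
have t2 : 0 <= b - t by lra.
have e1 := ler_wpM2l t2 ga; have e2 := ler_wpM2l t1 gb.
apply/andP; split; first by move: h1 h3; lra.
by move: h2 h4; lra.
Qed.

(** The bound is (b - a) times the increment of the nondecreasing function stein_g + 1{. > t}. This
    form, rather than a Lipschitz bound, is what [stein_approx] can integrate by parts. *)
Lemma stein_f_taylor t a b w : a <= b -> a <= w <= b ->
  `|stein_f t b - stein_f t a - (b - a) * stein_f' t w|
    <= (b - a) * (stein_g t b + (b > t)%R%:R - (stein_g t a + (a > t)%R%:R)).
Proof.
move=> ab /andP[aw wb]; have := stein_f_diff t ab => /andP[h1 h2].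
have g1 : stein_g t a <= stein_g t w by exact: stein_g_nondecreasing.
have g2 : stein_g t w <= stein_g t b by exact: stein_g_nondecreasing.
have E x : (x > t)%R%:R = 1 - (x <= t)%R%:R :> R.
  by rewrite ltNge; case: (x <= t) => /=; rewrite ?subrr ?subr0.
have i1 : (w <= t)%R%:R <= (a <= t)%R%:R :> R.
  by case: (leP w t) => wt //; rewrite (le_trans aw wt).
have i2 : (b <= t)%R%:R <= (w <= t)%R%:R :> R.
  by case: (leP b t) => bt //; rewrite (le_trans wb bt).
have ba : 0 <= b - a by rewrite subr_ge0.
rewrite !E ler_norml /stein_f'; apply/andP; split.
  have := ler_wpM2l ba (_ : stein_g t w + (w <= t)%R%:R - (stein_g t b + (a <= t)%R%:R) <= 0).
  have := ler_wpM2l ba g2; have := ler_wpM2l ba i1; lra.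
have := ler_wpM2l ba g1; have := ler_wpM2l ba i2; lra.
Qed.

(** The factor [Phi (- t)] below t makes the final error relative; the constant 2 above t is
    compensated later by exp (t (w - t)). *)
Definition stein_env t w : R :=
  if w <= t then Phi (- t) * (1 + 3 * Num.max w 0 * expR (w ^+ 2 / 2)) else 2.

Lemma mul_mpsi_le0 w : w <= 0 -> w * mpsi w <= 0.
Proof. by move=> w0; have := mul_mpsi_nondecreasing w0; rewrite mul0r. Qed.

Lemma mul_mpsi_le w : 0 <= w -> 0 <= w * mpsi w <= 3 * w * expR (w ^+ 2 / 2).
Proof.
move=> w0; rewrite mulr_ge0 ?mpsi_ge0//= mulrAC (mulrC _ w) ler_wpM2l//.
rewrite /mpsi npdf_inv; apply: le_trans (_ : 1 * (3 * expR (w ^+ 2 / 2)) <= _); last by rewrite mul1r.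
apply: ler_pM; rewrite ?Phi_ge0 ?Phi_le1//.
by rewrite ler_wpM2r ?expR_ge0 ?sqrt2pi_le3.
Qed.

Lemma stein_env_bound t w : 0 <= t ->
  `|stein_f' t w| <= stein_env t w /\ `|stein_g t w + (w > t)%R%:R| <= stein_env t w.
Proof.
move=> t0; have Ps := Phi_sym t; have Q0 := Phi_ge0 (- t); have P0 := Phi_ge0 t.
have P1 := Phi_le1 t.
rewrite /stein_f' /stein_g /stein_env; case: (leP w t) => [wt|tw]; last first.
  have w0 : - w <= 0 by lra.
  have h1 := mul_mpsi_le0 w0; have h2 := mul_mpsi_geN1 (- w).
  rewrite stein_f_ge ?(ltW tw)//=.
  have E : w * (Phi t * mpsi (- w)) = - (Phi t * (- w * mpsi (- w))) by ring.
  have k1 : Phi t * (- w * mpsi (- w)) <= 0 by rewrite mulr_ge0_le0.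
  have k2 : - Phi t <= Phi t * (- w * mpsi (- w)) by rewrite -mulrN1 ler_wpM2l.
  rewrite E; move: k1 k2 P0 P1; generalize (Phi t * (- w * mpsi (- w))) => x *.
  by split; rewrite ler_norml; apply/andP; split; lra.
have Pt : Phi t = 1 - Phi (- t) by lra.
rewrite /stein_f wt addr0 (mulrCA w) Pt mulr1n.
(* Below t both quantities are [Phi (- t)] times 1 + z or z, with z = w * mpsi w >= -1. *)
have core z v : -1 <= z -> z <= v -> 0 <= v ->
  `|Phi (- t) * z + 1 - (1 - Phi (- t))| <= Phi (- t) * (1 + v) /\
  `|Phi (- t) * z| <= Phi (- t) * (1 + v).
  have -> : Phi (- t) * z + 1 - (1 - Phi (- t)) = Phi (- t) * (1 + z) by ring.
  move=> z1 zv v0; rewrite !normrM (ger0_norm Q0).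
  by split; rewrite ler_wpM2l// ler_norml; apply/andP; split; lra.
apply: core; first exact: mul_mpsi_geN1.
  case: (leP w 0) => [w0|/ltW w0]; first by rewrite mulr0 mul0r mul_mpsi_le0.
  by have /andP[_] := mul_mpsi_le w0.
by rewrite mulr_ge0 ?expR_ge0// mulr_ge0// le_max lexx orbT.
Qed.
End SteinSolution.

(** * Bernoulli product measure *)

Section Bernoulli.
Variables (R : realType) (T : finType) (p : R).
Hypotheses (p0 : 0 < p) (p1 : p < 1).
Implicit Types (V S om : {set T}) (F G : {set T} -> R) (a b : T).

Definition bern_w V om : R := p ^+ #|om| * (1 - p) ^+ #|V :\: om|.
Definition bE V F : R := \sum_(om : {set T} | om \subset V) bern_w V om * F om.
Definition ind S om : R := (S \subset om)%:R.
Definition cin a om : R := (a \in om)%:R - p.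

Lemma bern_w_ge0 V om : 0 <= bern_w V om.
Proof. by rewrite mulr_ge0// exprn_ge0//; [exact: ltW | rewrite subr_ge0 ltW]. Qed.

Lemma eq_bE V F G : (forall om, om \subset V -> F om = G om) -> bE V F = bE V G.
Proof. by move=> FG; apply: eq_bigr => om omV; rewrite FG. Qed.

Lemma ler_bE V F G : (forall om, om \subset V -> F om <= G om) -> bE V F <= bE V G.
Proof. by move=> FG; apply: ler_sum => om omV; rewrite ler_wpM2l ?bern_w_ge0 ?FG. Qed.

Lemma bED V F G : bE V (fun om => F om + G om) = bE V F + bE V G.
Proof. by rewrite -big_split; apply: eq_bigr => om _; rewrite mulrDr. Qed.

Lemma bEB V F G : bE V (fun om => F om - G om) = bE V F - bE V G.
Proof. by rewrite -sumrB; apply: eq_bigr => om _; rewrite mulrBr. Qed.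

Lemma bEZ V (c : R) F : bE V (fun om => c * F om) = c * bE V F.
Proof. by rewrite mulr_sumr; apply: eq_bigr => om _; rewrite mulrCA. Qed.

Lemma bE_sum V (I : finType) (P : pred I) (F : I -> {set T} -> R) :
  bE V (fun om => \sum_(i | P i) F i om) = \sum_(i | P i) bE V (F i).
Proof.
by rewrite exchange_big; apply: eq_bigr => om _; rewrite mulr_sumr.
Qed.

Lemma bE_ge0 V F : (forall om, om \subset V -> 0 <= F om) -> 0 <= bE V F.
Proof. by move=> F0; apply: sumr_ge0 => om omV; rewrite mulr_ge0 ?bern_w_ge0 ?F0. Qed.

Lemma ler_norm_bE V F : `|bE V F| <= bE V (fun om => `|F om|).
Proof.
apply: le_trans (ler_norm_sum _ _ _) _; apply: ler_sum => om _.
by rewrite normrM ger0_norm ?bern_w_ge0.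
Qed.

Lemma bE_setD1 V a F : a \in V ->
  bE V F = p * bE (V :\ a) (fun om => F (a |: om)) + (1 - p) * bE (V :\ a) F.
Proof.
move=> aV; rewrite /bE (bigID (fun om => a \in om)) /=; congr (_ + _).
  rewrite (reindex_onto (fun om : {set T} => a |: om) (fun om => om :\ a)) /=; last first.
    by move=> om /andP[_ aom]; rewrite setD1K.
  rewrite mulr_sumr; apply: eq_big => om.
    rewrite subUset sub1set aV setU11 /= andbT subsetD1; congr andb.
    apply/eqP/idP => [<-|aom]; last by rewrite setU1K.
    by rewrite setD11.
  rewrite andbC => /andP[/eqP omE _].
  have aom : a \notin om by rewrite -omE setD11.
  rewrite mulrA; congr (_ * _).
  by rewrite /bern_w cardsU1 aom exprS -mulrA setDDl.
rewrite mulr_sumr; apply: eq_big => om; first by rewrite subsetD1.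
move=> /andP[_ aom]; rewrite mulrA; congr (_ * _).
rewrite /bern_w mulrCA; congr (_ * _).
by rewrite -exprS (cardsD1 a (V :\: om)) !inE aom aV !setDDl setUC.
Qed.

(** The coordinate [a] is overwritten instead of removed, so conditioning keeps the ground set [V]
    and can be repeated. *)
Lemma bE_split V a F : a \in V ->
  bE V F = p * bE V (fun om => F (a |: om)) + (1 - p) * bE V (fun om => F (om :\ a)).
Proof.
move=> aV; rewrite (bE_setD1 F aV) !(bE_setD1 _ aV).
have E1 : bE (V :\ a) (fun om => F (a |: (a |: om))) = bE (V :\ a) (fun om => F (a |: om)).
  by apply: eq_bE => om _; rewrite setUA setUid.
have E2 : bE (V :\ a) (fun om => F ((a |: om) :\ a)) = bE (V :\ a) F.
  by apply: eq_bE => om; rewrite subsetD1 => /andP[_ h]; rewrite setU1K.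
have E3 : bE (V :\ a) (fun om => F (om :\ a)) = bE (V :\ a) F.
  apply: eq_bE => om; rewrite subsetD1 => /andP[_ h].
  by congr F; apply/setP => x; rewrite !inE; case: eqP => // ->; rewrite (negbTE h).
by rewrite E1 E2 E3; ring.
Qed.

Lemma bE_cst V (c : R) : bE V (fun=> c) = c.
Proof.
elim: {V}#|V| {-2}V (leqnn #|V|) => [|k IH] V.
  rewrite leqn0 cards_eq0 => /eqP ->.
  rewrite /bE (big_pred1 finset.set0) => [|om]; last by rewrite subset0.
  by rewrite /bern_w setD0 cards0 !expr0 !mul1r.
have [->|[a aV]] := set_0Vmem V; first by move=> _; apply: IH; rewrite cards0.
by rewrite (cardsD1 a) aV ltnS => /IH E; rewrite (bE_setD1 _ aV) E; ring.
Qed.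

Lemma bE_ind V S G : S \subset V ->
  bE V (fun om => ind S om * G om) = p ^+ #|S| * bE V (fun om => G (S :|: om)).
Proof.
elim: {S}#|S| {-2}S (leqnn #|S|) G => [|k IH] S.
  rewrite leqn0 cards_eq0 => /eqP -> G _.
  rewrite cards0 expr0 mul1r; apply: eq_bE => om _.
  by rewrite /ind sub0set mul1r set0U.
have [->|[a aS]] := set_0Vmem S.
  by move=> _; apply: IH; rewrite cards0.
rewrite (cardsD1 a) aS ltnS => /IH {}IH G SV; have aV := subsetP SV _ aS.
rewrite (bE_split _ aV) [X in _ * X](_ : _ = bE V (fun om => ind (S :\ a) om * G (a |: om))); last first.
  apply: eq_bE => om _; congr (_%:R * _); congr nat_of_bool.
  apply/subsetP/subsetP => h x; last by move: (h x); rewrite !inE; case: (x == a).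
  by rewrite !inE => /andP[xa /h]; rewrite !inE (negbTE xa).
rewrite IH; last exact: subset_trans (subsetDl _ _) SV.
rewrite [X in (1 - p) * X](_ : _ = 0); last first.
  rewrite -[RHS](bE_cst V); apply: eq_bE => om _.
  rewrite /ind; case: (boolP (S \subset _)); rewrite ?mul0r//.
  by move=> /subsetP/(_ _ aS); rewrite !inE eqxx.
rewrite mulr0 addr0 exprS mulrA; congr (_ * _); apply: eq_bE => om _.
by congr G; apply/setP => x; rewrite !inE; case: eqVneq => // ->; rewrite aS.
Qed.

Lemma bE_ind1 V S : S \subset V -> bE V (ind S) = p ^+ #|S|.
Proof.
move=> /(bE_ind (fun=> 1)); rewrite bE_cst mulr1 => <-.
by apply: eq_bE => om _; rewrite mulr1.
Qed.

Lemma bE_ibp V a F : a \in V ->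
  bE V (fun om => cin a om * F om)
  = p * (1 - p) * bE V (fun om => F (a |: om) - F (om :\ a)).
Proof.
move=> aV; rewrite (bE_split _ aV) bEB.
rewrite [X in p * X + _](_ : _ = (1 - p) * bE V (fun om => F (a |: om))); last first.
  by rewrite -bEZ; apply: eq_bE => om _; rewrite /cin setU11.
rewrite [X in _ + _ * X](_ : _ = - p * bE V (fun om => F (om :\ a))); last first.
  by rewrite -bEZ; apply: eq_bE => om _; rewrite /cin setD11 sub0r.
by ring.
Qed.

(** Conditioning on [a] gives p (1 - p) times the sum of the means with and without [a];
    monotonicity bounds the second by the first. The gain is a factor 1 - p, with [a] now forced
    present. *)
Lemma bE_cin_abs V a F : a \in V ->
  (forall om, 0 <= F om) -> (forall om, F (om :\ a) <= F (a |: om)) ->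
  bE V (fun om => `|cin a om| * F om) <= 2 * (1 - p) * bE V (fun om => ind [set a] om * F om).
Proof.
move=> aV F0 Fle; have p0' := p0; have p1' := p1.
rewrite (bE_split (fun om => `|cin a om| * F om) aV).
rewrite (bE_split (fun om => ind [set a] om * F om) aV).
rewrite [X in p * X + _](_ : _ = (1 - p) * bE V (fun om => F (a |: om))); last first.
  by rewrite -bEZ; apply: eq_bE => om _; rewrite /cin setU11 ger0_norm// subr_ge0 ltW.
rewrite [X in _ + _ * X <= _](_ : _ = p * bE V (fun om => F (om :\ a))); last first.
  by rewrite -bEZ; apply: eq_bE => om _; rewrite /cin setD11 sub0r normrN gtr0_norm.
rewrite [X in _ <= _ * (p * X + _)](_ : _ = bE V (fun om => F (a |: om))); last first.
  by apply: eq_bE => om _; rewrite /ind sub1set setU11 mul1r.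
rewrite [X in _ <= _ * (_ + _ * X)](_ : _ = 0); last first.
  by rewrite -[RHS](bE_cst V); apply: eq_bE => om _; rewrite /ind sub1set setD11 mul0r.
have := ler_bE (V := V) (fun om _ => Fle om).
set x := bE V _; set y := bE V _ => yx.
have : p * (1 - p) * x <= p * (1 - p) * y.
  by rewrite ler_wpM2l// mulr_ge0 ?subr_ge0// ltW.
lra.
Qed.
End Bernoulli.

(** * Clark-Ocone formula and tilting *)

Section Hypergraph.
Variables (R : realType) (T : finType) (p : R).
Hypotheses (p0 : 0 < p) (p1 : p < 1).
Variables (V : {set T}) (M : {set {set T}}) (sg : R).
Hypotheses (MV : forall i, i \in M -> i \subset V) (sg0 : 0 < sg).
Implicit Types (A B K S om i j k : {set T}) (a b : T) (l : R).

Local Notation E := (bE p V).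

Lemma ind_setU1 S a om : ind R S (a |: om) = ind R (S :\ a) om.
Proof.
rewrite /ind; congr _%:R; congr nat_of_bool; apply/subsetP/subsetP => h x.
  by rewrite !inE => /andP[xa /h]; rewrite !inE (negbTE xa).
by move: (h x); rewrite !inE; case: (x == a).
Qed.

Lemma ind_setD1 S a om : ind R S (om :\ a) = (a \notin S)%:R * ind R S om.
Proof. by rewrite /ind subsetD1 andbC -natrM mulnb. Qed.

Lemma ind_setU S S' om : ind R (S :|: S') om = ind R S om * ind R S' om.
Proof. by rewrite /ind subUset -natrM mulnb. Qed.

Lemma ind_set1 a om : ind R [set a] om = (a \in om)%:R.
Proof. by rewrite /ind sub1set. Qed.

Lemma ind_set0 om : ind R finset.set0 om = 1.
Proof. by rewrite /ind sub0set. Qed.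

Lemma ind_ge0 S om : 0 <= ind R S om. Proof. exact: ler0n. Qed.

Lemma ind_le1 S om : ind R S om <= 1. Proof. by rewrite lern1 leq_b1. Qed.

Lemma ind_homo S om om' : om \subset om' -> ind R S om <= ind R S om'.
Proof.
by rewrite /ind => h; case: (boolP (S \subset om)) => // /subset_trans ->.
Qed.

(** In the Clark-Ocone formula the coordinates revealed after [a] stay as indicators ([hi]), while
    those before [a] are averaged to powers of p ([lo]). *)
Definition hi i a := [set b in i | (enum_rank a < enum_rank b)%N].
Definition lo i a := [set b in i | (enum_rank b < enum_rank a)%N].

Lemma enum_rank_natI a b : (enum_rank a : nat) = enum_rank b -> a = b.
Proof. by move=> h; apply: enum_rank_inj; exact: ord_inj. Qed.

Lemma hi_sub i a : hi i a \subset i.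
Proof. by apply/subsetP => b; rewrite inE => /andP[]. Qed.

Lemma hi_notin i a : a \notin hi i a.
Proof. by rewrite inE ltnn andbF. Qed.

Lemma set_lo_hi i a : i \subset lo i a :|: (a |: hi i a).
Proof.
apply/subsetP => b bi; rewrite !inE bi /=.
by case: ltngtP => [||/enum_rank_natI ->]; rewrite ?orbT ?eqxx.
Qed.

(* Discrete Clark-Ocone formula: the product telescopes along the enumeration order. *)
Lemma clark_ocone i om :
  ind R i om - p ^+ #|i| = \sum_(a in i) cin p a om * (p ^+ #|lo i a| * ind R (hi i a) om).
Proof.
elim: {i}#|i| {-2}i (leqnn #|i|) => [|n IH] i.
  rewrite leqn0 cards_eq0 => /eqP ->.
  by rewrite big_set0 cards0 /ind sub0set subrr.
have [->|[a0 a0i]] := set_0Vmem i.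
  by rewrite big_set0 cards0 /ind sub0set subrr.
(* The last element is peeled off: for an earlier a it joins [hi] and leaves [lo] unchanged, while
   its own term has empty [hi]. *)
pose m := [arg max_(a > a0 in i) enum_rank a].
have [mi mmax] : m \in i /\ forall b, b \in i -> (enum_rank b <= enum_rank m)%N.
  by rewrite /m; case: arg_maxnP.
rewrite (cardsD1 m i) mi ltnS => /IH IHm.
rewrite (bigD1 m) //= [X in _ = _ + X](_ : _ =
    (m \in om)%:R * (ind R (i :\ m) om - p ^+ #|i :\ m|)); last first.
  rewrite IHm mulr_sumr; apply: eq_big => [a|a /andP[ai am]]; first by rewrite !inE andbC.
  have am' : (enum_rank a < enum_rank m)%N.
    rewrite ltn_neqAle mmax// andbT; apply: contra am => /eqP.
    by move=> /enum_rank_natI ->.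
  have -> : lo (i :\ m) a = lo i a.
    apply/setP => b; rewrite !inE; case: eqVneq => // -> /=.
    by rewrite ltnNge ltnW ?andbF.
  have -> : hi i a = m |: hi (i :\ m) a.
    by apply/setP => b; rewrite !inE; case: eqVneq => // -> /=; rewrite mi.
  by rewrite ind_setU ind_set1; ring.
have -> : hi i m = finset.set0.
  apply/setP => b; rewrite !inE; apply/negP => /andP[/mmax].
  by rewrite leqNgt => /negbTE ->.
have -> : lo i m = i :\ m.
  apply/setP => b; rewrite !inE andbC; case: (boolP (b \in i)); rewrite ?andbF // => bi.
  rewrite !andbT ltn_neqAle mmax// andbT; congr negb.
  by apply/eqP/eqP => [/enum_rank_natI|->].
rewrite (_ : ind R i om = (m \in om)%:R * ind R (i :\ m) om); last first.
  by rewrite -ind_set1 -ind_setU setD1K.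
by rewrite ind_set0 exprD expr1 /cin; ring.
Qed.

Definition cnt om : R := \sum_(i in M) ind R i om.
Definition mean : R := \sum_(i in M) p ^+ #|i|.
Definition cstd om : R := (cnt om - mean) / sg.

(* cstd = sum_a (X_a - p) Tw_a, and Dw_a is the difference of cstd in the coordinate a. *)
Definition Tw a om : R := \sum_(i in M | a \in i) p ^+ #|lo i a| * ind R (hi i a) om / sg.
Definition Dw a om : R := \sum_(i in M | a \in i) ind R (i :\ a) om / sg.

Lemma cstd_clark_ocone om : cstd om = \sum_a cin p a om * Tw a om.
Proof.
rewrite /cstd /cnt /mean -sumrB mulr_suml.
under eq_bigr => i _ do rewrite clark_ocone mulr_suml.
rewrite (exchange_big_dep xpredT) //=; apply: eq_bigr => a _.
by rewrite mulr_sumr; apply: eq_bigr => i _; ring.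
Qed.

Lemma Tw_ge0 a om : 0 <= Tw a om.
Proof.
apply: sumr_ge0 => i _.
by rewrite !mulr_ge0 ?ind_ge0 ?exprn_ge0 ?invr_ge0 ?(ltW p0) ?(ltW sg0).
Qed.

Lemma cstd_diff a om : cstd (a |: om) - cstd (om :\ a) = Dw a om.
Proof.
rewrite /cstd -mulrBl opprB addrA subrK -sumrB mulr_suml /Dw.
rewrite [RHS]big_mkcondr /=; apply: eq_bigr => i _.
rewrite ind_setU1 ind_setD1; case: (boolP (a \in i)) => ai /=; rewrite ?mul0r ?subr0//.
rewrite mul1r (_ : i :\ a = i) ?subrr ?mul0r//.
by apply/setP => x; rewrite !inE; case: eqVneq => // ->; rewrite (negbTE ai).
Qed.

Lemma Tw_indep a om : Tw a (a |: om) = Tw a om /\ Tw a (om :\ a) = Tw a om.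
Proof.
split; apply: eq_bigr => i _; rewrite ?ind_setU1 ?ind_setD1 ?hi_notin ?mul1r//.
congr (_ * ind _ _ _ / _).
by apply/setP => x; rewrite !inE; case: eqVneq => // ->; rewrite ltnn andbF.
Qed.

Lemma Dw_indep a om : Dw a (a |: om) = Dw a om /\ Dw a (om :\ a) = Dw a om.
Proof.
split; apply: eq_bigr => i _; rewrite ?ind_setU1 ?ind_setD1 ?setD11 ?mul1r//.
by congr (ind _ _ _ / _); apply/setP => x; rewrite !inE andbA andbb.
Qed.

Lemma bE_cnt : E cnt = mean.
Proof.
by rewrite /cnt bE_sum; apply: eq_bigr => i iM; rewrite bE_ind1 ?MV.
Qed.

Definition nb K k := (k \in M) && (k :&: K != finset.set0).

(** [A] lies in a union of m members of [M], repetitions allowed. The number m measures the length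
    of a chain: it governs both the loss under tilting and the constant of the next link. *)
Fixpoint cov m A : bool :=
  if m is m'.+1 then [exists i in M, cov m' (A :\: i)] else A == finset.set0.

Lemma cov_sub m A B : A \subset B -> cov m B -> cov m A.
Proof.
elim: m A B => [|m IH] A B AB /=.
  by move=> /eqP B0; move: AB; rewrite B0 subset0.
move=> /exists_inP[i iM h]; apply/exists_inP; exists i => //.
exact: IH (setSD _ AB) h.
Qed.

Lemma covU m m' A B : cov m A -> cov m' B -> cov (m + m') (A :|: B).
Proof.
elim: m A => [|m IH] A /=; first by move=> /eqP ->; rewrite set0U.
move=> /exists_inP[i iM h] hB; apply/exists_inP; exists i => //.
by apply: cov_sub (IH _ h hB); rewrite setDUl setUS// subsetDl.
Qed.

Lemma cov1 i : i \in M -> cov 1 i.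
Proof. by move=> iM; apply/exists_inP; exists i => //; rewrite setDv. Qed.

Lemma nb_sub A B k : A \subset B -> nb A k -> nb B k.
Proof.
move=> AB /andP[kM h]; rewrite /nb kM; apply: contraNneq h => h.
by rewrite -subset0 -h setIS.
Qed.

Section Tilt.
Variable D : nat.
Hypothesis HD : forall i, i \in M -> (#|[set k | nb i k]| <= D)%N.

Lemma card_nb_cov m A : cov m A -> (#|[set k | nb A k]| <= m * D)%N.
Proof.
elim: m A => [|m IH] A /=.
  move=> /eqP ->; rewrite mul0n leqn0 cards_eq0; apply/eqP/setP => k.
  by rewrite !inE /nb setI0 eqxx andbF.
move=> /exists_inP[i iM h].
have sub : [set k | nb A k] \subset [set k | nb i k] :|: [set k | nb (A :\: i) k].
  apply/subsetP => k; rewrite !inE /nb => /andP[-> /set0Pn[x]]; rewrite inE => /andP[xk xA] /=.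
  case: (boolP (x \in i)) => xi; apply/orP; [left|right]; apply/set0Pn; exists x.
    by rewrite inE xk.
  by rewrite !inE xk xi.
apply: leq_trans (subset_leq_card sub) _.
apply: leq_trans (leq_card_setU _ _).1 _.
by rewrite mulSn leq_add ?HD ?IH.
Qed.

(** Adding [S] can complete only members that meet [S], at most m * D of them. This is how D enters
    the exponent. *)
Lemma cstd_setU m S om : cov m S -> cstd (S :|: om) <= cstd om + (m * D)%:R / sg.
Proof.
move=> cS; rewrite /cstd -mulrDl ler_pM2r ?invr_gt0// addrAC lerD2r -lerBlDl.
rewrite -sumrB; apply: le_trans (_ : (#|[set k | nb S k]|)%:R <= _); last first.
  by rewrite ler_nat card_nb_cov.
rewrite -sum1_card natr_sum [leRHS](eq_bigl (nb S)); last by move=> k; rewrite inE.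
rewrite /nb big_mkcondr /=; apply: ler_sum => i iM.
case: (boolP (_ == _)) => h /=; last first.
  by apply: le_trans (ind_le1 i (S :|: om)); rewrite lerBlDr lerDl ind_ge0.
rewrite lerBlDr add0r /ind; case: (boolP (i \subset _)) => // hi.
suff -> : i \subset om by [].
apply/subsetP => x xi; move: (subsetP hi _ xi); rewrite inE => /orP[xS|//].
have : x \in i :&: S by rewrite inE xi.
by rewrite (eqP h) inE.
Qed.

Definition mgf l : R := E (fun om => expR (l * cstd om)).

Lemma mgf_ge0 l : 0 <= mgf l.
Proof. by apply: bE_ge0 => // om _; exact: expR_ge0. Qed.

Lemma tilt_cov m S l : 0 <= l -> S \subset V -> cov m S ->
  E (fun om => ind R S om * expR (l * cstd om))
  <= p ^+ #|S| * (expR (l * (m * D)%:R / sg) * mgf l).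
Proof.
move=> l0 SV cS; rewrite bE_ind//; rewrite ler_wpM2l ?exprn_ge0 ?(ltW p0)//.
rewrite -bEZ; apply: ler_bE => // om _.
by rewrite -expRD ler_expR -mulrA -mulrDr ler_wpM2l// addrC cstd_setU.
Qed.

End Tilt.
End Hypergraph.

(** * Mixed second difference of the exponential *)

Section MixedDifference.
Variable R : realType.
Implicit Types (x l : R).

Lemma onem_expRN x : 0 <= x -> 0 <= 1 - expR (- x) <= x.
Proof.
move=> x0; have := expR_ge1Dx (- x) => h; apply/andP; split; last by lra.
by rewrite subr_ge0 -[leRHS](@expR0 R) ler_expR oppr_le0.
Qed.

(** With exp (l x) factored out, the difference is (1 - u)(1 - v) + w (1 - z) for exponentials u, v,
    w, z in [0, 1]. The product gives l^2 da db, the second summand l dab. *)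
Lemma expR_mixed_diff l x da db dab : 0 <= l -> 0 <= dab -> dab <= da -> dab <= db ->
  0 <= expR (l * x) - expR (l * (x - da)) - expR (l * (x - db)) + expR (l * (x - da - db + dab))
    <= (l * dab + l ^+ 2 * (da * db)) * expR (l * x).
Proof.
move=> l0 d0 dda ddb.
have -> : expR (l * (x - da)) = expR (- (l * da)) * expR (l * x).
  by rewrite -expRD; congr expR; ring.
have -> : expR (l * (x - db)) = expR (- (l * db)) * expR (l * x).
  by rewrite -expRD; congr expR; ring.
have -> : expR (l * (x - da - db + dab)) =
    (expR (- (l * da)) * expR (- (l * db)) +
     expR (- (l * (da + db - dab))) * (1 - expR (- (l * dab)))) * expR (l * x).
  have -> : expR (- (l * da)) * expR (- (l * db)) =
      expR (- (l * (da + db - dab))) * expR (- (l * dab)).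
    by rewrite -!expRD; congr expR; ring.
  transitivity (expR (- (l * (da + db - dab))) * expR (l * x)); last by ring.
  by rewrite -expRD; congr expR; ring.
set u := expR (- (l * da)); set v := expR (- (l * db)).
set w := expR (- (l * (da + db - dab))); set z := expR (- (l * dab)).
have -> : expR (l * x) - u * expR (l * x) - v * expR (l * x)
    + (u * v + w * (1 - z)) * expR (l * x) =
    ((1 - u) * (1 - v) + w * (1 - z)) * expR (l * x) by ring.
have /andP[u0 u1] : 0 <= 1 - u <= l * da.
  by apply: onem_expRN; rewrite mulr_ge0// (le_trans d0).
have /andP[v0 v1] : 0 <= 1 - v <= l * db.
  by apply: onem_expRN; rewrite mulr_ge0// (le_trans d0).
have /andP[z0 z1] : 0 <= 1 - z <= l * dab by apply: onem_expRN; rewrite mulr_ge0.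
have w1 : w <= 1.
  rewrite /w -[leRHS](@expR0 R) ler_expR oppr_le0 mulr_ge0//.
  by rewrite -addrA addr_ge0 ?subr_ge0// (le_trans d0).
have w0 : 0 <= w by exact: expR_ge0.
apply/andP; split.
  by rewrite mulr_ge0 ?expR_ge0// addr_ge0// mulr_ge0.
rewrite ler_wpM2r ?expR_ge0// addrC lerD//.
  by apply: le_trans z1; rewrite ler_piMl.
by rewrite (_ : l ^+ 2 * (da * db) = (l * da) * (l * db)); [exact: ler_pM|ring].
Qed.
End MixedDifference.

(** * Products of two centred coordinates under tilting *)

Section PairTerms.
Variables (R : realType) (T : finType) (p : R).
Hypotheses (p0 : 0 < p) (p1 : p < 1).
Variables (V : {set T}) (M : {set {set T}}) (sg : R).
Hypothesis sg0 : 0 < sg.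
Implicit Types (A B K S om i j k : {set T}) (a b : T) (l : R).

Local Notation E := (bE p V).
Local Notation ind := (ind R).
Local Notation W := (cstd p M sg).

Lemma cstd_homo om om' : om \subset om' -> W om <= W om'.
Proof.
move=> h; rewrite /cstd ler_pM2r ?invr_gt0// lerD2r.
by apply: ler_sum => i _; exact: ind_homo.
Qed.

Lemma expR_cstd_homo l om om' : 0 <= l -> om \subset om' ->
  expR (l * W om) <= expR (l * W om').
Proof. by move=> l0 h; rewrite ler_expR ler_wpM2l// cstd_homo. Qed.

(** For A = {a} with a present, the drop of W when a is deleted; for A = {a, b}, the part of both
    drops that is counted twice. *)
Definition deg A om : R := \sum_(k in M | A \subset k) ind k om / sg.

Lemma deg_ge0 A om : 0 <= deg A om.
Proof. by apply: sumr_ge0 => k _; rewrite mulr_ge0 ?ind_ge0// invr_ge0 ltW. Qed.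

Lemma deg_le A B om : A \subset B -> deg B om <= deg A om.
Proof.
move=> AB; rewrite /deg big_mkcondr [leRHS]big_mkcondr; apply: ler_sum => k kM.
case: (boolP (B \subset k)) => [/(subset_trans AB) ->//|_].
by case: ifP => // _; rewrite mulr_ge0 ?ind_ge0// invr_ge0 ltW.
Qed.

Lemma cstd_mixed a b om : a != b ->
  let o := a |: (b |: om) in
  [/\ W ((b |: om) :\ a) = W o - deg [set a] o,
      W (a |: (om :\ b)) = W o - deg [set b] o &
      W ((om :\ b) :\ a) = W o - deg [set a] o - deg [set b] o + deg [set a; b] o].
Proof.
move=> ab o.
(* The indicator of k with a and b switched on. The other three configurations follow from it by
   inclusion-exclusion. *)
pose c k := ind (k :\ a :\ b) om.
have c11 k : ind k o = c k by rewrite /o !ind_setU1.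
have rm x k : x \notin k -> k :\ x = k.
  move=> xk; apply/setP => y; rewrite !inE; case: eqVneq => // ->.
  by rewrite (negbTE xk).
have c01 k : ind k ((b |: om) :\ a) = c k - (a \in k)%:R * c k.
  rewrite ind_setD1 ind_setU1 /c; case: (boolP (a \in k)) => ak /=.
    by rewrite mul0r mul1r subrr.
  by rewrite (rm a k ak) mul1r mul0r subr0.
have c10 k : ind k (a |: (om :\ b)) = c k - (b \in k)%:R * c k.
  rewrite ind_setU1 ind_setD1 /c; rewrite !inE eq_sym ab /=.
  case: (boolP (b \in k)) => bk /=; first by rewrite mul0r mul1r subrr.
  by rewrite (rm b (k :\ a)) ?mul1r ?mul0r ?subr0// !inE (negbTE bk) andbF.
have c00 k : ind k ((om :\ b) :\ a) =
    c k - (a \in k)%:R * c k - (b \in k)%:R * c k + ([set a; b] \subset k)%:R * c k.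
  rewrite !ind_setD1 /c subUset !sub1set.
  case: (boolP (a \in k)) => ak; case: (boolP (b \in k)) => bk /=; rewrite ?mul0r ?mul1r ?addr0 ?subr0 ?subrr ?add0r ?addNr//.
  by rewrite (rm a k ak) (rm b k bk).
have degE A : deg A o = (\sum_(k in M) (A \subset k)%:R * c k) / sg.
  rewrite /deg big_mkcondr mulr_suml; apply: eq_bigr => k _.
  by case: ifP => _; rewrite ?mul0r// mul1r c11.
rewrite !degE /cstd /cnt; split.
- under eq_bigr => k _ do rewrite c01; under [in RHS]eq_bigr => k _ do rewrite c11.
  under [X in _ = _ - X / _]eq_bigr => k _ do rewrite sub1set.
  by rewrite sumrB; ring.
- under eq_bigr => k _ do rewrite c10; under [in RHS]eq_bigr => k _ do rewrite c11.
  under [X in _ = _ - X / _]eq_bigr => k _ do rewrite sub1set.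
  by rewrite sumrB; ring.
under eq_bigr => k _ do rewrite c00; under [in RHS]eq_bigr => k _ do rewrite c11.
under [X in _ = _ - X / _ - _ + _]eq_bigr => k _ do rewrite sub1set.
under [X in _ = _ - X / _ + _]eq_bigr => k _ do rewrite sub1set.
by rewrite big_split /= !sumrB; ring.
Qed.

Lemma cin_indep a b om : a != b ->
  cin p b (a |: om) = cin p b om /\ cin p b (om :\ a) = cin p b om.
Proof. by move=> ab; rewrite /cin !inE eq_sym (negbTE ab). Qed.

Lemma ind_indep S a om : a \notin S ->
  ind S (a |: om) = ind S om /\ ind S (om :\ a) = ind S om.
Proof.
move=> aS; rewrite ind_setD1 aS mul1r ind_setU1; split=> //; congr ind.
by apply/setP => y; rewrite !inE; case: eqVneq => // ->; rewrite (negbTE aS).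
Qed.

(** Neither a nor b occurs in [S], so integration by parts in a and then in b acts on exp (l W)
    alone and leaves its mixed difference, bounded by [expR_mixed_diff]. *)
Lemma unlinked_term a b S l : a \in V -> b \in V -> a != b -> a \notin S -> b \notin S ->
  S \subset V -> 0 <= l ->
  `|E (fun om => cin p a om * (cin p b om * (ind S om * expR (l * W om))))|
  <= (1 - p) ^+ 2 * E (fun om => ind (a |: (b |: S)) om *
       ((l * deg [set a; b] om + l ^+ 2 * (deg [set a] om * deg [set b] om)) * expR (l * W om))).
Proof.
move=> aV bV ab aS bS SV l0.
have q0 : 0 <= 1 - p by rewrite subr_ge0 ltW.
rewrite bE_ibp// (@eq_bE _ _ _ _ _ (fun om => cin p b om * (ind S om *
    (expR (l * W (a |: om)) - expR (l * W (om :\ a)))))); last first.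
  move=> om _; have [-> ->] := cin_indep om ab; have [-> ->] := ind_indep om aS.
  by ring.
rewrite bE_ibp// (@eq_bE _ _ _ _ _ (fun om => ind S om *
    (expR (l * W (a |: (b |: om))) - expR (l * W ((b |: om) :\ a))
     - expR (l * W (a |: (om :\ b))) + expR (l * W ((om :\ b) :\ a))))); last first.
  by move=> om _; have [-> ->] := ind_indep om bS; ring.
(* The two factors p left by integration by parts are exchanged for the presence of a and b. *)
have E2 G : p ^+ 2 * E (fun om => ind S om * G (a |: (b |: om))) =
    E (fun om => ind (a |: (b |: S)) om * G om).
  rewrite (@eq_bE _ _ _ _ (fun om => ind (a |: (b |: S)) om * G om)
    (fun om => ind (a |: [set b]) om * (ind S om * G om))); last first.
    by move=> om _; rewrite mulrA -ind_setU setUA.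
  rewrite [RHS]bE_ind; last by rewrite subUset !sub1set aV.
  rewrite cards2 ab; congr (_ * _); apply: eq_bE => om _.
  rewrite -setUA; have [-> _] := ind_indep (b |: om) aS.
  by have [-> _] := ind_indep om bS.
rewrite -E2 !mulrA normrM ger0_norm; last first.
  by rewrite !mulr_ge0 ?(ltW p0).
rewrite (_ : p * (1 - p) * p * (1 - p) = (1 - p) ^+ 2 * p * p); last by ring.
apply: ler_wpM2l; first by rewrite !mulr_ge0 ?(ltW p0).
apply: le_trans (ler_norm_bE p0 p1 _ _) _; apply: ler_bE => // om _.
have [-> -> ->] := cstd_mixed om ab.
set o := a |: (b |: om).
have sa : [set a] \subset [set a; b] by rewrite sub1set !inE eqxx.
have sb : [set b] \subset [set a; b] by rewrite sub1set !inE eqxx orbT.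
have /andP[h0 h1] := expR_mixed_diff (W o) l0 (deg_ge0 [set a; b] o) (deg_le o sa) (deg_le o sb).
by rewrite normrM (ger0_norm (ind_ge0 _ _ _)) ger0_norm// ler_wpM2l ?ind_ge0.
Qed.

(** No cancellation is sought here. Two uses of [bE_cin_abs] give 4 (1 - p)^2 when a and b differ,
    one use gives 2 (1 - p) when they coincide; 4 (1 - p) covers both. *)
Lemma linked_term a b S l : a \in V -> b \in V -> 0 <= l ->
  E (fun om => `|cin p a om * (cin p b om * (ind S om * expR (l * W om)))|)
  <= 4 * (1 - p) * E (fun om => ind (a |: (b |: S)) om * expR (l * W om)).
Proof.
move=> aV bV l0; have p0' := p0; have p1' := p1.
have q0 : 0 <= 1 - p by lra.
pose G om := ind S om * expR (l * W om).
have G0 om : 0 <= G om by rewrite mulr_ge0 ?ind_ge0 ?expR_ge0.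
have cle1 x om : `|cin p x om| <= 1.
  by rewrite /cin; case: (x \in om) => /=; rewrite ler_norml; apply/andP; split; lra.
have Gm om om' : om \subset om' -> G om <= G om'.
  by move=> h; rewrite ler_pM ?ind_ge0 ?expR_ge0 ?ind_homo ?expR_cstd_homo.
have s1 x om : om :\ x \subset x |: om.
  by apply: subset_trans (subsetDl _ _) (subsetUr _ _).
rewrite (@eq_bE _ _ _ _ _ (fun om => `|cin p b om| * (`|cin p a om| * G om))); last first.
  by move=> om _; rewrite !normrM (ger0_norm (ind_ge0 _ _ _)) (ger0_norm (expR_ge0 _)) mulrCA.
rewrite (@eq_bE _ _ _ _ (fun om => ind (a |: (b |: S)) om * _)
   (fun om => ind [set a] om * (ind [set b] om * G om))); last first.
  by move=> om _; rewrite !ind_setU !mulrA.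
have [<-|ab] := eqVneq a b.
  apply: (@le_trans _ _ (E (fun om => `|cin p a om| * G om))).
    apply: ler_bE => // om _; rewrite ler_wpM2l// ler_piMl//.
  apply: le_trans (bE_cin_abs p0 p1 aV G0 _) _; first by move=> om; exact: Gm.
  rewrite (@eq_bE _ _ _ _ (fun om => ind [set a] om * (_ * _)) (fun om => ind [set a] om * G om)).
    have : 0 <= E (fun om => ind [set a] om * G om).
      by apply: bE_ge0 => // om _; rewrite mulr_ge0 ?ind_ge0.
    by move=> h; rewrite ler_wpM2r//; lra.
  by move=> om _; rewrite mulrA -ind_setU setUid.
have ba : b != a by rewrite eq_sym.
apply: le_trans (bE_cin_abs p0 p1 bV _ _) _.
- by move=> om; rewrite mulr_ge0.
- move=> om; have [-> ->] := cin_indep om ba.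
  by rewrite ler_wpM2l// Gm.
rewrite (@eq_bE _ _ _ _ _ (fun om => `|cin p a om| * (ind [set b] om * G om))); last first.
  by move=> om _; rewrite mulrCA.
have := @bE_cin_abs _ _ _ p0 p1 V a (fun om => ind [set b] om * G om) aV.
move=> /(_ _)/wrap[]; first by move=> om; rewrite mulr_ge0 ?ind_ge0.
move=> /(_ _)/wrap[].
  by move=> om; rewrite ler_pM ?ind_ge0 ?Gm// ind_homo.
move=> h; have h2 : 0 <= 2 * (1 - p) by lra.
apply: le_trans (ler_wpM2l h2 h) _; rewrite mulrA.
have GE0 : 0 <= E (fun om => ind [set a] om * (ind [set b] om * G om)).
  by apply: bE_ge0 => // om _; rewrite !mulr_ge0 ?ind_ge0.
by rewrite ler_wpM2r//; nra.
Qed.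
End PairTerms.

(** * Chains of overlapping members *)

Section ChainSums.
Variables (R : realType) (T : finType) (p : R).
Hypothesis (p0 : 0 < p).
Variables (M : {set {set T}}) (L : nat -> R) (rho : R).
Hypotheses (rho0 : 0 <= rho) (L0 : forall m, 0 <= L m).
(** One link of a chain: summing over a new member that meets [K] costs [L m * rho]. For copies rho
    is E N / Psi_min. *)
Hypothesis chain : forall m K, cov M m K ->
  \sum_(k | nb M K k) p ^+ #|k :|: K| <= L m * rho * p ^+ #|K|.
Implicit Types (A B K i j k : {set T}) (r : {set T} * {set T}).

Definition meet A B := A :&: B != finset.set0.

Lemma meetC A B : meet A B = meet B A. Proof. by rewrite /meet setIC. Qed.

Lemma meetUl A A' B : meet (A :|: A') B = meet A B || meet A' B.
Proof. by rewrite /meet setIUl setU_eq0 negb_and. Qed.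

Lemma meetUr A B B' : meet A (B :|: B') = meet A B || meet A B'.
Proof. by rewrite !(meetC A) meetUl. Qed.

Definition PR r := (r.1 \in M) && nb M r.1 r.2.
Definition Un r := r.1 :|: r.2.
Local Notation mu := (mean p M).

Lemma cov_Un r : PR r -> cov M 2 (Un r).
Proof. by move=> /andP[h1 /andP[h2 _]]; exact: (covU (cov1 h1) (cov1 h2)). Qed.

Lemma sum_PR (F : {set T} * {set T} -> R) :
  \sum_(r | PR r) F r = \sum_(i in M) \sum_(j | nb M i j) F (i, j).
Proof. by rewrite pair_big_dep; apply: eq_big => [[i j]|[i j] _]. Qed.

Let px0 n : 0 <= p ^+ n. Proof. by rewrite exprn_ge0// ltW. Qed.

Lemma covk m K k : cov M m K -> nb M K k -> cov M m.+1 (k :|: K).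
Proof. by move=> cK /andP[kM _]; exact: (covU (cov1 kM) cK). Qed.

Lemma sum_mean : \sum_(r | PR r) p ^+ #|Un r| <= L 1 * rho * mu.
Proof.
rewrite sum_PR /mean mulr_sumr; apply: ler_sum => i iM.
under eq_bigr => j _ do rewrite /Un /= setUC.
exact: chain (cov1 iM).
Qed.

Lemma link1 m K i : cov M m K -> i \in M ->
  \sum_(j | nb M i j) p ^+ #|(i :|: j) :|: K| <= L m.+1 * rho * p ^+ #|i :|: K|.
Proof.
move=> cK iM; apply: le_trans (chain (covU (cov1 iM) cK)).
rewrite big_mkcond [leRHS]big_mkcond; apply: ler_sum => j _.
case: (boolP (nb M i j)) => [h|_]; last by case: ifP.
by rewrite (nb_sub (subsetUl i K) h) (setUC i) setUA.
Qed.

(** Either member of the pair may be the one that meets [K], whence the 2; the other is then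
    attached by [link1]. *)
Lemma link2 m K : cov M m K ->
  \sum_(r | PR r) (meet (Un r) K)%:R * p ^+ #|Un r :|: K|
  <= 2 * (L m * L m.+1) * rho ^+ 2 * p ^+ #|K|.
Proof.
move=> cK.
have half : \sum_(i in M) \sum_(j | nb M i j) (meet i K)%:R * p ^+ #|(i :|: j) :|: K|
    <= (L m * L m.+1) * rho ^+ 2 * p ^+ #|K|.
  apply: (@le_trans _ _ (\sum_(i | nb M K i) L m.+1 * rho * p ^+ #|i :|: K|)).
    rewrite [leRHS]big_mkcondr; apply: ler_sum => i iM.
    rewrite -mulr_sumr -/(meet i K); case: (boolP (meet i K)) => /= h; last by rewrite mul0r.
    by rewrite mul1r link1.
  rewrite -mulr_sumr; have c0 : 0 <= L m.+1 * rho by rewrite mulr_ge0.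
  apply: le_trans (ler_wpM2l c0 (chain cK)) _.
  by rewrite le_eqVlt; apply/orP; left; apply/eqP; ring.
rewrite sum_PR (_ : 2 * _ * _ * _ = L m * L m.+1 * rho ^+ 2 * p ^+ #|K| + L m * L m.+1 * rho ^+ 2 * p ^+ #|K|); last by ring.
apply: le_trans (lerD half half).
rewrite [X in _ <= _ + X](exchange_big_dep (mem M)) /=; last by move=> i j _ /andP[].
rewrite [X in _ <= _ + X](eq_bigr (fun i => \sum_(j | nb M i j) (meet j K)%:R * p ^+ #|(i :|: j) :|: K|)); last first.
  move=> i iM; apply: eq_big => [j|j _]; last by rewrite (setUC j).
  by rewrite /nb iM /= setIC.
rewrite -big_split /=; apply: ler_sum => i iM; rewrite -big_split /=; apply: ler_sum => j _.
rewrite -mulrDl ler_wpM2r// -natrD ler_nat /Un /= meetUl.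
by case: (meet i K); case: (meet j K).
Qed.

(** Either the pair meets [K] and k is attached last, or k meets [K] and the pair is attached to k.
    Each case costs the 2 of [link2]. *)
Lemma link3 m K : cov M m K ->
  \sum_(r | PR r) \sum_(k | nb M (Un r) k)
     (meet (k :|: Un r) K)%:R * p ^+ #|(k :|: Un r) :|: K|
  <= 4 * (L m * L m.+1 * L m.+2) * rho ^+ 3 * p ^+ #|K|.
Proof.
move=> cK.
have h1 : \sum_(r | PR r) \sum_(k | nb M (Un r) k)
    (meet (Un r) K)%:R * p ^+ #|(k :|: Un r) :|: K|
    <= 2 * (L m * L m.+1 * L m.+2) * rho ^+ 3 * p ^+ #|K|.
  have c0 : 0 <= L m.+2 * rho by rewrite mulr_ge0.
  apply: le_trans (_ : L m.+2 * rho * (2 * (L m * L m.+1) * rho ^+ 2 * p ^+ #|K|) <= _); last first.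
    by rewrite le_eqVlt; apply/orP; left; apply/eqP; ring.
  apply: le_trans (ler_wpM2l c0 (link2 cK)); rewrite mulr_sumr.
  apply: ler_sum => r PRr; rewrite -mulr_sumr mulrCA ler_wpM2l//.
  apply: le_trans (chain (covU (cov_Un PRr) cK)).
  rewrite big_mkcond [leRHS]big_mkcond; apply: ler_sum => k _.
  case: (boolP (nb M (Un r) k)) => [h|_]; last by case: ifP.
  by rewrite (nb_sub (subsetUl _ K) h) setUA.
have h2 : \sum_(r | PR r) \sum_(k | nb M (Un r) k)
    (meet k K)%:R * p ^+ #|(k :|: Un r) :|: K|
    <= 2 * (L m * L m.+1 * L m.+2) * rho ^+ 3 * p ^+ #|K|.
  have c0 : 0 <= 2 * (L m.+1 * L m.+2) * rho ^+ 2 by rewrite !mulr_ge0// exprn_ge0.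
  apply: le_trans (_ : 2 * (L m.+1 * L m.+2) * rho ^+ 2 * (L m * rho * p ^+ #|K|) <= _); last first.
    by rewrite le_eqVlt; apply/orP; left; apply/eqP; ring.
  apply: le_trans (ler_wpM2l c0 (chain cK)); rewrite mulr_sumr.
  rewrite (exchange_big_dep (mem M)) /=; last by move=> r k _ /andP[].
  rewrite [leRHS]big_mkcondr; apply: ler_sum => k kM.
  rewrite -/(meet k K); case: (boolP (meet k K)) => /= h; last first.
    by rewrite big1// => r _; rewrite mul0r.
  apply: le_trans (link2 (covU (cov1 kM) cK)).
  rewrite big_mkcondr; apply: ler_sum => r PRr.
  case: ifP => [/andP[_ kr]|_]; last by rewrite mulr_ge0.
  by rewrite meetUr meetC /meet kr !mul1r (setUC k) setUA.
rewrite (_ : 4 * _ * _ * _ = 2 * (L m * L m.+1 * L m.+2) * rho ^+ 3 * p ^+ #|K| + 2 * (L m * L m.+1 * L m.+2) * rho ^+ 3 * p ^+ #|K|); last by ring.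
apply: le_trans (lerD h1 h2).
rewrite -big_split /=; apply: ler_sum => r _; rewrite -big_split /=; apply: ler_sum => k _.
rewrite -mulrDl ler_wpM2r// -natrD ler_nat meetUl.
by case: (meet k K); case: (meet (Un r) K).
Qed.

Lemma sum_linked :
  \sum_(r | PR r) \sum_(r' | PR r') (meet (Un r) (Un r'))%:R * p ^+ #|Un r :|: Un r'|
  <= 2 * (L 1 * L 2 * L 3) * rho ^+ 3 * mu.
Proof.
have c0 : 0 <= 2 * (L 2 * L 3) * rho ^+ 2 by rewrite !mulr_ge0// exprn_ge0.
apply: le_trans (_ : 2 * (L 2 * L 3) * rho ^+ 2 * (L 1 * rho * mu) <= _); last first.
  by rewrite le_eqVlt; apply/orP; left; apply/eqP; ring.
apply: le_trans (ler_wpM2l c0 sum_mean); rewrite mulr_sumr.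
apply: ler_sum => r PRr; apply: le_trans (link2 (cov_Un PRr)).
by apply: ler_sum => r' _; rewrite meetC (setUC (Un r)).
Qed.

Lemma sum_deg : \sum_(r | PR r) \sum_(k | nb M (Un r) k) p ^+ #|k :|: Un r|
  <= L 1 * L 2 * rho ^+ 2 * mu.
Proof.
have c0 : 0 <= L 2 * rho by rewrite !mulr_ge0.
apply: le_trans (_ : L 2 * rho * (L 1 * rho * mu) <= _); last first.
  by rewrite le_eqVlt; apply/orP; left; apply/eqP; ring.
apply: le_trans (ler_wpM2l c0 sum_mean); rewrite mulr_sumr.
by apply: ler_sum => r PRr; exact: chain (cov_Un PRr).
Qed.

(** The sums are reordered so that k is attached to the first pair before the second pair is
    attached to both. *)
Lemma sum_codeg :
  \sum_(r | PR r) \sum_(r' | PR r') \sum_(k | nb M (Un r) k && nb M (Un r') k)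
     p ^+ #|k :|: (Un r :|: Un r')|
  <= 2 * (L 1 * L 2 * L 3 * L 4) * rho ^+ 4 * mu.
Proof.
have c0 : 0 <= 2 * (L 3 * L 4) * rho ^+ 2 by rewrite !mulr_ge0// exprn_ge0.
apply: le_trans (_ : 2 * (L 3 * L 4) * rho ^+ 2 * (L 1 * L 2 * rho ^+ 2 * mu) <= _); last first.
  by rewrite le_eqVlt; apply/orP; left; apply/eqP; ring.
apply: le_trans (ler_wpM2l c0 sum_deg); rewrite mulr_sumr.
apply: ler_sum => r PRr; rewrite mulr_sumr.
rewrite (exchange_big_dep (nb M (Un r))) /=; last by move=> r' k _ /andP[].
apply: ler_sum => k kr; apply: le_trans (link2 (covk (cov_Un PRr) kr)).
rewrite big_mkcondr; apply: ler_sum => r' PRr'.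
case: ifP => [/andP[_ /andP[_ kr']]|_]; last by rewrite mulr_ge0.
rewrite meetUr meetC /meet kr' mul1r (_ : Un r' :|: _ = k :|: (Un r :|: Un r'))//.
by rewrite setUC setUA.
Qed.

(** If the two triples are disjoint the exponents add and the sum factors, giving mu^2. Otherwise
    they form one chain, closed by [link3], with a single mu. *)
Lemma sum_degdeg :
  \sum_(r | PR r) \sum_(r' | PR r') \sum_(k | nb M (Un r) k) \sum_(k' | nb M (Un r') k')
     p ^+ #|k :|: (k' :|: (Un r :|: Un r'))|
  <= (L 1 * L 2) ^+ 2 * rho ^+ 4 * mu ^+ 2 +
     4 * (L 1 * L 2 * L 3 * L 4 * L 5) * rho ^+ 5 * mu.
Proof.
have split r r' k k' : p ^+ #|k :|: (k' :|: (Un r :|: Un r'))| <=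
    p ^+ #|k :|: Un r| * p ^+ #|k' :|: Un r'| +
    (meet (k' :|: Un r') (k :|: Un r))%:R * p ^+ #|(k' :|: Un r') :|: (k :|: Un r)|.
  rewrite (_ : k :|: _ = (k' :|: Un r') :|: (k :|: Un r)); last first.
    by apply/setP => x; rewrite !inE; do !case: (x \in _).
  rewrite /meet; case: eqP => [e|_] /=; last by rewrite mul1r lerDr mulr_ge0.
  by rewrite mul0r addr0 cardsU e cards0 subn0 exprD mulrC.
apply: le_trans (_ : \sum_(r | PR r) \sum_(k | nb M (Un r) k) \sum_(r' | PR r') \sum_(k' | nb M (Un r') k') (p ^+ #|k :|: Un r| * p ^+ #|k' :|: Un r'| +
    (meet (k' :|: Un r') (k :|: Un r))%:R * p ^+ #|(k' :|: Un r') :|: (k :|: Un r)|) <= _).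
  apply: ler_sum => r _; rewrite exchange_big /=; apply: ler_sum => k _.
  by apply: ler_sum => r' _; apply: ler_sum => k' _; exact: split.
have c0 : 0 <= 4 * (L 3 * L 4 * L 5) * rho ^+ 3 by rewrite !mulr_ge0// exprn_ge0.
set d := \sum_(r | PR r) \sum_(k | nb M (Un r) k) p ^+ #|k :|: Un r|.
have d0 : 0 <= d by apply: sumr_ge0 => r _; exact: sumr_ge0.
apply: le_trans (_ : d * d + 4 * (L 3 * L 4 * L 5) * rho ^+ 3 * d <= _); last first.
  rewrite (_ : _ + _ * mu = (L 1 * L 2 * rho ^+ 2 * mu) * (L 1 * L 2 * rho ^+ 2 * mu) + 4 * (L 3 * L 4 * L 5) * rho ^+ 3 * (L 1 * L 2 * rho ^+ 2 * mu)); last by ring.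
  apply: lerD; first by apply: ler_pM => //; exact: sum_deg.
  by rewrite ler_wpM2l//; exact: sum_deg.
rewrite {1}/d mulr_suml {2}/d mulr_sumr -big_split; apply: ler_sum => r PRr /=.
rewrite mulr_suml mulr_sumr -big_split; apply: ler_sum => k kr /=.
rewrite [X in X <= _](_ : _ = p ^+ #|k :|: Un r| * d + \sum_(r' | PR r') \sum_(k' | nb M (Un r') k')
   (meet (k' :|: Un r') (k :|: Un r))%:R * p ^+ #|(k' :|: Un r') :|: (k :|: Un r)|); last first.
  rewrite /d mulr_sumr -big_split; apply: eq_bigr => r' _ /=.
  by rewrite mulr_sumr -big_split.
by rewrite lerD2l; exact: link3 (covk (cov_Un PRr) kr).
Qed.
End ChainSums.

(** * Second moments of Clark-Ocone sums under tilting *)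

Section SecondMoment.
Variables (R : realType) (T : finType) (p : R).
Hypotheses (p0 : 0 < p) (p1 : p < 1).
Variables (V : {set T}) (M : {set {set T}}) (sg : R).
Hypotheses (MV : forall i, i \in M -> i \subset V) (sg0 : 0 < sg).
Variable D : nat.
Hypothesis HD : forall i, i \in M -> (#|[set k | nb M i k]| <= D)%N.
Variables (L : nat -> R) (rho : R).
Hypotheses (rho0 : 0 <= rho) (L0 : forall m, 0 <= L m).
Hypothesis chain : forall m K, cov M m K ->
  \sum_(k | nb M K k) p ^+ #|k :|: K| <= L m * rho * p ^+ #|K|.
Implicit Types (A B C K S om i j k : {set T}) (a b : T) (l : R).

Local Notation E := (bE p V).
Local Notation ind := (ind R).
Local Notation W := (cstd p M sg).
Local Notation mu := (mean p M).
Local Notation PR := (PR M).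
Local Notation nb := (nb M).
Local Notation deg := (deg M sg).

(* At most six members of M are forced to be present at the same time. *)
Definition tiltc l : R := expR (l * (6 * D)%:R / sg) * mgf p V M sg l.

Lemma tiltc_ge0 l : 0 <= tiltc l.
Proof. by rewrite mulr_ge0 ?expR_ge0 ?mgf_ge0. Qed.

Lemma tilt6 m S l : (m <= 6)%N -> 0 <= l -> S \subset V -> cov M m S ->
  E (fun om => ind S om * expR (l * W om)) <= p ^+ #|S| * tiltc l.
Proof.
move=> m6 l0 SV cS; apply: le_trans (tilt_cov p0 p1 sg0 HD l0 SV cS) _.
rewrite ler_wpM2l ?exprn_ge0 ?(ltW p0)// ler_wpM2r ?mgf_ge0// ler_expR.
by rewrite ler_pM2r ?invr_gt0// ler_wpM2l// ler_nat leq_mul2r m6 orbT.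
Qed.

Lemma nb_mem A k a : k \in M -> a \in k -> a \in A -> nb A k.
Proof. by move=> kM ak aA; rewrite /nb kM; apply/set0Pn; exists a; rewrite inE ak. Qed.

Let sgV0 : 0 <= sg^-1. Proof. by rewrite invr_ge0 ltW. Qed.

Lemma bE_deg2 A K K' a b l : 0 <= l -> A \subset V -> cov M 4 A -> a \in K -> b \in K' ->
  E (fun om => ind A om * (deg [set a; b] om * expR (l * W om)))
  <= sg^-1 * (\sum_(k | nb K k && nb K' k) p ^+ #|k :|: A|) * tiltc l.
Proof.
move=> l0 AV cA aK bK'.
rewrite (@eq_bE _ _ _ _ _ (fun om => \sum_(k in M | [set a; b] \subset k)
    sg^-1 * (ind (k :|: A) om * expR (l * W om)))); last first.
  move=> om _; rewrite /deg mulr_suml mulr_sumr; apply: eq_bigr => k _.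
  by rewrite ind_setU; ring.
rewrite bE_sum mulr_sumr mulr_suml.
rewrite big_mkcond [leRHS]big_mkcond; apply: ler_sum => k _.
case: ifP => [/andP[kM]|_]; last first.
  by case: ifP => // _; rewrite mulr_ge0 ?tiltc_ge0// mulr_ge0// exprn_ge0// ltW.
rewrite subUset !sub1set => /andP[ak bk].
rewrite (nb_mem kM ak aK) (nb_mem kM bk bK') /= bEZ -mulrA ler_wpM2l//.
apply: (@tilt6 5) => //; first by rewrite subUset MV.
exact: (covU (cov1 kM) cA).
Qed.

Lemma bE_degdeg A K K' a b l : 0 <= l -> A \subset V -> cov M 4 A -> a \in K -> b \in K' ->
  E (fun om => ind A om * (deg [set a] om * deg [set b] om * expR (l * W om)))
  <= sg^-1 ^+ 2 * (\sum_(k | nb K k) \sum_(k' | nb K' k') p ^+ #|k :|: (k' :|: A)|) * tiltc l.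
Proof.
move=> l0 AV cA aK bK'.
rewrite (@eq_bE _ _ _ _ _ (fun om => \sum_(k in M | a \in k) \sum_(k' in M | b \in k')
    sg^-1 ^+ 2 * (ind (k :|: (k' :|: A)) om * expR (l * W om)))); last first.
  move=> om _; rewrite /deg !mulr_suml mulr_sumr; apply: eq_big => [k|k _]; first by rewrite sub1set.
  rewrite mulr_sumr mulr_suml mulr_sumr; apply: eq_big => [k'|k' _]; first by rewrite sub1set.
  by rewrite !ind_setU; ring.
rewrite bE_sum mulr_sumr mulr_suml.
rewrite big_mkcond [leRHS]big_mkcond; apply: ler_sum => k _.
have t0 := tiltc_ge0 l.
case: ifP => [/andP[kM ak]|_]; last first.
  case: ifP => // _; rewrite mulr_ge0// mulr_ge0 ?exprn_ge0//.
  by apply: sumr_ge0 => k' _; rewrite exprn_ge0 ?(ltW p0).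
rewrite (nb_mem kM ak aK) bE_sum mulr_sumr mulr_suml.
rewrite big_mkcond [leRHS]big_mkcond; apply: ler_sum => k' _.
case: ifP => [/andP[kM' bk]|_]; last first.
  case: ifP => // _; apply: mulr_ge0 => //.
  by apply: mulr_ge0; apply: exprn_ge0 => //; exact: ltW.
rewrite (nb_mem kM' bk bK') bEZ -mulrA ler_wpM2l ?exprn_ge0//.
apply: (@tilt6 6) => //; first by rewrite !subUset AV !MV.
exact: (covU (cov1 kM) (covU (cov1 kM') cA)).
Qed.

(** A common index for the expansions of R and of U - 1: an overlapping pair of members with a tag
    that holds the selected coordinates, at most [Nx] tags per pair. *)
Variables (U : finType) (P : {set T} * {set T} * U -> bool).
Variables (av : {set T} * {set T} * U -> T) (Sv : {set T} * {set T} * U -> {set T}).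
Variables (wv : {set T} * {set T} * U -> R) (Nx : nat).
(** The weight pays for the coordinates of the union that are neither selected nor left as
    indicators. Thus each term behaves as if the whole union were forced present. *)
Hypothesis HP : forall t, P t -> [/\ PR t.1, av t \in Un t.1, Sv t \subset Un t.1,
  av t \notin Sv t & 0 <= wv t <= p ^+ #|Un t.1 :\: (av t |: Sv t)| / sg ^+ 2].
Hypothesis HN : forall r, (#|[set x | P (r, x)]| <= Nx)%N.
Implicit Types (t : {set T} * {set T} * U) (r : {set T} * {set T}).

Definition clark_sum om : R := \sum_(t | P t) wv t * (cin p (av t) om * ind (Sv t) om).

(** The first summand is for overlapping unions ([linked_term]); the other two come from the mixed
    difference for disjoint unions, through the common degree and the product of degrees. *)
Definition pairQ l r r' : R :=
  4 * (1 - p) / sg ^+ 4 * ((meet (Un r) (Un r'))%:R * p ^+ #|Un r :|: Un r'|)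
  + (1 - p) ^+ 2 * l / sg ^+ 5 *
      (\sum_(k | nb (Un r) k && nb (Un r') k) p ^+ #|k :|: (Un r :|: Un r')|)
  + (1 - p) ^+ 2 * l ^+ 2 / sg ^+ 6 *
      (\sum_(k | nb (Un r) k) \sum_(k' | nb (Un r') k') p ^+ #|k :|: (k' :|: (Un r :|: Un r'))|).

Let px0 n : 0 <= p ^+ n. Proof. by rewrite exprn_ge0// ltW. Qed.
Let q0 : 0 <= 1 - p. Proof. by rewrite subr_ge0 ltW. Qed.

Lemma pairQ_ge0 l r r' : 0 <= l -> 0 <= pairQ l r r'.
Proof.
move=> l0; have s0 := ltW sg0.
rewrite /pairQ !addr_ge0//; (apply: mulr_ge0;
  [by rewrite !mulr_ge0 ?invr_ge0 ?exprn_ge0|]).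
- by rewrite mulr_ge0.
- exact: sumr_ge0.
- by apply: sumr_ge0 => k _; exact: sumr_ge0.
Qed.

(** The forced set and the coordinates paid for by the two weights together cover both unions; since
    p < 1, the larger total exponent only helps. *)
Lemma weight_bound t t' C : P t -> P t' ->
  wv t * wv t' * p ^+ #|C :|: (av t |: (av t' |: (Sv t :|: Sv t')))|
  <= p ^+ #|C :|: (Un t.1 :|: Un t'.1)| / sg ^+ 4.
Proof.
move=> /HP[_ _ _ _ /andP[w0 wb]] /HP[_ _ _ _ /andP[w0' wb']].
set B := _ :|: (_ |: _).
apply: le_trans (_ : p ^+ #|Un t.1 :\: (av t |: Sv t)| / sg ^+ 2 *
  (p ^+ #|Un t'.1 :\: (av t' |: Sv t')| / sg ^+ 2) * p ^+ #|B| <= _).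
  by rewrite ler_wpM2r// ler_pM.
have -> x y z : x / sg ^+ 2 * (y / sg ^+ 2) * z = x * y * z / sg ^+ 4.
  by field; rewrite lt0r_neq0.
rewrite ler_pM2r ?invr_gt0 ?exprn_gt0// -!exprD ler_wiXn2l ?(ltW p0) ?(ltW p1)//.
apply: leq_trans (_ : #|(Un t.1 :\: (av t |: Sv t) :|: Un t'.1 :\: (av t' |: Sv t')) :|: B| <= _)%N.
  apply: subset_leq_card; apply/subsetP => x; rewrite /B !inE.
  by do !case: (_ == _); do !case: (x \in _); rewrite ?orbT ?andbF.
apply: leq_trans (leq_card_setU _ _).1 _; rewrite leq_add2r.
exact: (leq_card_setU _ _).1.
Qed.

Lemma pair_term t t' l : 0 <= l -> P t -> P t' ->
  wv t * wv t' * E (fun om => cin p (av t) om * (cin p (av t') om *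
     (ind (Sv t :|: Sv t') om * expR (l * W om)))) <= pairQ l t.1 t'.1 * tiltc l.
Proof.
move=> l0 Pt Pt'.
have [PRt at_ St nat_ /andP[w0 wb]] := HP Pt.
have [PRt' at' St' nat' /andP[w0' wb']] := HP Pt'.
have UV r : PR r -> Un r \subset V.
  by move=> /andP[h1 /andP[h2 _]]; rewrite subUset !MV.
have aV := subsetP (UV _ PRt) _ at_; have bV := subsetP (UV _ PRt') _ at'.
have SV : Sv t :|: Sv t' \subset V.
  by rewrite subUset (subset_trans St (UV _ PRt)) (subset_trans St' (UV _ PRt')).
set A := av t |: (av t' |: (Sv t :|: Sv t')).
have AU : A \subset Un t.1 :|: Un t'.1.
  rewrite /A !subUset !sub1set.
  rewrite (subsetP (subsetUl _ (Un t'.1)) _ at_) (subsetP (subsetUr (Un t.1) _) _ at') /=.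
  by rewrite (subset_trans St (subsetUl _ _)) (subset_trans St' (subsetUr _ _)).
have AV : A \subset V by apply: subset_trans AU _; rewrite subUset !UV.
have cA : cov M 4 A := cov_sub AU (covU (cov_Un PRt) (cov_Un PRt')).
have t0 := tiltc_ge0 l.
have ww0 : 0 <= wv t * wv t' by rewrite mulr_ge0.
have s0 := ltW sg0.
have c4 : 0 <= 4 * (1 - p) by rewrite mulr_ge0.
have Q1 : 0 <= (1 - p) ^+ 2 * l / sg ^+ 5 *
      (\sum_(k | nb (Un t.1) k && nb (Un t'.1) k) p ^+ #|k :|: (Un t.1 :|: Un t'.1)|).
  by rewrite !mulr_ge0 ?invr_ge0 ?exprn_ge0 ?sumr_ge0.
have Q2 : 0 <= (1 - p) ^+ 2 * l ^+ 2 / sg ^+ 6 *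
      (\sum_(k | nb (Un t.1) k) \sum_(k' | nb (Un t'.1) k') p ^+ #|k :|: (k' :|: (Un t.1 :|: Un t'.1))|).
  rewrite !mulr_ge0 ?invr_ge0 ?exprn_ge0//.
  by apply: sumr_ge0 => k _; exact: sumr_ge0.
rewrite /pairQ; case: (boolP (meet (Un t.1) (Un t'.1))) => hm.
  apply: le_trans (_ : wv t * wv t' * (4 * (1 - p) * (p ^+ #|A| * tiltc l)) <= _).
    rewrite ler_wpM2l//; apply: le_trans (ler_norm _) _.
    apply: le_trans (ler_norm_bE p0 p1 _ _) _.
    apply: le_trans (linked_term p0 p1 M sg0 _ aV bV l0) _.
    by rewrite ler_wpM2l//; exact: (@tilt6 4).
  apply: le_trans (_ : 4 * (1 - p) / sg ^+ 4 * (1 * p ^+ #|Un t.1 :|: Un t'.1|) * tiltc l <= _); last first.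
    by rewrite ler_wpM2r// -addrA lerDl addr_ge0.
  have h := weight_bound finset.set0 Pt Pt'; rewrite !set0U in h.
  have ct : 0 <= 4 * (1 - p) * tiltc l by rewrite mulr_ge0.
  have := ler_wpM2l ct h; congr (_ <= _); rewrite /=; ring.
(* Disjoint unions: neither coordinate occurs in the other factor, so integration by parts applies twice. *)
have dis x : x \in Un t.1 -> x \in Un t'.1 -> False.
  by move=> h1 h2; move/negP: hm; apply; apply/set0Pn; exists x; rewrite inE h1.
have ab : av t != av t' by apply/eqP => e; apply: (dis _ at_); rewrite e.
have aS : av t \notin Sv t :|: Sv t'.
  by rewrite inE negb_or nat_; apply/negP => /(subsetP St'); exact: dis.
have bS : av t' \notin Sv t :|: Sv t'.
  by rewrite inE negb_or nat' andbT; apply/negP => /(subsetP St) h; exact: dis h at'.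
rewrite mul0r mulr0 add0r.
apply: le_trans (_ : wv t * wv t' * ((1 - p) ^+ 2 *
   (l * (sg^-1 * (\sum_(k | nb (Un t.1) k && nb (Un t'.1) k) p ^+ #|k :|: A|) * tiltc l)
    + l ^+ 2 * (sg^-1 ^+ 2 * (\sum_(k | nb (Un t.1) k) \sum_(k' | nb (Un t'.1) k')
         p ^+ #|k :|: (k' :|: A)|) * tiltc l))) <= _).
  rewrite ler_wpM2l//; apply: le_trans (ler_norm _) _.
  apply: le_trans (unlinked_term p0 p1 M sg0 aV bV ab aS bS SV l0) _.
  rewrite ler_wpM2l ?exprn_ge0//.
  rewrite (@eq_bE _ _ _ _ _ (fun om => l * (ind A om * (deg [set av t; av t'] om * expR (l * W om))) +
    l ^+ 2 * (ind A om * (deg [set av t] om * deg [set av t'] om * expR (l * W om))))); last first.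
    by move=> om _; rewrite /A; ring.
  rewrite bED !bEZ; apply: lerD; rewrite ler_wpM2l ?exprn_ge0//.
    exact: bE_deg2.
  exact: bE_degdeg.
have h1 : wv t * wv t' * (\sum_(k | nb (Un t.1) k && nb (Un t'.1) k) p ^+ #|k :|: A|)
   <= (\sum_(k | nb (Un t.1) k && nb (Un t'.1) k) p ^+ #|k :|: (Un t.1 :|: Un t'.1)|) / sg ^+ 4.
  rewrite mulr_sumr mulr_suml; apply: ler_sum => k _; exact: weight_bound.
have h2 : wv t * wv t' * (\sum_(k | nb (Un t.1) k) \sum_(k' | nb (Un t'.1) k')
         p ^+ #|k :|: (k' :|: A)|)
   <= (\sum_(k | nb (Un t.1) k) \sum_(k' | nb (Un t'.1) k')
         p ^+ #|k :|: (k' :|: (Un t.1 :|: Un t'.1))|) / sg ^+ 4.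
  rewrite mulr_sumr mulr_suml; apply: ler_sum => k _.
  rewrite mulr_sumr mulr_suml; apply: ler_sum => k' _.
  by have := weight_bound (k :|: k') Pt Pt'; rewrite -!(setUA k k').
move: h1 h2; set x1 := \sum_(k | _) _; set y1 := \sum_(k | _) _.
set x2 := \sum_(k | _) _; set y2 := \sum_(k | _) _ => h1 h2.
have c1 : 0 <= (1 - p) ^+ 2 * l * sg^-1 * tiltc l by rewrite mulr_ge0// !mulr_ge0 ?exprn_ge0.
have c2 : 0 <= (1 - p) ^+ 2 * l ^+ 2 * sg^-1 ^+ 2 * tiltc l by rewrite mulr_ge0// !mulr_ge0 ?exprn_ge0.
have k1 := ler_wpM2l c1 h1; have k2 := ler_wpM2l c2 h2.
have := lerD k1 k2; congr (_ <= _); first by rewrite /=; ring.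
by field; rewrite lt0r_neq0.
Qed.

(** The three summands of [pairQ], summed over all pairs by [sum_linked], [sum_codeg] and
    [sum_degdeg]. *)
Definition smQ l : R :=
  8 * (1 - p) * (L 1 * L 2 * L 3) * rho ^+ 3 * mu / sg ^+ 4
  + 2 * (1 - p) ^+ 2 * l * (L 1 * L 2 * L 3 * L 4) * rho ^+ 4 * mu / sg ^+ 5
  + (1 - p) ^+ 2 * l ^+ 2 * ((L 1 * L 2) ^+ 2 * rho ^+ 4 * mu ^+ 2 +
     4 * (L 1 * L 2 * L 3 * L 4 * L 5) * rho ^+ 5 * mu) / sg ^+ 6.

Lemma sum_P (F : {set T} * {set T} -> R) : (forall r, PR r -> 0 <= F r) ->
  \sum_(t | P t) F t.1 <= Nx%:R * \sum_(r | PR r) F r.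
Proof.
move=> F0; rewrite mulr_sumr.
rewrite (eq_bigl (fun t => xpredT t.1 && P (t.1, t.2))); last by case.
rewrite -(pair_big_dep xpredT (fun r x => P (r, x)) (fun r x => F r)) /=.
rewrite [leRHS]big_mkcond; apply: ler_sum => r _.
case: ifP => PRr.
  rewrite sumr_const -[leLHS]mulr_natl ler_wpM2r ?F0// ler_nat.
  by apply: leq_trans (HN r); rewrite cardsE.
by rewrite big1// => x /HP[]; rewrite PRr.
Qed.

Lemma second_moment l : 0 <= l ->
  E (fun om => clark_sum om ^+ 2 * expR (l * W om)) <= Nx%:R ^+ 2 * smQ l * tiltc l.
Proof.
move=> l0; have s0 := ltW sg0.
rewrite (@eq_bE _ _ _ _ _ (fun om => \sum_(t | P t) \sum_(t' | P t')
   wv t * wv t' * (cin p (av t) om * (cin p (av t') om *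
     (ind (Sv t :|: Sv t') om * expR (l * W om)))))); last first.
  move=> om _; rewrite expr2 /clark_sum !mulr_suml; apply: eq_bigr => t _.
  rewrite mulr_sumr mulr_suml; apply: eq_bigr => t' _.
  by rewrite ind_setU; ring.
rewrite bE_sum.
apply: le_trans (_ : \sum_(t | P t) \sum_(t' | P t') pairQ l t.1 t'.1 * tiltc l <= _).
  apply: ler_sum => t Pt; rewrite bE_sum; apply: ler_sum => t' Pt'.
  by rewrite bEZ; exact: pair_term.
under eq_bigr => t _ do rewrite -mulr_suml.
rewrite -mulr_suml ler_wpM2r ?tiltc_ge0//.
apply: le_trans (_ : Nx%:R * (Nx%:R * \sum_(r | PR r) \sum_(r' | PR r') pairQ l r r') <= _).
  apply: le_trans (_ : \sum_(t | P t) Nx%:R * \sum_(r' | PR r') pairQ l t.1 r' <= _).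
    by apply: ler_sum => t Pt; apply: sum_P => r _; exact: pairQ_ge0.
  rewrite -mulr_sumr ler_wpM2l//.
  apply: (@sum_P (fun r => \sum_(r' | PR r') pairQ l r r')) => r _.
  by apply: sumr_ge0 => r' _; exact: pairQ_ge0.
rewrite mulrA -expr2 ler_wpM2l ?exprn_ge0//.
rewrite (_ : \sum_(r | PR r) _ =
  4 * (1 - p) / sg ^+ 4 * (\sum_(r | PR r) \sum_(r' | PR r') (meet (Un r) (Un r'))%:R * p ^+ #|Un r :|: Un r'|)
  + (1 - p) ^+ 2 * l / sg ^+ 5 *
      (\sum_(r | PR r) \sum_(r' | PR r') \sum_(k | nb (Un r) k && nb (Un r') k) p ^+ #|k :|: (Un r :|: Un r')|)
  + (1 - p) ^+ 2 * l ^+ 2 / sg ^+ 6 *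
      (\sum_(r | PR r) \sum_(r' | PR r') \sum_(k | nb (Un r) k) \sum_(k' | nb (Un r') k') p ^+ #|k :|: (k' :|: (Un r :|: Un r'))|)); last first.
  rewrite !mulr_sumr -!big_split /=; apply: eq_bigr => r _.
  by rewrite !mulr_sumr -!big_split.
have h1 := sum_linked p0 rho0 L0 chain.
have h2 := sum_codeg p0 rho0 L0 chain.
have h3 := sum_degdeg p0 rho0 L0 chain.
have c1 : 0 <= 4 * (1 - p) / sg ^+ 4 by rewrite !mulr_ge0 ?invr_ge0 ?exprn_ge0.
have c2 : 0 <= (1 - p) ^+ 2 * l / sg ^+ 5 by rewrite !mulr_ge0 ?invr_ge0 ?exprn_ge0.
have c3 : 0 <= (1 - p) ^+ 2 * l ^+ 2 / sg ^+ 6 by rewrite !mulr_ge0 ?invr_ge0 ?exprn_ge0.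
have := lerD (lerD (ler_wpM2l c1 h1) (ler_wpM2l c2 h2)) (ler_wpM2l c3 h3).
move=> h; apply: (le_trans h); rewrite /smQ le_eqVlt; apply/orP; left; apply/eqP.
by field; rewrite lt0r_neq0.
Qed.
End SecondMoment.

(** * Normal approximation *)

Section SteinMethod.
Variables (R : realType) (T : finType) (p : R).
Hypotheses (p0 : 0 < p) (p1 : p < 1).
Variables (V : {set T}) (M : {set {set T}}) (sg : R).
Hypotheses (MV : forall i, i \in M -> i \subset V) (sg0 : 0 < sg).
Implicit Types (A B C K S om i j k : {set T}) (a b : T) (l : R).

Local Notation E := (bE p V).
Local Notation ind := (ind R).
Local Notation W := (cstd p M sg).
Local Notation Tw := (Tw p M sg).
Local Notation Dw := (Dw M sg).
Local Notation cin := (cin p).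

Definition Rsum om : R := \sum_a cin a om * (Tw a om * Dw a om).
Definition Usum om : R := \sum_a p * (1 - p) * (Tw a om * Dw a om).

Let pq0 : 0 <= p * (1 - p). Proof. by apply: mulr_ge0; rewrite ?subr_ge0; exact: ltW. Qed.

Lemma Tw_out a om : a \notin V -> Tw a om = 0.
Proof.
move=> aV; apply: big1 => i /andP[/MV /subsetP iV ai].
by case/negP: aV; exact: iV.
Qed.

Lemma cstd_ibp (f : R -> R) : E (fun om => W om * f (W om)) =
  \sum_a p * (1 - p) * E (fun om => Tw a om * (f (W (a |: om)) - f (W (om :\ a)))).
Proof.
rewrite (@eq_bE _ _ _ _ _ (fun om => \sum_a cin a om * (Tw a om * f (W om)))); last first.
  move=> om _; rewrite {1}cstd_clark_ocone mulr_suml.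
  by apply: eq_bigr => a _; rewrite mulrA.
rewrite bE_sum; apply: eq_bigr => a _.
case: (boolP (a \in V)) => aV.
  rewrite bE_ibp//; congr (_ * _); apply: eq_bE => om _.
  by have [-> ->] := Tw_indep p M sg a om; rewrite mulrBr.
rewrite (@eq_bE _ _ _ _ _ (fun=> 0)); last by move=> om _; rewrite Tw_out// mul0r mulr0.
by rewrite (@eq_bE _ _ _ _ (fun om => _ * (_ - _)) (fun=> 0)) ?bE_cst ?mulr0// => om _; rewrite Tw_out// mul0r.
Qed.

Lemma Rsum_ibp (h : R -> R) : E (fun om => Rsum om * h (W om)) =
  \sum_a p * (1 - p) * E (fun om => Tw a om * Dw a om * (h (W (a |: om)) - h (W (om :\ a)))).
Proof.
rewrite (@eq_bE _ _ _ _ _ (fun om => \sum_a cin a om * (Tw a om * Dw a om * h (W om)))); last first.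
  by move=> om _; rewrite mulr_suml; apply: eq_bigr => a _; rewrite -mulrA.
rewrite bE_sum; apply: eq_bigr => a _.
case: (boolP (a \in V)) => aV.
  rewrite bE_ibp//; congr (_ * _); apply: eq_bE => om _.
  have [-> ->] := Tw_indep p M sg a om; have [-> ->] := Dw_indep M sg a om.
  by rewrite mulrBr.
rewrite (@eq_bE _ _ _ _ _ (fun=> 0)); last by move=> om _; rewrite Tw_out// !mul0r mulr0.
by rewrite (@eq_bE _ _ _ _ (fun om => _ * (_ - _)) (fun=> 0)) ?bE_cst ?mulr0// => om _; rewrite Tw_out// !mul0r.
Qed.

(** After integration by parts the Taylor error is integrated against T_a >= 0. Its bound is a sum
    of D_a times increments of h, which [Rsum_ibp] recognises as E R h(W). *)
Lemma stein_approx (f f' h : R -> R) :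
  (forall x y z, x <= y -> x <= z <= y ->
     `|f y - f x - (y - x) * f' z| <= (y - x) * (h y - h x)) ->
  `|E (fun om => W om * f (W om)) - E (fun om => Usum om * f' (W om))|
    <= E (fun om => Rsum om * h (W om)).
Proof.
move=> H; rewrite cstd_ibp Rsum_ibp.
rewrite (@eq_bE _ _ _ _ (fun om => Usum om * _)
   (fun om => \sum_a p * (1 - p) * (Tw a om * Dw a om * f' (W om)))); last first.
  by move=> om _; rewrite mulr_suml; apply: eq_bigr => a _; rewrite !mulrA.
rewrite bE_sum -sumrB; apply: le_trans (ler_norm_sum _ _ _) _.
apply: ler_sum => a _; rewrite bEZ -mulrBr normrM ger0_norm// ler_wpM2l//.
rewrite -bEB; apply: le_trans (ler_norm_bE p0 p1 _ _) _; apply: ler_bE => // om _.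
have T0 := Tw_ge0 p0 M sg0 a om.
rewrite -!mulrA -mulrBr normrM ger0_norm// ler_wpM2l//.
rewrite -(cstd_diff p M sg a om); apply: H.
  by apply: cstd_homo => //; apply: subset_trans (subsetDl _ _) (subsetUr _ _).
by rewrite !cstd_homo// ?subsetDl// subsetUr.
Qed.

Hypothesis sgE : sg ^+ 2 = E (fun om => (cnt R M om - mean p M) ^+ 2).

Lemma bE_cstd2 : E (fun om => W om * W om) = 1.
Proof.
rewrite (@eq_bE _ _ _ _ _ (fun om => sg^-1 ^+ 2 * (cnt R M om - mean p M) ^+ 2)); last first.
  by move=> om _; rewrite /cstd; ring.
by rewrite bEZ -sgE -exprMn mulVf ?expr1n// lt0r_neq0.
Qed.

Lemma bE_Usum : E Usum = 1.
Proof.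
rewrite -bE_cstd2 (cstd_ibp id) /Usum bE_sum; apply: eq_bigr => a _.
rewrite bEZ; congr (_ * _); apply: eq_bE => om _.
by rewrite cstd_diff.
Qed.

Lemma stein_bound t : 0 <= t ->
  `|E (fun om => (W om <= t)%R%:R) - Phi R t| <=
    E (fun om => `|1 - Usum om| * stein_env t (W om)) +
    E (fun om => `|Rsum om| * stein_env t (W om)).
Proof.
move=> t0.
have h1 := @stein_approx (stein_f t) (stein_f' t) (fun w => stein_g t w + (w > t)%R%:R)
  (fun x y z xy xzy => stein_f_taylor t xy xzy).
have e1 : E (fun om => (W om <= t)%R%:R) - Phi R t =
    E (fun om => stein_f' t (W om)) - E (fun om => W om * stein_f t (W om)).
  rewrite -(bE_cst p V (Phi R t)) -!bEB; apply: eq_bE => om _.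
  by rewrite /stein_f' /stein_g; ring.
have e2 : E (fun om => stein_f' t (W om)) =
    E (fun om => (1 - Usum om) * stein_f' t (W om)) + E (fun om => Usum om * stein_f' t (W om)).
  by rewrite -bED; apply: eq_bE => om _; ring.
have h2 : `|E (fun om => (1 - Usum om) * stein_f' t (W om))| <=
    E (fun om => `|1 - Usum om| * stein_env t (W om)).
  apply: le_trans (ler_norm_bE p0 p1 _ _) _; apply: ler_bE => // om _.
  by rewrite normrM ler_wpM2l// (stein_env_bound _ t0).1.
have h3 : E (fun om => Rsum om * (stein_g t (W om) + (W om > t)%R%:R)) <=
    E (fun om => `|Rsum om| * stein_env t (W om)).
  apply: ler_bE => // om _; apply: le_trans (ler_norm _) _.
  by rewrite normrM ler_wpM2l// (stein_env_bound _ t0).2.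
rewrite e1 e2 -addrA; apply: le_trans (ler_normD _ _) _; apply: lerD => //.
by rewrite distrC; apply: le_trans h1 h3.
Qed.

(** The function exp (l x) has a nondecreasing derivative, so this derivative serves as both f' and
    h in [stein_approx]. *)
Lemma bE_cstd_le l : 0 <= l ->
  E (fun om => W om * expR (l * W om)) <= l * (mgf p V M sg l +
     E (fun om => `|1 - Usum om| * expR (l * W om)) +
     E (fun om => `|Rsum om| * expR (l * W om))).
Proof.
move=> l0.
have := @stein_approx (fun x => expR (l * x)) (fun x => l * expR (l * x)) (fun x => l * expR (l * x)).
move=> /(_ _)/wrap[].
  move=> x y z xy /andP[xz zy].
  have d (x' : R) : is_derive x' (1 : R) (fun x : R => expR (l * x)) (l * expR (l * x')).
    by apply: is_derive_eq; rewrite /GRing.scale /=; ring.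
  have [c /andP[xc cy] ->] := mvt_is_derive xy d.
  have mono u v : u <= v -> l * expR (l * u) <= l * expR (l * v).
    by move=> uv; rewrite ler_wpM2l// ler_expR ler_wpM2l.
  rewrite (mulrC _ (y - x)) -mulrBr normrM ger0_norm ?subr_ge0// ler_wpM2l ?subr_ge0//.
  have := mono _ _ xz; have := mono _ _ zy; have := mono _ _ xc; have := mono _ _ cy.
  move: (l * expR (l * x)) (l * expR (l * y)) (l * expR (l * z)) (l * expR (l * c)).
  by move=> *; rewrite ler_norml; apply/andP; split; lra.
move=> /(le_trans (ler_norm _)); rewrite lerBlDl => /le_trans; apply.
rewrite !mulrDr /mgf -!bEZ -!bED; apply: ler_bE => // om _.
have e0 : 0 <= l * expR (l * W om) by rewrite mulr_ge0 ?expR_ge0.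
have h1 : (Usum om - 1) * (l * expR (l * W om)) <= `|1 - Usum om| * (l * expR (l * W om)).
  by rewrite ler_wpM2r// distrC ler_norm.
have h2 : Rsum om * (l * expR (l * W om)) <= `|Rsum om| * (l * expR (l * W om)).
  by rewrite ler_wpM2r// ler_norm.
by move: h1 h2; lra.
Qed.

Variable D : nat.
Hypothesis HD : forall i, i \in M -> (#|[set k | nb M i k]| <= D)%N.
Variables (L : nat -> R) (rho : R).
Hypotheses (rho0 : 0 <= rho) (L0 : forall m, 0 <= L m).
Hypothesis chain : forall m K, cov M m K ->
  \sum_(k | nb M K k) p ^+ #|k :|: K| <= L m * rho * p ^+ #|K|.
Variable e : nat.
Hypothesis Me : forall i, i \in M -> (#|i| <= e)%N.
Local Notation smQ := (smQ p M sg L rho).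
Local Notation tiltc := (tiltc p V M sg D).

Let Rt := ({set T} * {set T} * T)%type.

(** The index ((i, j), a) stands for the product of the i-term of T_a with the j-term of D_a. [RS]
    collects the indicators that remain, [Rw] the averaged part of i. *)
Definition RP (t : Rt) := PR M t.1 && ((t.2 \in t.1.1) && (t.2 \in t.1.2)).
Definition RS (t : Rt) := hi t.1.1 t.2 :|: t.1.2 :\ t.2.
Definition Rw (t : Rt) : R := p ^+ #|lo t.1.1 t.2| / sg ^+ 2.

Lemma sum_TwDw a om : Tw a om * Dw a om =
  \sum_(r | PR M r && ((a \in r.1) && (a \in r.2))) Rw (r, a) * ind (RS (r, a)) om.
Proof.
rewrite /Tw /Dw mulr_suml.
under eq_bigr => i _ do rewrite mulr_sumr.
rewrite pair_big /=; apply: eq_big => [[i j]|[i j] _] /=; last first.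
  by rewrite /Rw /RS /= ind_setU; field; rewrite lt0r_neq0.
rewrite /PR /nb /=; apply/idP/idP => [/andP[/andP[-> ai] /andP[-> aj]]|].
  by rewrite ai aj !andbT; apply/set0Pn; exists a; rewrite inE aj.
by move=> /andP[/andP[-> /andP[-> _]] /andP[-> ->]].
Qed.

Lemma Rsum_clark om : Rsum om = clark_sum p RP (fun t : Rt => t.2) RS Rw om.
Proof.
rewrite /Rsum /clark_sum.
under eq_bigr => a _ do rewrite sum_TwDw mulr_sumr.
rewrite (exchange_big_dep (PR M)) /=; last by move=> a r _ /andP[].
rewrite (eq_bigl (fun t : Rt => PR M t.1 && ((t.2 \in t.1.1) && (t.2 \in t.1.2)))) //.
rewrite pair_big_dep /=; apply: eq_big => [[r a]|[r a] _] //=; last by ring.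
by rewrite andbA andbb.
Qed.

Lemma Rsum_moment l : 0 <= l ->
  E (fun om => Rsum om ^+ 2 * expR (l * W om)) <= e%:R ^+ 2 * smQ l * tiltc l.
Proof.
move=> l0.
rewrite (@eq_bE _ _ _ _ _ (fun om => clark_sum p RP (fun t : Rt => t.2) RS Rw om ^+ 2 * expR (l * W om))).
  apply: (second_moment p0 p1 MV sg0 HD rho0 L0 chain) => //.
    move=> [[i j] a] /andP[PRr /= /andP[ai aj]].
    split => //=.
    - by rewrite inE ai.
    - rewrite subUset (subset_trans (hi_sub _ _) (subsetUl _ _)).
      exact: subset_trans (subsetDl _ _) (subsetUr _ _).
    - by rewrite !inE eqxx ltnn andbF.
    rewrite /Rw mulr_ge0 ?invr_ge0 ?exprn_ge0 ?(ltW p0) ?(ltW sg0)//=.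
    rewrite ler_pM2r ?invr_gt0 ?exprn_gt0// ler_wiXn2l ?(ltW p0) ?(ltW p1)//.
    apply: subset_leq_card; apply/subsetP => x; rewrite /Un /RS /= !inE !negb_or.
    case: (ltngtP (enum_rank a) (enum_rank x)) => [||/enum_rank_natI ->]; rewrite ?eqxx ?andbF//=.
    - by case: (x == a); case: (x \in i); case: (x \in j).
    - by case: (x == a); case: (x \in i); case: (x \in j).
  (* The tag a lies in i, which leaves at most e choices. *)
  move=> [i j]; case: (boolP (PR M (i, j))) => h.
    apply: leq_trans (Me (proj1 (andP h))); apply: subset_leq_card.
    by apply/subsetP => x; rewrite inE => /andP[_ /andP[]].
  rewrite (_ : [set x | _] = finset.set0) ?cards0//.
  by apply/setP => x; rewrite !inE /RP (negbTE h).
by move=> om _; rewrite Rsum_clark.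
Qed.

Let Ut := ({set T} * {set T} * (T * T))%type.

Definition UP (t : Ut) := RP (t.1, t.2.1) && (t.2.2 \in RS (t.1, t.2.1)).
Definition US (t : Ut) := hi (RS (t.1, t.2.1)) t.2.2.
Definition Uw (t : Ut) : R :=
  p * (1 - p) * Rw (t.1, t.2.1) * p ^+ #|lo (RS (t.1, t.2.1)) t.2.2|.

(** As E U = 1, U - 1 is a combination of centred indicators of the sets [RS]. A second Clark-Ocone
    expansion of each one introduces the coordinate b. *)
Lemma Usum_clark om : Usum om - 1 = clark_sum p UP (fun t : Ut => t.2.2) US Uw om.
Proof.
have UsumE o : Usum o = \sum_(t | RP t) p * (1 - p) * Rw t * ind (RS t) o.
  rewrite /Usum.
  under eq_bigr => a _ do rewrite sum_TwDw mulr_sumr.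
  rewrite (exchange_big_dep (PR M)) /=; last by move=> a r _ /andP[].
  rewrite pair_big_dep /=; apply: eq_big => [[r a]|[r a] _] //=; last by rewrite mulrA.
  by rewrite andbA andbb.
rewrite -bE_Usum (eq_bE _ (fun o _ => UsumE o)) bE_sum UsumE -sumrB.
rewrite (eq_bigr (fun t : Rt => \sum_(b in RS t) cin b om * (Uw (t.1, (t.2, b)) * ind (US (t.1, (t.2, b))) om))); last first.
  move=> [[i j] a] /andP[/andP[/= iM /andP[/= jM _]] _]; rewrite bEZ bE_ind1; last first.
    rewrite subUset (subset_trans (hi_sub _ _) (MV iM)).
    exact: subset_trans (subsetDl _ _) (MV jM).
  rewrite -mulrBr clark_ocone mulr_sumr; apply: eq_bigr => b _.
  by rewrite /Uw /US /=; ring.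
rewrite pair_big_dep /clark_sum /=.
rewrite (reindex (fun t : Ut => (t.1, t.2.1, t.2.2))) /=; last first.
  by exists (fun t : Rt * T => (t.1.1, (t.1.2, t.2))) => [[r [a b]]|[[r a] b]].
by apply: eq_bigr => -[r [a b]] _ /=; rewrite mulrCA.
Qed.

Lemma Usum_moment l : 0 <= l ->
  E (fun om => (1 - Usum om) ^+ 2 * expR (l * W om)) <= (2 * e ^ 2)%:R ^+ 2 * smQ l * tiltc l.
Proof.
move=> l0; have p0' := ltW p0; have p1' := ltW p1; have s0' := ltW sg0.
rewrite (@eq_bE _ _ _ _ _ (fun om => clark_sum p UP (fun t : Ut => t.2.2) US Uw om ^+ 2 * expR (l * W om))).
  apply: (second_moment p0 p1 MV sg0 HD rho0 L0 chain) => //.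
    move=> [[i j] [a b]] /andP[/= /andP[PRr /= /andP[ai aj]] bS].
    have SU : RS (i, j, a) \subset i :|: j.
      rewrite /RS /= subUset (subset_trans (hi_sub _ _) (subsetUl _ _)).
      exact: subset_trans (subsetDl _ _) (subsetUr _ _).
    split => //=.
    - exact: (subsetP SU).
    - exact: subset_trans (hi_sub _ _) SU.
    - exact: hi_notin.
    rewrite /Uw /Rw /= !mulr_ge0 ?invr_ge0 ?exprn_ge0 ?subr_ge0//=.
    (* The factor p pays for the coordinate a, and 1 - p is bounded by 1. *)
    rewrite (_ : p * (1 - p) * (p ^+ #|lo i a| / sg ^+ 2) * p ^+ #|lo (RS (i, j, a)) b| =
       (1 - p) * p ^+ (1 + #|lo i a| + #|lo (RS (i, j, a)) b|) / sg ^+ 2); last first.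
      by rewrite !exprD expr1; ring.
    rewrite ler_pM2r ?invr_gt0 ?exprn_gt0//.
    apply: (@le_trans _ _ (p ^+ (1 + #|lo i a| + #|lo (RS (i, j, a)) b|))).
      by rewrite ler_piMl ?exprn_ge0// lerBlDr lerDl.
    rewrite ler_wiXn2l//.
    apply: leq_trans (_ : #|[set a] :|: lo i a :|: lo (RS (i, j, a)) b| <= _)%N; last first.
      apply: leq_trans (leq_card_setU _ _).1 _; rewrite leq_add2r.
      by apply: leq_trans (leq_card_setU _ _).1 _; rewrite cards1.
    apply: subset_leq_card; apply/subsetP => x /setDP[xU].
    rewrite in_setU in_set1 negb_or => /andP[xb xhi]; rewrite !in_setU in_set1.
    have := set_lo_hi i a; have := set_lo_hi (RS (i, j, a)) b => /subsetP h1 /subsetP h2.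
    case: (boolP (x \in RS (i, j, a))) => [/h1|].
      by rewrite !in_setU in_set1 (negbTE xb) (negbTE xhi) !orbF => ->; rewrite orbT.
    rewrite /RS /= !in_setU negb_or in_setD1 negb_and negbK.
    move=> /andP[xh]; case: (eqVneq x a) => //= xa xj.
    move: xU; rewrite in_setU (negbTE xj) orbF => /h2.
    by rewrite !in_setU in_set1 (negbTE xa) (negbTE xh) !orbF => ->.
  move=> [i j]; case: (boolP (PR M (i, j))) => h; last first.
    rewrite (_ : [set x | _] = finset.set0) ?cards0//.
    by apply/setP => x; rewrite !inE /UP /RP (negbTE h).
  (* a ranges over i and b over the union of i and j, whence 2 e^2 tags. *)
  apply: leq_trans (_ : #|setX i (i :|: j)| <= _)%N.
    apply: subset_leq_card; apply/subsetP => -[a b]; rewrite !inE /=.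
    move=> /andP[/andP[_ /= /andP[-> _]]]; rewrite !inE /=.
    by move=> /orP[/andP[->]|/andP[_ ->]]; rewrite ?orbT.
  have [/Me ie /andP[/Me je _]] := andP h.
  rewrite cardsX mulnCA leq_mul//; apply: leq_trans (leq_card_setU _ _).1 _.
  by rewrite mul2n -addnn leq_add.
by move=> om _; rewrite -Usum_clark -sqrrN opprB.
Qed.
End SteinMethod.

(** * From tilted moments to the tail probability *)

Section Assembly.
Variables (R : realType) (T : finType) (p : R).
Hypotheses (p0 : 0 < p) (p1 : p < 1).
Variables (V : {set T}) (M : {set {set T}}) (sg : R).
Hypotheses (MV : forall i, i \in M -> i \subset V) (sg0 : 0 < sg).
Variables (kap t : R).
Hypotheses (kap0 : 0 <= kap) (t0 : 0 <= t).
Implicit Types (om : {set T}) (l w : R).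

Local Notation E := (bE p V).
Local Notation W := (cstd p M sg).
Local Notation mgf := (mgf p V M sg).

Hypothesis Ubound : forall l, 0 <= l <= t ->
  E (fun om => `|1 - Usum p M sg om| * expR (l * W om)) <= (1 + l) * kap * mgf l.
Hypothesis Rbound : forall l, 0 <= l <= t ->
  E (fun om => `|Rsum p M sg om| * expR (l * W om)) <= (1 + l) * kap * mgf l.

Lemma is_derive_sum (I : finType) (P : pred I) (F : I -> R -> R) (dF : I -> R) (x : R) :
  (forall i, is_derive x (1 : R) (F i) (dF i)) ->
  is_derive x (1 : R) (fun l => \sum_(i | P i) F i l) (\sum_(i | P i) dF i).
Proof.
move=> dFi; elim: (index_enum I) => [|i r IH].
  rewrite (_ : (fun l => _) = cst 0); first by rewrite big_nil; exact: is_derive_cst.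
  by apply/funext => l; rewrite big_nil.
rewrite (_ : (fun l => _) = (fun l => (if P i then F i l else 0) + \sum_(i <- r | P i) F i l)); last first.
  by apply/funext => l; rewrite big_cons; case: ifP; rewrite ?add0r.
rewrite big_cons; case: (P i); first exact: is_deriveD.
by under eq_fun do rewrite add0r.
Qed.

Lemma is_derive_mgf l : is_derive l (1 : R) mgf (E (fun om => W om * expR (l * W om))).
Proof.
apply: is_derive_sum => om; apply: is_derive_eq; rewrite /GRing.scale /=.
by ring.
Qed.

Lemma mgf0 : mgf 0 = 1.
Proof.
rewrite -[RHS](bE_cst p V); apply: eq_bE => om _.
by rewrite mul0r expR0.
Qed.

(** A Gronwall argument: [bE_cstd_le] and the two moment hypotheses give M' <= (l + 2 kap l (1 + l))
    M, and M 0 = 1. *)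
Lemma mgf_le l : 0 <= l <= t -> mgf l <= expR (l ^+ 2 / 2 + kap * (l ^+ 2 * (1 + l))).
Proof.
move=> /andP[l0 lt].
(* h' = x + kap (2 x + 3 x^2) exceeds the logarithmic growth rate x + kap (2 x + 2 x^2), so M exp (-
   h) does not increase. *)
pose h x : R := x ^+ 2 / 2 + kap * (x ^+ 2 * (1 + x)).
have dm x : is_derive x (1 : R) mgf (E (fun om => W om * expR (x * W om))) := is_derive_mgf x.
have d x : is_derive x (1 : R) (fun y => mgf y * expR (- h y))
    ((E (fun om => W om * expR (x * W om)) - (x + kap * (2 * x + 3 * x ^+ 2)) * mgf x) * expR (- h x)).
  by rewrite /h; apply: is_derive_eq; rewrite /GRing.scale /=; field.
have [c /andP[c0 cl] e] := mvt_is_derive l0 d.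
have : mgf l * expR (- h l) <= 1.
  rewrite -[leRHS](_ : mgf 0 * expR (- h 0) = 1); last first.
    by rewrite mgf0 /h expr0n /= !mul0r mulr0 addr0 oppr0 expR0 mulr1.
  rewrite -subr_le0 e mulr_le0_ge0 ?subr_ge0//.
  rewrite mulr_le0_ge0 ?expR_ge0// subr_le0.
  apply: le_trans (bE_cstd_le p0 p1 MV sg0 c0) _.
  have ct : 0 <= c <= t by rewrite c0 (le_trans cl).
  have m0 := mgf_ge0 p0 p1 V M sg c.
  apply: (@le_trans _ _ (c * (mgf c + (1 + c) * kap * mgf c + (1 + c) * kap * mgf c))).
    by rewrite ler_wpM2l// lerD ?Rbound// lerD2l Ubound.
  rewrite [leLHS](_ : _ = (c + kap * (2 * c + 2 * c ^+ 2)) * mgf c); last by ring.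
  rewrite ler_wpM2r// lerD2l ler_wpM2l// lerD2l ler_wpM2r ?sqr_ge0//; lra.
by rewrite expRN ler_pdivrMr ?expR_gt0// mul1r.
Qed.

Local Notation EE := (expR (kap * (t ^+ 2 * (1 + t)))).

Lemma mgf_le_EE l : 0 <= l <= t -> mgf l <= expR (l ^+ 2 / 2) * EE.
Proof.
move=> /andP[l0 lt]; apply: le_trans (mgf_le _) _; first by rewrite l0.
rewrite -expRD ler_expR lerD2l ler_wpM2l// ler_pM ?sqr_ge0//; last by rewrite lerD2l.
  by rewrite addr_ge0.
by rewrite ler_sqr.
Qed.

(* On [j, j + 1] the weight exp (w^2 / 2) is at most e^(1/2) exp (j w - j^2 / 2). *)
Lemma stein_env_le w : stein_env t w <= Phi R (- t) +
  \sum_(j < (Num.truncn t).+1) (6 * Phi R (- t) * (1 + j%:R) * expR (- (j%:R ^+ 2 / 2)) * expR (j%:R * w))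
  + 2 * expR (- t ^+ 2) * expR (t * w).
Proof.
have Q0 := Phi_ge0 (- t).
have s0 (j : 'I_(Num.truncn t).+1) : 0 <= 6 * Phi R (- t) * (1 + j%:R) * expR (- (j%:R ^+ 2 / 2)) * expR (j%:R * w).
  by rewrite !mulr_ge0 ?expR_ge0// addr_ge0.
have e0 : 0 <= 2 * expR (- t ^+ 2) * expR (t * w) by rewrite !mulr_ge0 ?expR_ge0.
rewrite /stein_env; case: (leP w t) => wt; last first.
  (* Above t the last summand alone suffices, because exp (t (w - t)) >= 1. *)
  rewrite -[leLHS]add0r lerD//; first by rewrite addr_ge0// sumr_ge0.
  rewrite -mulrA ler_peMr// -expRD -[leLHS]expR0 ler_expR.
  have := mulr_ge0 t0 (_ : 0 <= w - t); rewrite subr_ge0 (ltW wt) => /(_ isT).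
  by rewrite expr2; lra.
apply: le_trans (_ : Phi R (- t) + \sum_(j < (Num.truncn t).+1) (6 * Phi R (- t) * (1 + j%:R) * expR (- (j%:R ^+ 2 / 2)) * expR (j%:R * w)) <= _); last by rewrite lerDl.
rewrite mulrDr mulr1 lerD2l.
case: (leP w 0) => [w0|w0]; first by rewrite mulr0 mul0r mulr0 sumr_ge0.
have w0' := ltW w0; have /andP[jw wj] := truncn_itv w0'.
have jt : (Num.truncn w < (Num.truncn t).+1)%N by rewrite ltnS le_truncn.
rewrite (bigD1 (Ordinal jt)) //= -[leLHS]addr0 lerD ?sumr_ge0//.
set j : R := (Num.truncn w)%:R in jw *.
have wj' : w <= 1 + j by rewrite addrC; apply: ltW; move: wj; rewrite -natr1.
have e2 : expR (2^-1) <= 2 :> R.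
  have h : 2^-1 <= expR (- 2^-1) :> R by have := expR_ge1Dx (- 2^-1 : R); lra.
  by rewrite -[expR _]invrK -expRN -[leRHS]invrK lef_pV2 ?posrE ?expR_gt0 ?invr_gt0.
have ew : expR (w ^+ 2 / 2) <= 2 * (expR (- (j ^+ 2 / 2)) * expR (j * w)).
  apply: le_trans (_ : expR (2^-1) * (expR (- (j ^+ 2 / 2)) * expR (j * w)) <= _); last first.
    by rewrite ler_wpM2r// mulr_ge0 ?expR_ge0.
  rewrite -!expRD ler_expR.
  have : (w - j) ^+ 2 <= 1 ^+ 2 by rewrite ler_sqr ?nnegrE ?subr_ge0//; lra.
  by rewrite expr1n; lra.
rewrite [leRHS](_ : _ = Phi R (- t) * (3 * (1 + j) * (2 * (expR (- (j ^+ 2 / 2)) * expR (j * w))))); last by ring.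
rewrite ler_wpM2l// ler_pM ?expR_ge0 ?mulr_ge0//; lra.
Qed.

(** In slab j the factor exp (- j^2 / 2) cancels M(j), so each of at most 1 + t slabs costs 6 (1 +
    t)^2. In the last term exp (- t^2 / 2) remains, which [mills_lower] bounds by a multiple of (1 +
    t) Phi (- t). In units of (1 + t)(1 + t^2) the three parts cost 1, 12 and 24, whence 37. *)
Lemma bE_env_le (Y : {set T} -> R) :
  (forall l, 0 <= l <= t -> E (fun om => `|Y om| * expR (l * W om)) <= (1 + l) * kap * mgf l) ->
  E (fun om => `|Y om| * stein_env t (W om))
  <= 37 * kap * ((1 + t) * (1 + t ^+ 2)) * Phi R (- t) * EE.
Proof.
move=> HY; have Q0 := Phi_ge0 (- t); set Q := Phi R (- t) in Q0 *.
have E1 : 1 <= EE.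
  by rewrite -[leLHS]expR0 ler_expR !mulr_ge0 ?sqr_ge0// addr_ge0.
have E0 : 0 <= EE by exact: expR_ge0.
have /andP[mt _] := truncn_itv t0.
set m := Num.truncn t in mt.
apply: le_trans (_ : E (fun om => Q * (`|Y om| * expR (0 * W om)) +
   \sum_(j < m.+1) (6 * Q * (1 + j%:R) * expR (- (j%:R ^+ 2 / 2))) * (`|Y om| * expR (j%:R * W om))
   + 2 * expR (- t ^+ 2) * (`|Y om| * expR (t * W om))) <= _).
  apply: ler_bE => // om _.
  apply: le_trans (ler_wpM2l (normr_ge0 _) (stein_env_le (W om))) _.
  rewrite le_eqVlt; apply/orP; left; apply/eqP.
  rewrite mul0r expR0 !mulrDr mulr_sumr; congr (_ + _ + _).
  - by rewrite mulr1 mulrC.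
  - by apply: eq_bigr => j _; rewrite -/Q; ring.
  - by ring.
rewrite !bED bE_sum !bEZ.
under eq_bigr => j _ do rewrite bEZ.
have h0 : E (fun om => `|Y om| * expR (0 * W om)) <= kap * EE.
  apply: le_trans (HY 0 _) _; first by rewrite lexx.
  by rewrite mgf0 addr0 mul1r mulr1 ler_peMr.
have ht : 2 * expR (- t ^+ 2) * E (fun om => `|Y om| * expR (t * W om)) <= 12 * (1 + t) ^+ 2 * kap * Q * EE.
  have tt : 0 <= t <= t by rewrite t0 lexx.
  apply: le_trans (_ : 2 * expR (- t ^+ 2) * ((1 + t) * kap * (expR (t ^+ 2 / 2) * EE)) <= _).
    rewrite ler_wpM2l ?mulr_ge0 ?expR_ge0//; apply: le_trans (HY t tt) _.
    by rewrite ler_wpM2l ?mgf_le_EE// mulr_ge0// addr_ge0.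
  have eE : expR (- t ^+ 2) * expR (t ^+ 2 / 2) = expR (- (t ^+ 2 / 2)).
    by rewrite -expRD; congr expR; field.
  rewrite [leLHS](_ : _ = 2 * (1 + t) * kap * EE * (expR (- t ^+ 2) * expR (t ^+ 2 / 2))); last by ring.
  rewrite eE [leRHS](_ : _ = 2 * (1 + t) * kap * EE * (6 * (1 + t) * Q)); last by ring.
  apply: ler_wpM2l; first by rewrite !mulr_ge0// addr_ge0.
  have := mills_lower t0; rewrite npdfE mulNr -/Q mulrC ler_pdivrMr ?sqrt2pi_gt0// => /le_trans; apply.
  rewrite (_ : 6 * (1 + t) * Q = 2 * (1 + t) * Q * 3); last by ring.
  by rewrite ler_wpM2l ?sqrt2pi_le3// !mulr_ge0// addr_ge0.
have hs : \sum_(j < m.+1) 6 * Q * (1 + j%:R) * expR (- (j%:R ^+ 2 / 2)) * E (fun om => `|Y om| * expR (j%:R * W om))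
    <= 6 * (1 + t) ^+ 3 * kap * Q * EE.
  apply: le_trans (_ : \sum_(j < m.+1) 6 * (1 + t) ^+ 2 * kap * Q * EE <= _).
    apply: ler_sum => j _.
    have jt : j%:R <= t by apply: le_trans mt; rewrite ler_nat -ltnS.
    have jj : 0 <= (j%:R : R) <= t by rewrite ler0n.
    apply: le_trans (_ : 6 * Q * (1 + j%:R) * expR (- (j%:R ^+ 2 / 2)) * ((1 + j%:R) * kap * (expR (j%:R ^+ 2 / 2) * EE)) <= _).
      rewrite ler_wpM2l ?mulr_ge0 ?expR_ge0 ?addr_ge0//; apply: le_trans (HY _ jj) _.
      by rewrite ler_wpM2l ?mgf_le_EE// mulr_ge0// addr_ge0.
    rewrite [leLHS](_ : _ = 6 * kap * Q * EE * (1 + j%:R) ^+ 2 * (expR (- (j%:R ^+ 2 / 2)) * expR (j%:R ^+ 2 / 2))); last by ring.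
    rewrite -expRD addNr expR0 mulr1 [leRHS](_ : _ = 6 * kap * Q * EE * (1 + t) ^+ 2); last by ring.
    by rewrite ler_wpM2l ?mulr_ge0// ler_sqr ?nnegrE ?addr_ge0// lerD2l.
  rewrite sumr_const card_ord -[leLHS]mulr_natl.
  rewrite [leRHS](_ : _ = (1 + t) * (6 * (1 + t) ^+ 2 * kap * Q * EE)); last by ring.
  apply: ler_wpM2r; first by rewrite !mulr_ge0 ?exprn_ge0 ?addr_ge0.
  by rewrite -natr1 addrC lerD2l.
have h0' := ler_wpM2l Q0 h0.
apply: le_trans (lerD (lerD h0' hs) ht) _.
rewrite [leLHS](_ : _ = kap * Q * EE * (1 + 6 * (1 + t) ^+ 3 + 12 * (1 + t) ^+ 2)); last by ring.
rewrite [leRHS](_ : _ = kap * Q * EE * (37 * ((1 + t) * (1 + t ^+ 2)))); last by ring.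
rewrite ler_wpM2l ?mulr_ge0//.
have s1 : (1 + t) ^+ 2 <= 2 * (1 + t ^+ 2) by have := sqr_ge0 (1 - t); lra.
have t1 : 0 <= 1 + t by rewrite addr_ge0.
have s2 : (1 + t) * (1 + t) ^+ 2 <= 2 * ((1 + t) * (1 + t ^+ 2)) by rewrite [leRHS]mulrCA ler_wpM2l.
have s3 : 1 + t ^+ 2 <= (1 + t) * (1 + t ^+ 2).
  by rewrite ler_peMl ?addr_ge0 ?sqr_ge0// lerDl.
have s4 : 0 <= t ^+ 2 by exact: sqr_ge0.
rewrite (_ : (1 + t) ^+ 3 = (1 + t) * (1 + t) ^+ 2); last by ring.
move: s1 s2 s3 s4; generalize ((1 + t) * (1 + t) ^+ 2) => x.
generalize ((1 + t) ^+ 2) => y; generalize ((1 + t) * (1 + t ^+ 2)) => z.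
generalize (t ^+ 2) => u *; lra.
Qed.

Lemma normal_approximation :
  `|E (fun om => (W om <= t)%R%:R) - Phi R t|
  <= 74 * kap * ((1 + t) * (1 + t ^+ 2)) * Phi R (- t) * EE.
Proof.
apply: le_trans (stein_bound p0 p1 MV sg0 t0) _.
apply: le_trans (lerD (bE_env_le Ubound) (bE_env_le Rbound)) _.
by rewrite le_eqVlt; apply/orP; left; apply/eqP; ring.
Qed.
End Assembly.

(** * Copies of a graph *)

Section Permutations.
Variable U : finType.
Implicit Types (s : {perm U}) (A B : {set U}) (k h K : {set {set U}}).

(** Points are matched one at a time; a transposition corrects the new image without moving those
    already placed. *)
Lemma perm_extension (X : finType) (A : {set X}) (f f' : X -> U) :
  {in A &, injective f} -> {in A &, injective f'} ->
  exists s : {perm U}, forall x, x \in A -> s (f x) = f' x.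
Proof.
elim: {A}#|A| {-2}A (leqnn #|A|) => [|m IH] A.
  rewrite leqn0 cards_eq0 => /eqP -> _ _; exists 1%g => x.
  by rewrite inE.
have [->|[a aA]] := set_0Vmem A; first by move=> _ _ _; exists 1%g => x; rewrite inE.
rewrite (cardsD1 a) aA ltnS => h fA f'A.
have sub x : x \in A :\ a -> x \in A by rewrite inE => /andP[].
have [||s sE] := IH _ h.
- by move=> x y /sub xA /sub yA; exact: fA.
- by move=> x y /sub xA /sub yA; exact: f'A.
exists (s * tperm (s (f a)) (f' a))%g => x xA; rewrite permM.
have [->|xa] := eqVneq x a; first by rewrite tpermL.
have xAa : x \in A :\ a by rewrite !inE xa.
rewrite (sE x xAa) tpermD//; apply/eqP.
  rewrite -(sE _ xAa) => /perm_inj/(fA _ _ aA xA) e.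
  by rewrite e eqxx in xa.
by move=> /(f'A _ _ aA xA) e; rewrite e eqxx in xa.
Qed.

Lemma card_fiber_le (X Y : finType) (f : X -> Y) (A : {set X}) (m : nat) :
  (forall x, x \in A -> #|[set y in A | f y == f x]| <= m)%N -> (#|A| <= #|f @: A| * m)%N.
Proof.
move=> h; rewrite -sum1_card (partition_big_imset f) /=.
rewrite -sum_nat_const; apply: leq_sum => y /imsetP[x xA ->].
by rewrite sum1dep_card; apply: h.
Qed.

(** A permutation restricts to an injection of A into B, and at most (|U| - |A|)! permutations share
    a restriction. *)
Lemma card_perm_sub A B :
  (#|[set s : {perm U} | s @: A \subset B]| <= #|B| ^_ #|A| * (#|U| - #|A|)`!)%N.
Proof.
pose r (s : {perm U}) : {ffun {x | x \in A} -> U} := [ffun x => s (val x)].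
apply: leq_trans (@card_fiber_le _ _ r _ (#|U| - #|A|)`! _) _.
  move=> s _; rewrite -(cardsC A) addKn -card_perm.
  rewrite -(card_imset _ (mulIg s^-1%g)); apply: subset_leq_card.
  apply/subsetP => u /imsetP[s']; rewrite inE => /andP[_ /eqP e] ->.
  apply/subsetP => x; rewrite !inE permM.
  apply: contraNN => xA; apply/eqP.
  have := congr1 (fun g : {ffun {x | x \in A} -> U} => g (Sub x xA)) e.
  by rewrite !ffunE /= => ->; rewrite permK.
rewrite leq_mul2r; apply/orP; right.
have -> : #|A| = #|{: {x | x \in A}}| by rewrite card_sig; apply: eq_card.
rewrite -card_inj_ffuns_on; apply: subset_leq_card; apply/subsetP => g /imsetP[s].
rewrite inE => sAB ->; rewrite inE; apply/andP; split.
  apply/ffun_onP => x; rewrite ffunE; apply: (subsetP sAB).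
  exact: imset_f (valP x).
apply/injectiveP => x y; rewrite !ffunE => /perm_inj; exact: val_inj.
Qed.

Definition act s k := (fun x : {set U} => s @: x) @: k.

Lemma imset_perm_inj s : injective (fun x : {set U} => s @: x).
Proof. exact/imset_inj/perm_inj. Qed.

Lemma act_inj s : injective (act s).
Proof. exact/imset_inj/imset_perm_inj. Qed.

Lemma actK s k : act s^-1%g (act s k) = k.
Proof.
rewrite /act -imset_comp -[RHS]imset_id; apply: eq_imset => x /=.
by rewrite -imset_comp -[RHS]imset_id; apply: eq_imset => y /=; rewrite permK.
Qed.

Lemma card_act s k : #|act s k| = #|k|.
Proof. by rewrite card_imset//; exact: imset_perm_inj. Qed.

Lemma actI s k K : act s (k :&: K) = act s k :&: act s K.
Proof. by apply: imsetI => x y _ _; exact: imset_perm_inj. Qed.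

Lemma act_cover s h K : act s h \subset K -> s @: cover h \subset cover K.
Proof.
move=> hK; apply/subsetP => y /imsetP[x /bigcupP[e eh xe] ->].
apply/bigcupP; exists (s @: e); last exact: imset_f.
by apply: (subsetP hK); exact: imset_f.
Qed.

End Permutations.

(** * Chain bound for a family invariant under vertex permutations *)

Section ChainBound.
Variables (R : realType) (U : finType) (p : R).
Hypotheses (p0 : 0 < p) (p1 : p < 1).
Implicit Types (s : {perm U}) (k h K : {set {set U}}).
Variables (M : {set {set {set U}}}) (e v : nat) (Psi : R).
Hypothesis actM : forall s k, k \in M -> act s k \in M.
Hypothesis Me : forall k, k \in M -> #|k| = e.
Hypothesis Mv : forall k, k \in M -> (#|cover k| <= v)%N.
Hypothesis Psi0 : 0 < Psi.
Hypothesis MPsi : forall k h, k \in M -> h \subset k -> h != finset.set0 ->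
  Psi <= #|U|%:R ^+ #|cover h| * p ^+ #|h|.
Hypothesis Uv : (4 * v ^ 2 <= #|U|)%N.

(** This is prod (1 - i / n) >= 1 - sum i / n over i < k, with the sum of the i bounded by k^2 /
    2. *)
Lemma ffact_lower (k : nat) : (k <= #|U|)%N -> (0 < #|U|)%N ->
  #|U|%:R ^+ k * (1 - k%:R ^+ 2 / (2 * #|U|%:R)) <= (#|U| ^_ k)%:R :> R.
Proof.
move: #|U| => n kn n0; have n0' : 0 < n%:R :> R by rewrite ltr0n.
elim: k kn => [|k IH] kn; first by rewrite ffactn0 expr0n /= mul0r subr0 mulr1.
have {IH} := IH (ltnW kn).
rewrite ffactnSr natrM natrB; last exact: ltnW.
move=> h; have nk : 0 <= n%:R - k%:R :> R by rewrite subr_ge0 ler_nat ltnW.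
apply: le_trans (ler_wpM2r nk h).
rewrite exprS -[leRHS]mulrA [leLHS](_ : _ = n%:R ^+ k * (n%:R * (1 - k.+1%:R ^+ 2 / (2 * n%:R)))); last by ring.
rewrite ler_wpM2l ?exprn_ge0//.
rewrite -[k.+1%:R]natr1.
have -> : n%:R * (1 - (k%:R + 1) ^+ 2 / (2 * n%:R)) = n%:R - (k%:R + 1) ^+ 2 / 2 :> R.
  by field; rewrite lt0r_neq0.
have -> : (1 - k%:R ^+ 2 / (2 * n%:R)) * (n%:R - k%:R) = n%:R - k%:R - k%:R ^+ 2 / 2 + k%:R ^+ 3 / (2 * n%:R) :> R.
  by field; rewrite lt0r_neq0.
have : 0 <= k%:R ^+ 3 / (2 * n%:R) :> R by rewrite divr_ge0 ?exprn_ge0 ?mulr_ge0.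
by generalize (k%:R ^+ 3 / (2 * n%:R) : R) => x; generalize (n%:R : R) (k%:R : R) => *; lra.
Qed.

(** The assumption 4 v^2 <= n makes k^2 / (2 n) at most 1/8; this is the origin of 8 / 7. *)
Lemma expn_le_ffact (k : nat) : (k <= v)%N -> #|U|%:R ^+ k <= 8 / 7 * (#|U| ^_ k)%:R :> R.
Proof.
move=> kv; have [v0|v0] := posnP v.
  by move: kv; rewrite v0 leqn0 => /eqP ->; rewrite expr0 ffactn0; lra.
have n0 : (0 < #|U|)%N by apply: leq_trans Uv; rewrite muln_gt0 expn_gt0 v0.
have kn : (k <= #|U|)%N.
  apply: leq_trans Uv; apply: leq_trans kv _; rewrite expnS expn1 mulnCA leq_pmulr//.
  by rewrite muln_gt0.
have n0' : 0 < #|U|%:R :> R by rewrite ltr0n.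
have h := ffact_lower kn n0.
have h2 : k%:R ^+ 2 / (2 * #|U|%:R) <= 8^-1 :> R.
  rewrite ler_pdivrMr ?mulr_gt0//.
  have : (4 * k ^ 2)%:R <= #|U|%:R :> R.
    by rewrite ler_nat (leq_trans _ Uv)// leq_mul2l leq_exp2r.
  by rewrite natrM natrX; lra.
have x0 : 0 <= #|U|%:R ^+ k :> R by rewrite exprn_ge0.
have h3 : #|U|%:R ^+ k * (7 / 8) <= #|U|%:R ^+ k * (1 - k%:R ^+ 2 / (2 * #|U|%:R)) :> R.
  by rewrite ler_wpM2l//; move: h2; generalize (k%:R ^+ 2 / (2 * #|U|%:R) : R) => *; lra.
rewrite [leLHS](_ : _ = 8 / 7 * (#|U|%:R ^+ k * (7 / 8))); last by field.
by rewrite ler_wpM2l// (le_trans h3 h).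
Qed.

(** 2^e counts the possible intersections h inside a member, and (m v)^_v bounds the placements of
    the at most v vertices of h among the at most m v vertices of the chain. *)
Definition chainL (m : nat) : R := 8 / 7 * 2 ^+ e * ((m * v) ^_ v)%:R.

Lemma card_cover_cov m K : cov M m K -> (#|cover K| <= m * v)%N.
Proof.
elim: m K => [|m IH] K /=; first by move=> /eqP ->; rewrite /cover big_set0 cards0.
move=> /exists_inP[i iM h].
apply: leq_trans (_ : #|cover i :|: cover (K :\: i)| <= _)%N.
  apply: subset_leq_card; apply/subsetP => x /bigcupP[y yK xy].
  rewrite in_setU; case: (boolP (y \in i)) => yi; apply/orP; [left|right].
    by apply/bigcupP; exists y.
  by apply/bigcupP; exists y => //; rewrite inE yi.
apply: leq_trans (leq_card_setU _ _).1 _; rewrite mulSn leq_add//; first exact: Mv.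
exact: IH.
Qed.

Lemma ffact_homol (a b m : nat) : (a <= b)%N -> (a ^_ m <= b ^_ m)%N.
Proof.
move=> ab; elim: m => [|m IH]; first by rewrite !ffactn0.
by rewrite !ffactnSr leq_mul// leq_sub2r.
Qed.

Lemma ffact_homo (N a b : nat) : (a <= b)%N -> (b <= N)%N -> (N ^_ a <= N ^_ b)%N.
Proof.
elim: b => [|b IH]; first by rewrite leqn0 => /eqP ->.
rewrite leq_eqVlt => /orP[/eqP ->//|]; rewrite ltnS => ab bN.
by apply: leq_trans (IH ab (ltnW bN)) _; rewrite ffactnSr leq_pmulr// subn_gt0.
Qed.

(* The intersection of the permuted k with K is the image of some nonempty h in k; sum over all such h. *)
Lemma perm_sum_bound m k K : (0 < m)%N -> cov M m K -> k \in M ->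
  \sum_(s : {perm U} | nb M K (act s k)) p ^+ #|act s k :|: K|
  <= (#|U|)`!%:R * (chainL m / Psi * p ^+ #|k| * p ^+ #|K|).
Proof.
move=> m0 cK kM; have p0' := ltW p0.
(* The value of p^|act s k :|: K| when the intersection is the image of h. *)
pose c h : R := p ^+ #|k| * p ^+ #|K| / p ^+ #|h|.
have c0 h : 0 <= c h by rewrite /c !mulr_ge0 ?invr_ge0 ?exprn_ge0.
apply: le_trans (_ : \sum_(s : {perm U}) \sum_(h in powerset k | h != finset.set0) (act s h \subset K)%:R * c h <= _).
  rewrite big_mkcond; apply: ler_sum => s _.
  have t0 : 0 <= \sum_(h in powerset k | h != finset.set0) (act s h \subset K)%:R * c h.
    by apply: sumr_ge0 => h _; rewrite mulr_ge0.
  case: ifP => // /andP[_ kK].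
  pose H := [set x in k | s @: (x : {set U}) \in K].
  have HE : act s H = act s k :&: K.
    apply/setP => y; rewrite inE; apply/imsetP/andP => [[x]|[/imsetP[x xk ->] yK]].
      by rewrite inE => /andP[xk xK] ->; rewrite xK; split=> //; exact: imset_f.
    by exists x => //; rewrite inE xk.
  have H0 : H != finset.set0.
    by apply: contraNneq kK => e0; rewrite -HE e0 /act imset0.
  have Hk : H \in powerset k by rewrite inE; apply/subsetP => x; rewrite inE => /andP[].
  rewrite (bigD1 H) /=; last by rewrite Hk H0.
  rewrite -[leLHS]addr0 lerD ?sumr_ge0//; last by move=> h _; rewrite mulr_ge0.
  rewrite HE subsetIr mul1r /c -(card_act s H) HE -(card_act s k) -exprD.
  rewrite ler_pdivlMr ?exprn_gt0// -exprD cardsUI lexx//.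
rewrite exchange_big /=.
have fact0 : (#|U|)`!%:R != 0 :> R by rewrite pnatr_eq0 -lt0n fact_gt0.
apply: le_trans (_ : \sum_(h in powerset k | h != finset.set0)
   (#|U|)`!%:R * (8 / 7 * ((m * v) ^_ v)%:R / Psi * p ^+ #|k| * p ^+ #|K|) <= _).
  apply: ler_sum => h /andP[hk h0]; rewrite inE in hk.
  rewrite -mulr_suml -natr_sum.
  rewrite (_ : (\sum_(s : {perm U}) (act s h \subset K))%N = #|[set s | act s h \subset K]|); last first.
    by rewrite -sum1dep_card [RHS]big_mkcond.
  have hv : (#|cover h| <= v)%N.
    apply: leq_trans (Mv kM); apply: subset_leq_card; apply/subsetP => x /bigcupP[y yh xy].
    by apply/bigcupP; exists y => //; exact: (subsetP hk).
  have h1 : (#|[set s | act s h \subset K]| <= (m * v) ^_ v * (#|U| - #|cover h|)`!)%N.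
    apply: leq_trans (_ : #|[set s : {perm U} | s @: cover h \subset cover K]| <= _)%N.
      apply: subset_leq_card; apply/subsetP => s; rewrite !inE; exact: act_cover.
    apply: leq_trans (card_perm_sub _ _) _; rewrite leq_mul2r; apply/orP; right.
    have [hK|Kh] := leqP #|cover h| #|cover K|; last by rewrite ffact_small.
    apply: leq_trans (_ : (m * v) ^_ #|cover h| <= _)%N.
      by rewrite ffact_homol// (card_cover_cov cK).
    by rewrite ffact_homo// leq_pmull.
  apply: le_trans (_ : ((m * v) ^_ v * (#|U| - #|cover h|)`!)%:R * c h <= _).
    by rewrite ler_wpM2r// ler_nat.
  have hU : (#|cover h| <= #|U|)%N by exact: max_card.
  have fE : (#|U|)`!%:R = (#|U| ^_ #|cover h|)%:R * (#|U| - #|cover h|)`!%:R :> R.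
    by rewrite -natrM ffact_fact.
  have hP := MPsi kM hk h0.
  have hn := expn_le_ffact hv.
  have : Psi <= 8 / 7 * (#|U| ^_ #|cover h|)%:R * p ^+ #|h|.
    by apply: le_trans hP _; rewrite ler_wpM2r ?exprn_ge0.
  rewrite natrM /c fE.
  have ph0 : 0 < p ^+ #|h| by rewrite exprn_gt0.
  move: ph0; generalize (p ^+ #|h|) => x x0.
  set y : R := (#|U| ^_ #|cover h|)%:R => hy.
  have hy' : x^-1 <= 8 / 7 * y / Psi.
    by rewrite ler_pdivlMr// [leLHS]mulrC ler_pdivrMr.
  have core (a b f u d z : R) : 0 <= a -> 0 <= f -> 0 <= u * d -> z <= 8 / 7 * b / Psi ->
      a * f * (u * d * z) <= b * f * (8 / 7 * a / Psi * u * d).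
    move=> a0 f0 cd0 zb.
    rewrite [leRHS](_ : _ = a * f * (u * d * (8 / 7 * b / Psi))); last by ring.
    by rewrite ler_wpM2l ?mulr_ge0// ler_wpM2l.
  by apply: core => //; rewrite mulr_ge0 ?exprn_ge0.
rewrite -mulr_sumr ler_wpM2l// sumr_const -[leLHS]mulr_natl.
rewrite [leRHS](_ : _ = 2 ^+ e * (8 / 7 * ((m * v) ^_ v)%:R / Psi * p ^+ #|k| * p ^+ #|K|)); last first.
  by rewrite /chainL [8 / 7 * _]mulrC !mulrA.
rewrite ler_wpM2r ?mulr_ge0 ?invr_ge0 ?exprn_ge0 ?(ltW Psi0)//.
rewrite -natrX ler_nat -(Me kM) -card_powerset; apply: subset_leq_card.
by apply/subsetP => h; rewrite unfold_in => /andP[].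
Qed.

(** Permuting the vertices permutes [M], so the sum over k equals its average over all permutations
    s of the sum over [act s k]. After exchanging the sums, each fixed k is bounded by
    [perm_sum_bound]. *)
Lemma chain_bound m K : cov M m K ->
  \sum_(k | nb M K k) p ^+ #|k :|: K| <= chainL m * (mean p M / Psi) * p ^+ #|K|.
Proof.
move=> cK.
case: m cK => [|m] cK.
  have K0 : K = finset.set0 by apply/eqP.
  rewrite big_pred0 => [|k]; last by rewrite /nb K0 setI0 eqxx andbF.
  by rewrite !mulr_ge0 ?sumr_ge0 ?invr_ge0 ?exprn_ge0 ?(ltW p0) ?(ltW Psi0)// => i _; rewrite exprn_ge0 ?(ltW p0).
have fact0 : 0 < (#|U|)`!%:R :> R by rewrite ltr0n fact_gt0.
rewrite -(ler_pM2l fact0).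
pose F k : R := if nb M K k then p ^+ #|k :|: K| else 0.
have actM' s k : (act s k \in M) = (k \in M).
  by apply/idP/idP; [rewrite -{2}(actK s k); exact: actM | exact: actM].
have avg s : \sum_(k | nb M K k) p ^+ #|k :|: K| = \sum_(k in M) F (act s k).
  rewrite big_mkcond (reindex_inj (@act_inj _ s)) /= [RHS]big_mkcond; apply: eq_bigr => k _.
  by rewrite /F -(actM' s k) /nb; case: (act s k \in M).
have -> : (#|U|)`!%:R * \sum_(k | nb M K k) p ^+ #|k :|: K| =
    \sum_(s : {perm U}) \sum_(k in M) F (act s k).
  rewrite [RHS](eq_bigr (fun=> \sum_(k | nb M K k) p ^+ #|k :|: K|)); last by move=> s _; rewrite -avg.
  rewrite sumr_const -[RHS]mulr_natl -(cardsT U) -card_perm; congr (_%:R * _).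
  have h (s : {perm U}) : s \in perm_on [set: U] by apply/subsetP => x _; exact: in_setT.
  by apply: eq_card => s; rewrite h.
rewrite exchange_big /=.
rewrite [leRHS](_ : _ = \sum_(k in M) (#|U|)`!%:R * (chainL m.+1 / Psi * p ^+ #|k| * p ^+ #|K|)); last first.
  rewrite -mulr_sumr; congr (_ * _); rewrite -mulr_suml -mulr_sumr; congr (_ * _).
  by rewrite -[RHS]mulrA [Psi^-1 * _]mulrC.
apply: ler_sum => k kM; apply: le_trans (perm_sum_bound _ cK kM) => //.
by rewrite [leRHS]big_mkcond.
Qed.
End ChainBound.

(** * Lower bound for the variance *)

Section VarianceBound.
Variables (R : realType) (T : finType) (p : R).
Hypotheses (p0 : 0 < p) (p1 : p < 1).
Variables (V : {set T}) (M : {set {set T}}) (e : nat).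
Hypothesis MV : forall i, i \in M -> i \subset V.
Hypothesis Me : forall i, i \in M -> #|i| = e.
Implicit Types (i j h : {set T}).

Local Notation var := (bE p V (fun om => (cnt R M om - mean p M) ^+ 2)).

Lemma varE : var = \sum_(i in M) \sum_(j in M) (p ^+ #|i :|: j| - p ^+ #|i| * p ^+ #|j|).
Proof.
rewrite (@eq_bE _ _ _ _ _ (fun om => \sum_(i in M) \sum_(j in M) (ind R (i :|: j) om
    - p ^+ #|j| * ind R i om - p ^+ #|i| * ind R j om + p ^+ #|i| * p ^+ #|j|))); last first.
  move=> om _; rewrite /cnt /mean -sumrB expr2 mulr_suml; apply: eq_bigr => i _.
  by rewrite mulr_sumr; apply: eq_bigr => j _; rewrite ind_setU; ring.
rewrite bE_sum; apply: eq_bigr => i iM; rewrite bE_sum; apply: eq_bigr => j jM.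
have iV := MV iM; have jV := MV jM.
have UV : i :|: j \subset V by rewrite subUset iV.
by rewrite bED !bEB !bEZ !bE_ind1 ?bE_cst//; ring.
Qed.

Lemma sum_sqr_le (I : finType) (A : {set I}) (d : I -> R) :
  (\sum_(h in A) d h) ^+ 2 <= #|A|%:R * \sum_(h in A) d h ^+ 2.
Proof.
rewrite expr2 mulr_suml.
under eq_bigr => h _ do rewrite mulr_sumr.
apply: le_trans (_ : \sum_(h in A) \sum_(k in A) (d h ^+ 2 / 2 + d k ^+ 2 / 2) <= _).
  apply: ler_sum => h _; apply: ler_sum => k _.
  by have := sqr_ge0 (d h - d k); generalize (d h) (d k) => x y; lra.
under eq_bigr => h _ do rewrite big_split /= sumr_const -mulr_suml.
by rewrite big_split /= sumr_const sumrMnl -mulr_suml -mulrnDl -splitr mulr_natl.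
Qed.

(* Second moment of the number of members of M through a common h; every pair counted there shares at least b elements. *)
Lemma var_lower (Hf : {set {set T}}) (b : nat) : (0 < b)%N ->
  (forall h, h \in Hf -> #|h| = b) ->
  (forall i, i \in M -> exists2 h, h \in Hf & h \subset i) ->
  mean p M ^+ 2 * (1 - p) <= 2 ^+ e * (#|Hf|%:R * p ^+ b) * var.
Proof.
move=> b0 Hb Hex; have p0' := ltW p0; have p1' := ltW p1.
have q0 : 0 <= 1 - p by rewrite subr_ge0.
pose d h : R := \sum_(i in M) (h \subset i)%:R.
have meanE : mean p M = #|M|%:R * p ^+ e.
  rewrite /mean (eq_bigr (fun=> p ^+ e)); last by move=> i /Me ->.
  by rewrite sumr_const mulr_natl.
have h1 : #|M|%:R <= \sum_(h in Hf) d h.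
  rewrite /d exchange_big /= -sum1_card natr_sum; apply: ler_sum => i /Hex[h hH hi].
  by rewrite (bigD1 h) //= hi -[leLHS]addr0 lerD ?sumr_ge0.
have h2 := sum_sqr_le Hf d.
have h3 : p ^+ (2 * e) * (1 - p) * \sum_(h in Hf) d h ^+ 2 <= 2 ^+ e * p ^+ b * var.
  rewrite varE.
  rewrite (_ : \sum_(h in Hf) d h ^+ 2 = \sum_(i in M) \sum_(j in M) (#|[set h in Hf | (h \subset i) && (h \subset j)]|)%:R); last first.
    transitivity (\sum_(h in Hf) \sum_(i in M) \sum_(j in M) ((h \subset i) && (h \subset j))%:R : R).
      apply: eq_bigr => h _; rewrite /d expr2 mulr_suml; apply: eq_bigr => i _.
      by rewrite mulr_sumr; apply: eq_bigr => j _; rewrite -natrM mulnb.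
    rewrite exchange_big /=; apply: eq_bigr => i _; rewrite exchange_big /=.
    apply: eq_bigr => j _; rewrite -natr_sum; congr (_%:R).
    by rewrite -sum1dep_card [RHS]big_mkcondr.
  rewrite !mulr_sumr; apply: ler_sum => i iM; rewrite !mulr_sumr; apply: ler_sum => j jM.
  set N := #|_|.
  have Ne : (N <= 2 ^ e)%N.
    rewrite -(Me iM) -card_powerset; apply: subset_leq_card.
    by apply/subsetP => h; rewrite !inE => /andP[_ /andP[]].
  have cUI : (#|i :|: j| + #|i :&: j| = 2 * e)%N.
    by rewrite cardsUI (Me iM) (Me jM) mul2n addnn.
  have pij : p ^+ #|i| * p ^+ #|j| = p ^+ #|i :|: j| * p ^+ #|i :&: j|.
    by rewrite -!exprD cUI (Me iM) (Me jM) mul2n addnn.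
  have term0 : 0 <= p ^+ #|i :|: j| - p ^+ #|i| * p ^+ #|j|.
    by rewrite pij subr_ge0 ler_piMr ?exprn_ge0// exprn_ile1.
  have c0 : 0 <= 2 ^+ e * p ^+ b by rewrite mulr_ge0 ?exprn_ge0.
  have [NN|[h]] := set_0Vmem [set h in Hf | (h \subset i) && (h \subset j)].
    by rewrite /N NN cards0 mulr0 mulr_ge0.
  rewrite inE => /andP[hH /andP[hi hj]].
  (* A common h makes the intersection nonempty with at least b elements: the covariance keeps the
     factor 1 - p, and p^b bounds the overlap. *)
  have bij : (b <= #|i :&: j|)%N by rewrite -(Hb h hH) subset_leq_card// subsetI hi.
  have h1' : p ^+ #|i :&: j| <= p.
    by rewrite -[leRHS]expr1 ler_wiXn2l// (leq_trans b0).
  have h2' : p ^+ #|i :&: j| <= p ^+ b by rewrite ler_wiXn2l.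
  have NR : N%:R <= 2 ^+ e :> R by rewrite -natrX ler_nat.
  rewrite pij -cUI exprD.
  have U0 : 0 <= p ^+ #|i :|: j| by rewrite exprn_ge0.
  have I0 : 0 <= p ^+ #|i :&: j| by rewrite exprn_ge0.
  have N0 : 0 <= N%:R :> R by [].
  rewrite [leRHS](_ : _ = 2 ^+ e * (p ^+ b * (p ^+ #|i :|: j| * (1 - p ^+ #|i :&: j|)))); last by ring.
  rewrite [leLHS](_ : _ = N%:R * (p ^+ #|i :&: j| * (p ^+ #|i :|: j| * (1 - p)))); last by rewrite mulrC; congr (_ * _); rewrite [RHS]mulrCA mulrA.
  rewrite ler_pM//; first by rewrite !mulr_ge0.
  by rewrite ler_pM ?mulr_ge0// ler_wpM2l// lerD2l lerN2.
have c1 : 0 <= p ^+ (2 * e) * (1 - p) by rewrite mulr_ge0 ?exprn_ge0.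
have M0 : 0 <= #|M|%:R :> R by [].
have h4 : #|M|%:R ^+ 2 <= (\sum_(h in Hf) d h) ^+ 2.
  by rewrite ler_sqr ?nnegrE// (le_trans M0).
rewrite [X in X ^+ 2 * _ <= _]meanE exprMn -exprM [(e * 2)%N]mulnC.
rewrite [leLHS](_ : _ = p ^+ (2 * e) * (1 - p) * #|M|%:R ^+ 2); last by rewrite -[LHS]mulrA mulrC.
apply: le_trans (ler_wpM2l c1 (le_trans h4 h2)) _.
have H0 : 0 <= #|Hf|%:R :> R by [].
have := ler_wpM2l H0 h3; congr (_ <= _); first by rewrite mulrCA.
by rewrite !mulrA [_ * 2 ^+ e]mulrC.
Qed.
End VarianceBound.

(** * Copies of the graph as a permutation-invariant family *)

Section Copies.
Variables (V0 : finType) (g0 : rel V0).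
Hypothesis hg0 : simple_graph V0 g0.
Variable n : nat.
Implicit Types (e : {set V0}) (k h : {set {set 'I_n}}) (f : V0 -> 'I_n).

Local Notation NI := (nonisolated V0 g0).
Local Notation GE := (gedges V0 g0).
Local Notation M := (copies V0 g0 n).

Lemma gedgeP e : reflect (exists x y, g0 x y /\ e = [set x; y]) (e \in GE).
Proof.
apply: (iffP idP) => [/imset2P[x y _]|[x [y [xy ->]]]].
  by rewrite inE => /andP[_ xy] ->; exists x, y.
by apply/imset2P; exists x y; rewrite ?inE.
Qed.

Lemma gedge_sub e : e \in GE -> e \subset NI.
Proof.
move=> /gedgeP[x [y [xy ->]]]; rewrite subUset !sub1set !inE.
apply/andP; split; apply/existsP; first by exists y.
by exists x; rewrite hg0.1.
Qed.

Lemma card_gedge e : e \in GE -> #|e| = 2.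
Proof.
move=> /gedgeP[x [y [xy ->]]]; rewrite cards2; case: eqVneq => // e0.
by move: xy; rewrite e0 hg0.2.
Qed.

Lemma copyP k : reflect
  (exists2 f, {in NI &, injective f} & k = [set f @: (e : {set V0}) | e in GE]) (k \in M).
Proof.
rewrite inE; apply: (iffP existsP) => [[f /andP[inj /eqP ->]]|[f inj ->]].
  exists f => // x y xN yN fxy; move: inj => /forall_inP/(_ x xN)/forall_inP/(_ y yN).
  by rewrite fxy eqxx /= => /eqP.
exists (finfun f); apply/andP; split.
  apply/forall_inP => x xN; apply/forall_inP => y yN; rewrite !ffunE.
  by apply/implyP => /eqP/(inj _ _ xN yN) ->.
apply/eqP; apply: eq_imset => e; apply: eq_imset => x.
by rewrite ffunE.
Qed.

Lemma inj_imset_sub (X : finType) (A : {set X}) (Y : finType) (f : X -> Y) (B C : {set X}) :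
  {in A &, injective f} -> B \subset A -> C \subset A -> f @: B = f @: C -> B = C.
Proof.
move=> inj BA CA.
have half (B' C' : {set X}) : B' \subset A -> C' \subset A -> f @: B' = f @: C' -> B' \subset C'.
  move=> BA' CA' e; apply/subsetP => x xB.
  have : f x \in f @: C' by rewrite -e imset_f.
  by move=> /imsetP[y yC fxy]; rewrite (inj x y (subsetP BA' _ xB) (subsetP CA' _ yC) fxy).
by move=> e; apply/eqP; rewrite eqEsubset (half _ _ BA CA e) (half _ _ CA BA (esym e)).
Qed.

Lemma copy_inj f : {in NI &, injective f} ->
  {in GE &, injective (fun e : {set V0} => f @: e)}.
Proof. by move=> inj e e' eE eE'; apply: (inj_imset_sub inj); exact: gedge_sub. Qed.

Lemma card_copy k : k \in M -> #|k| = nedges V0 g0.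
Proof. by move=> /copyP[f inj ->]; rewrite card_in_imset//; exact: copy_inj. Qed.

Lemma copy_Kedges k : k \in M -> k \subset Kedges n.
Proof.
move=> /copyP[f inj ->]; apply/subsetP => y /imsetP[e eE ->].
rewrite inE card_in_imset ?(card_gedge eE)//.
by move=> x x' xe xe'; apply: inj; apply: (subsetP (gedge_sub eE)).
Qed.

Lemma card_cover_copy k : k \in M -> (#|cover k| <= #|NI|)%N.
Proof.
move=> /copyP[f inj ->]; apply: leq_trans (leq_imset_card f _).
apply: subset_leq_card; apply/subsetP => x /bigcupP[y /imsetP[e eE ->]].
by apply: (subsetP (imsetS _ (gedge_sub eE))).
Qed.

Lemma act_imset f (s : {perm 'I_n}) :
  act s [set f @: (e : {set V0}) | e in GE] = [set (fun x => s (f x)) @: (e : {set V0}) | e in GE].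
Proof.
by rewrite /act -imset_comp; apply: eq_imset => e /=; rewrite -imset_comp.
Qed.

Lemma act_copy (s : {perm 'I_n}) k : k \in M -> act s k \in M.
Proof.
move=> /copyP[f inj ->]; apply/copyP; exists (fun x => s (f x)); last exact: act_imset.
by move=> x y xN yN /perm_inj; exact: inj.
Qed.

Lemma copies_transitive k k' : k \in M -> k' \in M -> exists s : {perm 'I_n}, act s k = k'.
Proof.
move=> /copyP[f inj ->] /copyP[f' inj' ->].
have [s sE] := perm_extension inj inj'; exists s; rewrite act_imset.
apply: eq_in_imset => e /gedge_sub eN; apply: eq_in_imset => x xe.
by apply: sE; exact: (subsetP eN).
Qed.

(** A vertex permutation carrying k to [Gam] carries the copies meeting k injectively to copies
    meeting [Gam]. *)
Lemma nb_Dcount k Gam : k \in M -> Gam \in M ->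
  (#|[set k' | nb M k k']| <= Dcount V0 g0 n Gam)%N.
Proof.
move=> kM GM; have [s sE] := copies_transitive kM GM.
rewrite -(card_imset _ (@act_inj _ s)); apply: subset_leq_card.
apply/subsetP => y /imsetP[k']; rewrite inE => /andP[k'M h] ->.
by rewrite inE act_copy//= -sE -actI -card_gt0 card_act card_gt0.
Qed.

Variables (R : realType) (p : R).
Hypotheses (p0 : 0 < p).

Local Notation Psi := (Psi_min R V0 g0 n p).

Lemma is_subgraph_full : GE != finset.set0 -> is_subgraph_ne V0 g0 ([set: V0], GE).
Proof.
move=> h; rewrite /is_subgraph_ne /= subxx h andbT /=.
by apply/forall_inP => e _; apply/subsetP => x _; rewrite inE.
Qed.

Lemma Psi_min_attained : GE != finset.set0 ->
  exists2 H, is_subgraph_ne V0 g0 H & Psi = n%:R ^+ #|H.1| * p ^+ #|H.2|.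
Proof.
move=> h; rewrite /Psi_min.
elim/big_ind: _ => [|x y [H1 h1 ->] [H2 h2 ->]|H hH]; last by exists H.
  by exists ([set: V0], GE); [exact: is_subgraph_full|rewrite /= cardsT].
by case: (leP (n%:R ^+ #|H1.1| * p ^+ #|H1.2|) (n%:R ^+ #|H2.1| * p ^+ #|H2.2|)) => _; [exists H1|exists H2].
Qed.

Lemma Psi_min_le H : is_subgraph_ne V0 g0 H -> Psi <= n%:R ^+ #|H.1| * p ^+ #|H.2|.
Proof. by move=> hH; rewrite /Psi_min (bigD1 H) //= ge_min lexx. Qed.

Lemma Psi_min_gt0 : GE != finset.set0 -> (0 < n)%N -> 0 < Psi.
Proof.
by move=> h n0; have [H _ ->] := Psi_min_attained h; rewrite mulr_gt0 ?exprn_gt0// ltr0n.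
Qed.

(** Pulled back along the embedding, h becomes an edge set F of the graph with as many edges and
    spanned vertices, so (cover F, F) competes in the minimum. *)
Lemma Psi_min_copy k h : k \in M -> h \subset k -> h != finset.set0 ->
  Psi <= n%:R ^+ #|cover h| * p ^+ #|h|.
Proof.
move=> /copyP[f inj ->] hk h0.
pose F := [set e in GE | f @: e \in h].
have FE : h = [set f @: (e : {set V0}) | e in F].
  apply/setP => y; apply/idP/imsetP => [yh|[e]]; last by rewrite inE => /andP[_ eh] ->.
  have /imsetP[e eE ye] := subsetP hk _ yh.
  by exists e => //; rewrite inE eE -ye.
have FG : F \subset GE by apply/subsetP => e; rewrite inE => /andP[].
have FN : cover F \subset NI.
  apply/subsetP => x /bigcupP[e eF]; apply: (subsetP (gedge_sub _)).
  exact: (subsetP FG).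
have cF : #|F| = #|h|.
  rewrite FE card_in_imset// => e e' /(subsetP FG) eE /(subsetP FG) eE'.
  exact: copy_inj.
have cS : #|cover F| = #|cover h|.
  have -> : cover h = f @: cover F.
    rewrite FE; apply/setP => y; apply/bigcupP/imsetP.
      move=> [_ /imsetP[e eF ->] /imsetP[x xe ->]]; exists x => //.
      by apply/bigcupP; exists e.
    move=> [x /bigcupP[e eF xe] ->]; exists (f @: e); last exact: imset_f.
    by apply/imsetP; exists e.
  rewrite card_in_imset// => x y xF yF.
  by apply: inj; exact: (subsetP FN).
rewrite -cF -cS; apply: (@Psi_min_le (cover F, F)).
rewrite /is_subgraph_ne /= FG /=; apply/andP; split.
  by apply/forall_inP => e eF; apply/subsetP => x xe; apply/bigcupP; exists e.
by rewrite -card_gt0 cF card_gt0.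
Qed.

(** The family is the set of images of F under all maps from S, injective or not, which gives the
    count n^|S| at once. A filter on cardinality discards images that lose edges, and restrictions
    of embeddings pass it. *)
Lemma sub_copies_family (H : {set V0} * {set {set V0}}) : is_subgraph_ne V0 g0 H ->
  exists Hf : {set {set {set 'I_n}}}, [/\ (#|Hf| <= n ^ #|H.1|)%N,
    forall h, h \in Hf -> #|h| = #|H.2| &
    forall k, k \in M -> exists2 h, h \in Hf & h \subset k].
Proof.
case: H => S F /and3P[/= FG /forall_inP FS F0].
pose r (u : {ffun {x | x \in S} -> 'I_n}) : {set {set 'I_n}} :=
  [set [set u x | x in [set x : {x | x \in S} | val x \in (e : {set V0})]] | e in F].
pose Hf := [set h in r @: [set: {ffun {x | x \in S} -> 'I_n}] | #|h| == #|F|].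
exists Hf; split.
- apply: leq_trans (_ : #|r @: [set: {ffun {x | x \in S} -> 'I_n}]| <= _)%N.
    by apply: subset_leq_card; apply/subsetP => h; rewrite inE => /andP[].
  apply: leq_trans (leq_imset_card _ _) _.
  by rewrite cardsT card_ffun card_ord card_sig leq_eqVlt; apply/orP; left; apply/eqP; congr (_ ^ _)%N; apply: eq_card.
- by move=> h; rewrite inE => /andP[_ /eqP].
move=> k /copyP[f inj ->].
pose u : {ffun {x | x \in S} -> 'I_n} := [ffun x => f (val x)].
have ru : r u = [set f @: (e : {set V0}) | e in F].
  apply: eq_in_imset => e eF; apply/setP => y; apply/imsetP/imsetP.
    by move=> [x]; rewrite inE => xe ->; exists (val x); rewrite ?ffunE.
  move=> [x xe ->]; have xS := subsetP (FS _ eF) _ xe.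
  by exists (Sub x xS); rewrite ?inE ?ffunE SubK.
exists (r u); last by rewrite ru; exact: imsetS.
rewrite inE imset_f ?inE//= ru card_in_imset// => e e' eF eF'.
by apply: copy_inj => //; exact: (subsetP FG).
Qed.

End Copies.

(** * Transfer to G(n,p) *)

Section GnpLink.
Variables (R : realType) (V0 : finType) (g0 : rel V0) (n : nat) (p : R).
Implicit Types (om : {set {set 'I_n}}).
Local Notation M := (copies V0 g0 n).

Lemma gnp_prob_bern om : om \subset Kedges n -> gnp_prob R n p om = bern_w p (Kedges n) om.
Proof. by move=> h; rewrite /gnp_prob h /bern_w cardsDS. Qed.

Lemma gnp_E_bE (F : {set {set 'I_n}} -> R) : gnp_E R n p F = bE p (Kedges n) F.
Proof.
rewrite /gnp_E /bE [RHS]big_mkcond; apply: eq_bigr => om _.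
by case: ifP => h; [rewrite gnp_prob_bern|rewrite /gnp_prob h mul0r].
Qed.

Lemma gnp_P_bE (A : {set {set 'I_n}} -> bool) :
  gnp_P R n p A = bE p (Kedges n) (fun om => (A om)%:R).
Proof.
rewrite -gnp_E_bE /gnp_P /gnp_E big_mkcond; apply: eq_bigr => om _.
by case: (A om); rewrite ?mulr1 ?mulr0.
Qed.

Lemma Ncopies_cnt om : Ncopies R V0 g0 n om = cnt R M om.
Proof.
rewrite /Ncopies /cnt -sum1dep_card natr_sum big_mkcondr; apply: eq_bigr => i _.
by rewrite /ind; case: ifP.
Qed.

Hypothesis hg0 : simple_graph V0 g0.

Lemma meanN_mean : meanN R V0 g0 n p = mean p M.
Proof.
rewrite /meanN gnp_E_bE (eq_bE _ (fun om _ => Ncopies_cnt om)) bE_cnt//.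
exact: copy_Kedges.
Qed.

Lemma varN_var : varN R V0 g0 n p = bE p (Kedges n) (fun om => (cnt R M om - mean p M) ^+ 2).
Proof.
by rewrite /varN gnp_E_bE; apply: eq_bE => om _; rewrite Ncopies_cnt meanN_mean.
Qed.

Lemma Wstd_cstd om : Wstd R V0 g0 n p om = cstd p M (sigmaN R V0 g0 n p) om.
Proof. by rewrite /Wstd /cstd Ncopies_cnt meanN_mean. Qed.

Hypotheses (p0 : 0 < p) (p1 : p < 1) (hedge : gedges V0 g0 != finset.set0).

(** [var_lower] is applied to the images of a subgraph attaining Psi_min, for which |Hf| p^b <=
    Psi_min. *)
Lemma varN_lower : mean p M ^+ 2 * (1 - p) <=
  2 ^+ nedges V0 g0 * Psi_min R V0 g0 n p * varN R V0 g0 n p.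
Proof.
have [H hH PsiE] := Psi_min_attained n p hedge.
have [Hf [cHf Hfb Hfex]] := sub_copies_family hg0 n hH.
have b0 : (0 < #|H.2|)%N by rewrite card_gt0; case/and3P: hH.
apply: le_trans (var_lower p0 p1 (@copy_Kedges _ _ hg0 n) (@card_copy _ _ hg0 n) b0 Hfb Hfex) _.
rewrite varN_var ler_wpM2r//.
  by apply: bE_ge0 => // om _; rewrite sqr_ge0.
rewrite ler_wpM2l ?exprn_ge0// PsiE ler_wpM2r ?exprn_ge0 ?(ltW p0)//.
by rewrite -natrX ler_nat.
Qed.
End GnpLink.

(** * Constants *)

Section Numerics.
Variable R : realType.

(* The term in b^3 is absorbed into those in b^2 and b^4 by AM-GM. *)
Lemma smQ_split (q l X L4 L5 A b Y : R) :
  0 <= q <= 1 -> 0 <= l -> 0 <= X -> 0 <= L4 <= L5 -> 0 <= A -> 0 <= b ->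
  8 * A * X * b ^+ 2 + 2 * q * l * A * X * L4 * b ^+ 3
    + l ^+ 2 * (A ^+ 2 * Y * b ^+ 2 + 4 * q * A * X * L4 * L5 * b ^+ 4)
  <= b ^+ 2 * (12 * (A * X) + l ^+ 2 * (A ^+ 2 * Y)
       + 17 / 4 * l ^+ 2 * (A * X * (L4 * L5)) * b ^+ 2).
Proof.
move=> /andP[q0 q1] l0 X0 /andP[L40 L45] A0 b0.
pose c := A * X * b ^+ 2.
have c0 : 0 <= c by rewrite /c !mulr_ge0 ?exprn_ge0.
pose y := l * L4 * b.
have y0 : 0 <= y by rewrite /y !mulr_ge0.
have h1 : 2 * q * y <= 4 + y ^+ 2 / 4.
  have h : 2 * q * y <= 2 * y by rewrite -mulrA ler_wpM2l// ler_piMl.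
  by have := sqr_ge0 (y - 4); move: h; lra.
have h2 : y ^+ 2 <= l ^+ 2 * (L4 * L5) * b ^+ 2.
  rewrite /y !exprMn ler_wpM2r ?exprn_ge0// ler_wpM2l ?exprn_ge0//.
  by rewrite expr2 ler_wpM2l.
have L5' : 0 <= L5 by exact: le_trans L45.
have z0 : 0 <= l ^+ 2 * (L4 * L5) * b ^+ 2 by rewrite !mulr_ge0 ?exprn_ge0.
have h3 : 4 * q * (l ^+ 2 * (L4 * L5) * b ^+ 2) <= 4 * (l ^+ 2 * (L4 * L5) * b ^+ 2).
  by rewrite -mulrA ler_wpM2l// ler_piMl.
set z := l ^+ 2 * (L4 * L5) * b ^+ 2 in h2 h3 z0.
rewrite [leLHS](_ : _ = c * (8 + 2 * q * y + 4 * q * z) + l ^+ 2 * (A ^+ 2 * Y) * b ^+ 2); last first.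
  by rewrite /c /y /z; ring.
rewrite [leRHS](_ : _ = c * (12 + 17 / 4 * z) + l ^+ 2 * (A ^+ 2 * Y) * b ^+ 2); last first.
  by rewrite /c /z; ring.
rewrite lerD2r ler_wpM2l//; move: h1 h2 h3; generalize (y ^+ 2) (2 * q * y) (4 * q * z).
by move=> *; lra.
Qed.

Lemma pow_mono (x y : R) (k : nat) : 0 <= x -> x <= y -> x ^+ k <= y ^+ k.
Proof. by move=> x0 xy; rewrite lerXn2r ?nnegrE// (le_trans x0). Qed.

(** In the application G = 2^e, P = 2^v', f = v'!, F = v!, eps = e and b2 = 2^e / (q Psi_min), where
    v' counts the nonisolated vertices and v all of them. *)
Variables (G P f F eps b2 : R).
Hypotheses (G1 : 0 <= G) (P1 : 0 <= P) (f1 : 0 <= f) (F1 : 1 <= F) (fF : f <= F) (e1 : 0 <= eps).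
Hypotheses (PG : P <= G ^+ 2) (Pf : P <= 2 * f) (eF : eps <= F) (e2F : eps ^+ 2 <= 2 * F).
Hypotheses (b20 : 0 <= b2) (b2s : 2048 * (G ^+ 14 * F ^+ 5 * eps ^+ 2) * b2 <= 1).
Local Notation K0 := (G ^+ 14 * F ^+ 5 * eps ^+ 2).

Let F0 : 0 <= F. Proof. exact: le_trans fF. Qed.

Lemma term_linked : (8 / 7) ^+ 3 * (eps ^+ 4 * G ^+ 4 * f ^+ 3 * P ^+ 5) <= 3 / 2 * K0.
Proof.
have h : eps ^+ 4 * G ^+ 4 * f ^+ 3 * P ^+ 5 <= K0.
  rewrite [leLHS](_ : _ = (eps ^+ 2 * G ^+ 4) * (eps ^+ 2 * (f ^+ 3 * P ^+ 5))); last by ring.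
  rewrite [leRHS](_ : _ = (eps ^+ 2 * G ^+ 4) * (F ^+ 2 * (F ^+ 3 * (G ^+ 2) ^+ 5))); last by ring.
  rewrite ler_wpM2l ?mulr_ge0 ?exprn_ge0// ler_pM ?mulr_ge0 ?exprn_ge0 ?pow_mono//.
  by rewrite ler_pM ?exprn_ge0 ?pow_mono.
have K00 : 0 <= K0 by rewrite !mulr_ge0 ?exprn_ge0.
move: h K00; generalize (eps ^+ 4 * G ^+ 4 * f ^+ 3 * P ^+ 5) K0 => x y *; lra.
Qed.

Lemma term_degdeg : (8 / 7) ^+ 4 * (eps ^+ 4 * G ^+ 6 * f ^+ 4 * P ^+ 4) <= 7 / 2 * K0.
Proof.
have h : eps ^+ 4 * G ^+ 6 * f ^+ 4 * P ^+ 4 <= 2 * K0.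
  rewrite [leLHS](_ : _ = (eps ^+ 2 * G ^+ 6) * (eps ^+ 2 * (f ^+ 4 * P ^+ 4))); last by ring.
  rewrite [leRHS](_ : _ = (eps ^+ 2 * G ^+ 6) * ((2 * F) * (F ^+ 4 * (G ^+ 2) ^+ 4))); last by ring.
  rewrite ler_wpM2l ?mulr_ge0 ?exprn_ge0// ler_pM ?mulr_ge0 ?exprn_ge0//.
  by rewrite ler_pM ?exprn_ge0 ?pow_mono.
have K00 : 0 <= K0 by rewrite !mulr_ge0 ?exprn_ge0.
move: h K00; generalize (eps ^+ 4 * G ^+ 6 * f ^+ 4 * P ^+ 4) K0 => x y *; lra.
Qed.

(** The left side is of order K0^2 b2. The smallness hypothesis 2048 K0 b2 <= 1 removes one K0. *)
Lemma term_five : (8 / 7) ^+ 5 * (eps ^+ 4 * G ^+ 6 * f ^+ 5 * P ^+ 14) * b2 <= K0 / 17.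
Proof.
have h : eps ^+ 4 * G ^+ 6 * f ^+ 5 * P ^+ 14 <= 8 * K0 * K0.
  rewrite [leLHS](_ : _ = (eps ^+ 4 * G ^+ 6) * (f ^+ 5 * (P ^+ 11 * P ^+ 3))); last by ring.
  apply: le_trans (_ : (eps ^+ 4 * G ^+ 6) * (F ^+ 5 * ((G ^+ 2) ^+ 11 * (2 * f) ^+ 3)) <= _).
    rewrite ler_wpM2l ?mulr_ge0 ?exprn_ge0// ler_pM ?mulr_ge0 ?exprn_ge0 ?pow_mono//.
    by rewrite ler_pM ?exprn_ge0 ?pow_mono.
  rewrite [leLHS](_ : _ = (8 * eps ^+ 4 * G ^+ 28 * F ^+ 5) * f ^+ 3); last by ring.
  rewrite [leRHS](_ : _ = (8 * eps ^+ 4 * G ^+ 28 * F ^+ 5) * F ^+ 5); last by ring.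
  rewrite ler_wpM2l ?mulr_ge0 ?exprn_ge0//.
  apply: le_trans (pow_mono 3 f1 fF) _.
  by rewrite (_ : F ^+ 5 = F ^+ 3 * F ^+ 2); [rewrite ler_peMr ?exprn_ge0 ?exprn_ege1|ring].
have K00 : 0 <= K0 by rewrite !mulr_ge0 ?exprn_ge0.
have h2 := ler_wpM2r b20 h; have h3 := ler_wpM2l K00 b2s.
have h4 : 2048 * (K0 * (K0 * b2)) <= K0 
  by rewrite (_ : 2048 * _ = K0 * (2048 * K0 * b2)); [move: h3; rewrite mulr1|ring].
have h5 : (eps ^+ 4 * G ^+ 6 * f ^+ 5 * P ^+ 14) * b2 <= 8 * (K0 * (K0 * b2)).
  by rewrite (_ : 8 * (_ * _) = 8 * K0 * K0 * b2); [exact: h2|ring].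
apply: le_trans (_ : (8 / 7) ^+ 5 * (8 * (K0 * (K0 * b2))) <= _).
  by rewrite -mulrA ler_wpM2l ?exprn_ge0.
move: h4 K00; generalize (K0 * (K0 * b2)) => u; generalize K0 => k *; lra.
Qed.

Lemma numeric_main (l A X Y Z bb : R) : 0 <= l -> 0 <= A <= G ->
  0 <= X <= (8 / 7) ^+ 3 * (G ^+ 3 * f ^+ 3 * P ^+ 5) ->
  0 <= Y <= (8 / 7) ^+ 4 * (G ^+ 4 * f ^+ 4 * P ^+ 4) ->
  0 <= Z <= (8 / 7) ^+ 2 * (G ^+ 2 * f ^+ 2 * P ^+ 9) ->
  0 <= bb <= b2 ->
  (2 * eps ^+ 2) ^+ 2 * (bb * (12 * (A * X) + l ^+ 2 * (A ^+ 2 * Y)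
       + 17 / 4 * l ^+ 2 * (A * X * Z) * bb)) <= 128 * K0 * b2 * (1 + l) ^+ 2.
Proof.
move=> l0 /andP[A0 AG] /andP[X0 hX] /andP[Y0 hY] /andP[Z0 hZ] /andP[bb0 hb].
have c0 : 0 <= (2 * eps ^+ 2) ^+ 2 by rewrite exprn_ge0 ?mulr_ge0 ?exprn_ge0.
have l2 : 0 <= l ^+ 2 by rewrite exprn_ge0.
set X' := _ ^+ 3 * _ in hX; set Y' := _ ^+ 4 * _ in hY; set Z' := _ ^+ 2 * _ in hZ.
have AX : A * X <= G * X' by rewrite ler_pM.
have AX0 : 0 <= A * X by rewrite mulr_ge0.
apply: le_trans (_ : (2 * eps ^+ 2) ^+ 2 * (b2 * (12 * (G * X') + l ^+ 2 * (G ^+ 2 * Y')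
       + 17 / 4 * l ^+ 2 * (G * X' * Z') * b2)) <= _).
  rewrite ler_wpM2l// ler_pM ?addr_ge0 ?mulr_ge0 ?exprn_ge0//.
  apply: lerD; [apply: lerD|].
  - by rewrite ler_wpM2l.
  - by rewrite ler_wpM2l// ler_pM ?exprn_ge0 ?pow_mono.
  - apply: ler_pM; rewrite ?mulr_ge0//.
    by rewrite ler_wpM2l ?mulr_ge0// ler_pM.
have h1 := term_linked; have h2 := term_degdeg; have h3 := term_five.
rewrite [leLHS](_ : _ = b2 * (48 * ((8 / 7) ^+ 3 * (eps ^+ 4 * G ^+ 4 * f ^+ 3 * P ^+ 5))
  + l ^+ 2 * (4 * ((8 / 7) ^+ 4 * (eps ^+ 4 * G ^+ 6 * f ^+ 4 * P ^+ 4)))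
  + l ^+ 2 * (17 * ((8 / 7) ^+ 5 * (eps ^+ 4 * G ^+ 6 * f ^+ 5 * P ^+ 14) * b2)))); last first.
  by rewrite /X' /Y' /Z'; field.
rewrite [leRHS](_ : _ = b2 * (128 * K0 * (1 + l) ^+ 2)); last by ring.
rewrite ler_wpM2l//.
have K00 : 0 <= K0 by rewrite !mulr_ge0 ?exprn_ge0.
(* 72 = 48 * 3/2, 14 = 4 * 7/2 and 1 = 17/17 by the three term lemmas. *)
apply: le_trans (_ : 72 * K0 + l ^+ 2 * (14 * K0) + l ^+ 2 * K0 <= _).
  apply: lerD; [apply: lerD|].
  - by move: h1; generalize ((8 / 7) ^+ 3 * (eps ^+ 4 * G ^+ 4 * f ^+ 3 * P ^+ 5)) K0 => x y *; lra.
  - rewrite ler_wpM2l//.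
    by move: h2; generalize ((8 / 7) ^+ 4 * (eps ^+ 4 * G ^+ 6 * f ^+ 4 * P ^+ 4)) K0 => x y *; lra.
  - rewrite ler_wpM2l//; move: h3.
    by generalize ((8 / 7) ^+ 5 * (eps ^+ 4 * G ^+ 6 * f ^+ 5 * P ^+ 14) * b2) K0 => x y *; lra.
have lK : 0 <= l * K0 by rewrite mulr_ge0.
have l2K : 0 <= l ^+ 2 * K0 by rewrite mulr_ge0.
rewrite [leRHS](_ : _ = 128 * K0 + 256 * (l * K0) + 128 * (l ^+ 2 * K0)); last by ring.
rewrite [leLHS](_ : _ = 72 * K0 + 15 * (l ^+ 2 * K0)); last by ring.
move: lK l2K K00; generalize (l * K0) (l ^+ 2 * K0) K0 => x y z *; lra.
Qed.
End Numerics.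

(** * Factorial inequalities *)

Section Counting.
Local Open Scope nat_scope.

Lemma expn2_le_fact (v : nat) : 2 ^ v <= 2 * v`!.
Proof.
elim: v => [//|[//|v] IH]; rewrite expnS factS mulnCA leq_mul//.
Qed.

Lemma mul_pred_le_fact (v : nat) : v * v.-1 <= 2 * v`!.
Proof.
case: v => [//|[//|v]]; rewrite !factS.
apply: leq_trans (leq_pmull _ (isT : 0 < 2)).
by rewrite mulnA leq_pmulr ?fact_gt0.
Qed.

Lemma mul_pred_sqr_le_fact (v : nat) : (v * v.-1) ^ 2 <= 8 * v`!.
Proof.
have H w : w.+2 * w.+1 <= 8 * w`!.
  elim: w => [//|[//|[//|w]] IH].
  rewrite factS mulnCA; apply: leq_trans (leq_mul (leqnn _) IH).
  rewrite mulnCA [leqLHS]mulnC leq_mul2l /=.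
  apply: leq_trans (_ : 2 * w.+3 <= _); last by rewrite leq_mul.
  by rewrite mul2n -addnn -[leqLHS]/(2 + w.+3) leq_add2r.
case: v => [//|[//|v]]; rewrite !factS /= expnS expn1.
apply: leq_trans (leq_mul (leqnn (v.+2 * v.+1)) (H v)) _.
by rewrite [leqLHS]mulnCA -mulnA.
Qed.
End Counting.

(** * Size of the graph constant *)

Section GraphConstants.
Variables (R : realType) (V0 : finType) (g0 : rel V0).
Hypothesis hg0 : simple_graph V0 g0.
Hypothesis hedge : gedges V0 g0 != finset.set0.
Local Notation e := (nedges V0 g0).
Local Notation v' := #|nonisolated V0 g0|.

Lemma nedges_gt0 : (0 < e)%N. Proof. by rewrite card_gt0. Qed.

Lemma double_nedges : (2 * e <= #|V0| * #|V0|.-1)%N.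
Proof.
have h : (e <= 'C(#|V0|, 2))%N.
  rewrite -card_draws; apply: subset_leq_card; apply/subsetP => x xE.
  by rewrite inE (card_gedge hg0 xE).
apply: leq_trans (leq_mul (leqnn 2) h) _; rewrite bin2 mul2n.
by rewrite -[leqRHS]odd_double_half leq_addl.
Qed.

Lemma nedges_le_fact : (e <= (#|V0|)`!)%N.
Proof. by have := leq_trans double_nedges (mul_pred_le_fact _); rewrite leq_mul2l. Qed.

Lemma nedges_sqr_le_fact : (e ^ 2 <= 2 * (#|V0|)`!)%N.
Proof.
have := leq_trans (_ : (2 * e) ^ 2 <= _)%N (mul_pred_sqr_le_fact #|V0|).
by rewrite leq_exp2r// => /(_ double_nedges); rewrite expnMn (_ : 8 = 4 * 2)%N// -mulnA leq_mul2l.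
Qed.

Lemma card_nonisolated : (v' <= 2 * e)%N.
Proof.
apply: leq_trans (_ : #|cover (gedges V0 g0)| <= _)%N.
  apply: subset_leq_card; apply/subsetP => x; rewrite inE => /existsP[y xy].
  apply/bigcupP; exists [set x; y]; last by rewrite !inE eqxx.
  by apply/gedgeP; exists x, y.
apply: leq_trans (leq_card_cover _).1 _.
rewrite (eq_bigr (fun=> 2%N)); last by move=> y; exact: card_gedge.
by rewrite sum_nat_const mulnC.
Qed.

Lemma aut_gt0 : (0 < Defs.aut V0 g0)%N.
Proof.
rewrite card_gt0; apply/set0Pn; exists 1%g; rewrite inE.
by apply/forallP => x; apply/forallP => y; rewrite !perm1.
Qed.

Lemma aut_le_fact : (Defs.aut V0 g0 <= (#|V0|)`!)%N.
Proof.
have <- : #|[set: {perm V0}]| = (#|V0|)`!.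
  rewrite -(cardsT V0) -card_perm; apply: eq_card => s.
  by rewrite in_setT; apply/esym/subsetP => x _; exact: in_setT.
exact: subset_leq_card (subsetT _).
Qed.

(** Squaring clears the half-integer exponents; the constant meets the moment bounds only through
    its square. *)
Lemma cG0_sqr : cG0 R V0 g0 ^+ 2 =
  512 * 2 ^+ (15 * e) * ((#|V0|)`!)%:R ^+ 8 * e%:R ^+ 2 / (Defs.aut V0 g0)%:R ^+ 3.
Proof.
have two : powR 2 (9 / 2 + 15 / 2 * e%:R) ^+ 2 = 512 * 2 ^+ (15 * e) :> R.
  rewrite expr2 -powRD; last by apply/implyP.
  rewrite (_ : 9 / 2 + 15 / 2 * e%:R + (9 / 2 + 15 / 2 * e%:R) = (9 + 15 * e)%:R :> R); last first.
    by rewrite natrD natrM; field.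
  by rewrite powR_mulrn// exprD; congr (_ * _); ring.
have au : powR (Defs.aut V0 g0)%:R (3 / 2) ^+ 2 = (Defs.aut V0 g0)%:R ^+ 3 :> R.
  rewrite expr2 -powRD; last by apply/implyP => _; rewrite pnatr_eq0 -lt0n aut_gt0.
  rewrite (_ : 3 / 2 + 3 / 2 = 3%:R :> R); last by field.
  by rewrite powR_mulrn.
have core (x F w y : R) : (x * F ^+ 4 * w / y) ^+ 2 = x ^+ 2 * F ^+ 8 * w ^+ 2 / y ^+ 2.
  by rewrite exprMn exprVn; congr (_ / _); ring.
by rewrite /cG0 core two au.
Qed.

Lemma cG0_gt0 : 0 < cG0 R V0 g0.
Proof.
rewrite /cG0 divr_gt0 ?powR_gt0 ?ltr0n ?aut_gt0// !mulr_gt0 ?powR_gt0 ?exprn_gt0//.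
all: by rewrite ltr0n ?fact_gt0 ?nedges_gt0.
Qed.

(** As aut <= v!, the cube of aut cancels three of the eight powers of v!. Of the 15 powers of 2^e,
    14 pay for chains and counting, and one for the variance bound. *)
Lemma cG0_sqr_ge : 512 * 2 ^+ (15 * e) * ((#|V0|)`!)%:R ^+ 5 * e%:R ^+ 2 <= cG0 R V0 g0 ^+ 2.
Proof.
rewrite cG0_sqr ler_pdivlMr ?exprn_gt0 ?ltr0n ?aut_gt0//.
have h : (Defs.aut V0 g0)%:R ^+ 3 <= ((#|V0|)`!)%:R ^+ 3 :> R.
  by rewrite pow_mono// ler_nat aut_le_fact.
have core (a F b w : R) : 0 <= a -> 0 <= F -> 0 <= b -> w <= F ^+ 3 ->
    a * F ^+ 5 * b * w <= a * F ^+ 8 * b.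
  move=> a0 F0 b0 wF; rewrite [leRHS](_ : _ = a * F ^+ 5 * b * F ^+ 3); last by ring.
  by rewrite ler_wpM2l ?mulr_ge0 ?exprn_ge0.
apply: (core (512 * 2 ^+ (15 * e)) ((#|V0|)`!)%:R (e%:R ^+ 2)) h.
- by apply: mulr_ge0; [exact: ler0n|apply: exprn_ge0; exact: ler0n].
- exact: ler0n.
- by apply: exprn_ge0; exact: ler0n.
Qed.

Lemma cG0_ge1 : 1 <= cG0 R V0 g0.
Proof.
have core (a b c : R) : 1 <= a * (b * c) -> 1 < 512 * a * b * c.
  rewrite (_ : 512 * a * b * c = 512 * (a * (b * c))); last by ring.
  by generalize (a * (b * c)) => w; lra.
rewrite leNgt; apply/negP => c1; have := cG0_sqr_ge.
have c2 : cG0 R V0 g0 ^+ 2 <= 1 by rewrite exprn_ile1 ?(ltW c1)// ltW ?cG0_gt0.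
move=> /le_trans/(_ c2); apply/negP; rewrite -ltNge.
have F1 : 1 <= ((#|V0|)`!)%:R :> R by rewrite ler1n fact_gt0.
have E1 : 1 <= e%:R :> R by rewrite ler1n nedges_gt0.
have G1 : 1 <= 2 ^+ (15 * e) :> R by rewrite exprn_ege1// ler1n.
have F5 : 1 <= ((#|V0|)`!)%:R ^+ 5 :> R by rewrite exprn_ege1.
have E2 : 1 <= e%:R ^+ 2 :> R by rewrite exprn_ege1.
have : 1 <= 2 ^+ (15 * e) * (((#|V0|)`!)%:R ^+ 5 * e%:R ^+ 2) :> R.
  by apply: mulr_ege1 => //; exact: mulr_ege1.
exact: core.
Qed.

Lemma bin_le_expn2 (N k : nat) : ('C(N, k) <= 2 ^ N)%N.
Proof.
have -> : (2 ^ N)%N = #|powerset [set: 'I_N]| by rewrite card_powerset cardsT card_ord.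
have -> : 'C(N, k) = #|[set A : {set 'I_N} | #|A| == k]| by rewrite card_draws card_ord.
by apply: subset_leq_card; apply/subsetP => A _; rewrite inE subsetT.
Qed.

Lemma ffact_le (N k : nat) : (N ^_ k <= 2 ^ N * k`!)%N.
Proof. by rewrite -bin_ffact leq_mul2r bin_le_expn2 orbT. Qed.

Lemma chainL_le (m : nat) :
  chainL R e v' m <= 8 / 7 * 2 ^+ e * ((2 ^ v')%:R ^+ m * (v'`!)%:R).
Proof.
rewrite /chainL ler_wpM2l ?mulr_ge0 ?exprn_ge0// -natrX -natrM ler_nat.
by rewrite -expnM [(v' * m)%N]mulnC ffact_le.
Qed.

Lemma chainL1 : chainL R e v' 1 = 8 / 7 * 2 ^+ e * (v'`!)%:R.
Proof. by rewrite /chainL mul1n ffactnn. Qed.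

Lemma chainL_ge0 m : 0 <= chainL R e v' m.
Proof. by rewrite /chainL !mulr_ge0 ?exprn_ge0. Qed.

Lemma chainL45 : chainL R e v' 4 <= chainL R e v' 5.
Proof.
by rewrite /chainL ler_wpM2l ?mulr_ge0 ?exprn_ge0// ler_nat ffact_homol// leq_mul2r orbT.
Qed.
End GraphConstants.

(** * From second moments to first absolute moments *)

Section MomentConstant.
Variable R : realType.

(** Cauchy-Schwarz in the form |Y| <= Y^2 / (2 k) + k / 2, with k the target constant. *)
Lemma bE_abs_le (T : finType) (p : R) (V : {set T}) (Y Z : {set T} -> R) (k m : R) :
  0 < p -> p < 1 -> 0 < k -> (forall om, 0 <= Z om) -> bE p V Z <= m ->
  bE p V (fun om => Y om ^+ 2 * Z om) <= k ^+ 2 * m ->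
  bE p V (fun om => `|Y om| * Z om) <= k * m.
Proof.
move=> p0 p1 k0 Z0 hZ hY.
apply: le_trans (_ : bE p V (fun om => (2 * k)^-1 * (Y om ^+ 2 * Z om) + k / 2 * Z om) <= _).
  apply: ler_bE => // om _.
  rewrite mulrA -mulrDl ler_wpM2r//.
  have h : `|Y om| * (2 * k) <= Y om ^+ 2 + k ^+ 2.
    by have := sqr_ge0 (`|Y om| - k); rewrite -(real_normK (num_real (Y om))); lra.
  rewrite (_ : _ + _ = (Y om ^+ 2 + k ^+ 2) / (2 * k)); last by field; rewrite lt0r_neq0.
  by rewrite ler_pdivlMr ?mulr_gt0.
rewrite bED !bEZ.
have c1 : 0 <= (2 * k)^-1 by rewrite invr_ge0 mulr_ge0// ltW.
have c2 : 0 <= k / 2 by rewrite divr_ge0// ltW.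
apply: le_trans (lerD (ler_wpM2l c1 hY) (ler_wpM2l c2 hZ)) _.
by rewrite le_eqVlt; apply/orP; left; apply/eqP; field; rewrite lt0r_neq0.
Qed.

(** For copies the variance bound gives A <= 2^e and b^2 <= 2^e / (q Psi_min). Each term contains at
    least b^2, so its square root has order 1 / sqrt (q Psi_min). *)
Lemma smQE (T : finType) (p : R) (M : {set {set T}}) (sg : R) (L : nat -> R) (rho l : R) :
  0 < sg ->
  let A := (1 - p) * mean p M * rho / sg ^+ 2 in let b := rho / sg in
  smQ p M sg L rho l = 8 * A * (L 1%N * L 2%N * L 3%N) * b ^+ 2
    + 2 * (1 - p) * l * A * (L 1%N * L 2%N * L 3%N) * L 4%N * b ^+ 3
    + l ^+ 2 * (A ^+ 2 * (L 1%N * L 2%N) ^+ 2 * b ^+ 2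
        + 4 * (1 - p) * A * (L 1%N * L 2%N * L 3%N) * L 4%N * L 5%N * b ^+ 4).
Proof.
move=> sg0 A b; rewrite /smQ /A /b.
generalize (L 1%N) (L 2%N) (L 3%N) (L 4%N) (L 5%N) (mean p M) => l1 l2 l3 l4 l5 mu.
by field; rewrite lt0r_neq0.
Qed.

Lemma chain_products (a G P f L1 L2 L3 L4 L5 : R) :
  0 <= a -> 0 <= G -> 0 <= P -> 0 <= f ->
  0 <= L1 <= a * G * f -> 0 <= L2 <= a * G * (P ^+ 2 * f) -> 0 <= L3 <= a * G * (P ^+ 3 * f) ->
  0 <= L4 <= a * G * (P ^+ 4 * f) -> 0 <= L5 <= a * G * (P ^+ 5 * f) ->
  [/\ 0 <= L1 * L2 * L3 <= a ^+ 3 * (G ^+ 3 * f ^+ 3 * P ^+ 5),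
      0 <= (L1 * L2) ^+ 2 <= a ^+ 4 * (G ^+ 4 * f ^+ 4 * P ^+ 4) &
      0 <= L4 * L5 <= a ^+ 2 * (G ^+ 2 * f ^+ 2 * P ^+ 9)].
Proof.
move=> a0 G0 P0 f0 /andP[p1 h1] /andP[p2 h2] /andP[p3 h3] /andP[p4 h4] /andP[p5 h5].
have h12 : L1 * L2 <= (a * G * f) * (a * G * (P ^+ 2 * f)) by rewrite ler_pM.
split; apply/andP; split; rewrite ?mulr_ge0 ?exprn_ge0 ?mulr_ge0//.
- rewrite [leRHS](_ : _ = (a * G * f) * (a * G * (P ^+ 2 * f)) * (a * G * (P ^+ 3 * f))); last by ring.
  by rewrite ler_pM ?mulr_ge0.
- rewrite [leRHS](_ : _ = ((a * G * f) * (a * G * (P ^+ 2 * f))) ^+ 2); last by ring.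
  by rewrite pow_mono ?mulr_ge0.
- rewrite [leRHS](_ : _ = (a * G * (P ^+ 4 * f)) * (a * G * (P ^+ 5 * f))); last by ring.
  by rewrite ler_pM.
Qed.

Lemma variance_consequences (q mu Psi G sg gam2 : R) :
  0 < q -> 0 < Psi -> 0 < sg -> 0 <= G -> gam2 * (q * Psi) = 1 ->
  mu ^+ 2 * q <= G * Psi * sg ^+ 2 ->
  q * mu * (mu / Psi) / sg ^+ 2 <= G /\ (mu / Psi / sg) ^+ 2 <= G * gam2.
Proof.
move=> q0 P0 s0 G0 ge h; split.
  rewrite (_ : _ / _ = mu ^+ 2 * q / (Psi * sg ^+ 2)); last by field; rewrite !lt0r_neq0.
  by rewrite ler_pdivrMr ?mulr_gt0 ?exprn_gt0// mulrA.
have n0 : q * Psi != 0 by rewrite mulf_neq0 ?lt0r_neq0.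
have g0 : gam2 = (q * Psi)^-1 by apply: (mulIf n0); rewrite ge mulVf.
rewrite g0 ler_pdivlMr ?mulr_gt0//.
rewrite (_ : _ * (q * Psi) = mu ^+ 2 * q / (Psi * sg ^+ 2)); last by field; rewrite !lt0r_neq0.
by rewrite ler_pdivrMr ?mulr_gt0 ?exprn_gt0// mulrA.
Qed.

Lemma small_constant (G F eps c gam2 : R) :
  0 <= G -> 0 <= F -> 0 <= eps -> 0 <= gam2 ->
  512 * G ^+ 15 * F ^+ 5 * eps ^+ 2 <= c ^+ 2 -> 4 * c ^+ 2 * gam2 <= 1 ->
  2048 * (G ^+ 14 * F ^+ 5 * eps ^+ 2) * (G * gam2) <= 1 /\
  128 * (G ^+ 14 * F ^+ 5 * eps ^+ 2) * (G * gam2) <= c ^+ 2 * gam2 / 4.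
Proof.
move=> G0 F0 e0 g0 h1 h2.
have h3 := ler_wpM2r g0 h1.
have E : 512 * G ^+ 15 * F ^+ 5 * eps ^+ 2 * gam2 = 512 * ((G ^+ 14 * F ^+ 5 * eps ^+ 2) * (G * gam2)) by ring.
have {E}h4 : 512 * ((G ^+ 14 * F ^+ 5 * eps ^+ 2) * (G * gam2)) <= c ^+ 2 * gam2.
  by rewrite -E; exact: h3.
have {h2}h5 : 4 * (c ^+ 2 * gam2) <= 1 by rewrite mulrA.
rewrite -!(mulrA _ (_ * _ * _) (_ * _)); move: h4 h5.
generalize ((G ^+ 14 * F ^+ 5 * eps ^+ 2) * (G * gam2)) => x.
by generalize (c ^+ 2 * gam2) => y *; split; lra.
Qed.

Lemma double_le1 (x : R) : x <= 1 / 2 -> 2 * x <= 1. Proof. by lra. Qed.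

Lemma sqr_half_scaled (a b l : R) :
  ((1 + l) * (a * b / 2)) ^+ 2 = a ^+ 2 * b ^+ 2 / 4 * (1 + l) ^+ 2.
Proof. by field. Qed.

End MomentConstant.

(** * Tilted moments for copies *)

Section CopyMoments.
Variables (R : realType) (V0 : finType) (g0 : rel V0).
Hypothesis hg0 : simple_graph V0 g0.
Hypothesis hedge : gedges V0 g0 != finset.set0.
Variables (n : nat) (p : R).
Hypotheses (p0 : 0 < p) (p1 : p < 1).
Hypothesis hn : (4 * #|V0| ^ 2 <= n)%N.
Variable Gam : {set {set 'I_n}}.
Hypothesis hGam : Gam \in copies V0 g0 n.

Local Notation M := (copies V0 g0 n).
Local Notation e := (nedges V0 g0).
Local Notation v' := #|nonisolated V0 g0|.
Local Notation c := (cG0 R V0 g0).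
Local Notation Psi := (Psi_min R V0 g0 n p).
Local Notation sg := (sigmaN R V0 g0 n p).
Local Notation E := (bE p (Kedges n)).
Local Notation W := (cstd p M sg).
Local Notation gam := (Num.sqrt ((1 - p) * Psi))^-1.
Local Notation D := (Dcount V0 g0 n Gam).

Lemma n_gt0 : (0 < n)%N.
Proof.
apply: leq_trans hn; rewrite muln_gt0 expn_gt0 /=.
have [x /gedgeP[y [z _]]] := set0Pn _ hedge.
by apply/orP; left; apply/card_gt0P; exists y.
Qed.

Let Psi0 : 0 < Psi. Proof. exact: Psi_min_gt0 p0 hedge n_gt0. Qed.
Let q0 : 0 < 1 - p. Proof. by rewrite subr_gt0. Qed.

Lemma mean_copies_gt0 : 0 < mean p M.
Proof.
rewrite /mean (bigD1 Gam) //= ltr_wpDr ?exprn_gt0// sumr_ge0// => i _.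
by rewrite exprn_ge0 ?ltW.
Qed.

Lemma varN_gt0 : 0 < varN R V0 g0 n p.
Proof.
have h := varN_lower n hg0 p0 p1 hedge.
rewrite ltNge; apply/negP => v0.
have : 0 < mean p M ^+ 2 * (1 - p) by rewrite mulr_gt0 ?exprn_gt0 ?mean_copies_gt0.
rewrite ltNge => /negP; apply; apply: le_trans h _.
by rewrite mulr_ge0_le0// mulr_ge0 ?exprn_ge0 ?(ltW Psi0).
Qed.

Lemma sigmaN_gt0 : 0 < sg. Proof. by rewrite sqrtr_gt0 varN_gt0. Qed.

Lemma sigmaN_sqr : sg ^+ 2 = varN R V0 g0 n p.
Proof. by rewrite sqr_sqrtr// ltW ?varN_gt0. Qed.

Lemma nonisolated_copy_size : (4 * v' ^ 2 <= #|'I_n|)%N.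
Proof.
rewrite card_ord; apply: leq_trans hn; rewrite leq_mul2l leq_exp2r//.
exact: max_card.
Qed.

Lemma chain_copies m K : cov M m K ->
  \sum_(k | nb M K k) p ^+ #|k :|: K| <= chainL R e v' m * (mean p M / Psi) * p ^+ #|K|.
Proof.
apply: (chain_bound p0 _ _ _ Psi0 _ nonisolated_copy_size).
- by move=> s k; exact: act_copy.
- by move=> k; exact: card_copy.
- by move=> k; exact: card_cover_copy.
- by move=> k h kM hk h0; rewrite card_ord; exact: Psi_min_copy kM hk h0.
Qed.

Let gamE : gam ^+ 2 * ((1 - p) * Psi) = 1.
Proof.
have h : 0 < (1 - p) * Psi by rewrite mulr_gt0.
by rewrite exprVn sqr_sqrtr ?mulVf ?ltW// lt0r_neq0.
Qed.

Let gam0 : 0 < gam. Proof. by rewrite invr_gt0 sqrtr_gt0 mulr_gt0. Qed.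

(** The condition on c gam absorbs the b^4 term into the b^2 terms. The bound on N admits both tag
    counts, e for R and 2 e^2 for U. *)
Lemma smQ_copies (l : R) (N : nat) : 0 <= l -> c * gam <= 1 / 2 -> (N <= 2 * e ^ 2)%N ->
  N%:R ^+ 2 * smQ p M sg (chainL R e v') (mean p M / Psi) l <= ((1 + l) * (c * gam / 2)) ^+ 2.
Proof.
move=> l0 cg hN.
have s0 := sigmaN_gt0; have c0 := cG0_gt0 R hedge; have m0 := ltW mean_copies_gt0.
have h1 := varN_lower n hg0 p0 p1 hedge; rewrite -sigmaN_sqr in h1.
have G0 : 0 <= 2 ^+ e :> R by rewrite exprn_ge0.
have [hA hb] := variance_consequences q0 Psi0 s0 G0 gamE h1.
rewrite smQE//.
set A := (1 - p) * mean p M * _ / _ in hA *; set b := mean p M / Psi / sg in hb *.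
have A0 : 0 <= A.
  by rewrite /A !mulr_ge0 ?invr_ge0 ?exprn_ge0 ?(ltW q0) ?(ltW Psi0) ?(ltW s0).
have b0 : 0 <= b by rewrite /b !mulr_ge0 ?invr_ge0 ?(ltW Psi0) ?(ltW s0).
have f0 : 0 <= (v'`!)%:R :> R by exact: ler0n.
have P0 : 0 <= (2 ^ v')%:R :> R by exact: ler0n.
have a0 : 0 <= 8 / 7 :> R by [].
have L0 := chainL_ge0 R g0.
have Lle m : 0 <= chainL R e v' m <= 8 / 7 * 2 ^+ e * ((2 ^ v')%:R ^+ m * (v'`!)%:R).
  by rewrite L0 chainL_le.
have L1 : 0 <= chainL R e v' 1 <= 8 / 7 * 2 ^+ e * (v'`!)%:R by rewrite L0 chainL1 lexx.
have [hX hY hZ] := chain_products a0 G0 P0 f0 L1 (Lle 2%N) (Lle 3%N) (Lle 4%N) (Lle 5%N).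
have q01 : 0 <= 1 - p <= 1 by rewrite ltW//= lerBlDr lerDl ltW.
have L45 : 0 <= chainL R e v' 4 <= chainL R e v' 5 by rewrite L0 chainL45.
have X0 : 0 <= chainL R e v' 1 * chainL R e v' 2 * chainL R e v' 3 by case/andP: hX.
have h2 := smQ_split ((chainL R e v' 1 * chainL R e v' 2) ^+ 2) q01 l0 X0 L45 A0 b0.
have NR : N%:R ^+ 2 <= (2 * e%:R ^+ 2) ^+ 2 :> R.
  by apply: pow_mono; rewrite ?ler0n// -natrX -natrM ler_nat.
have N0 : 0 <= N%:R ^+ 2 :> R by rewrite exprn_ge0.
apply: le_trans (ler_wpM2l N0 h2) _.
have v'v : (v' <= #|V0|)%N by exact: max_card.
have fF : (v'`!)%:R <= ((#|V0|)`!)%:R :> R by rewrite ler_nat leq_fact.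
have F1 : 1 <= ((#|V0|)`!)%:R :> R by rewrite ler1n fact_gt0.
have e0 : 0 <= e%:R :> R by exact: ler0n.
have PG : (2 ^ v')%:R <= (2 ^+ e) ^+ 2 :> R.
  by rewrite -!natrX ler_nat -expnM leq_exp2l// mulnC (card_nonisolated hg0).
have Pf : (2 ^ v')%:R <= 2 * (v'`!)%:R :> R by rewrite -natrM ler_nat expn2_le_fact.
have eF : e%:R <= ((#|V0|)`!)%:R :> R by rewrite ler_nat nedges_le_fact.
have e2F : e%:R ^+ 2 <= 2 * ((#|V0|)`!)%:R :> R.
  by rewrite -natrX -natrM ler_nat nedges_sqr_le_fact.
have F0 : 0 <= ((#|V0|)`!)%:R :> R by exact: ler0n.
have cc : 512 * (2 ^+ e) ^+ 15 * ((#|V0|)`!)%:R ^+ 5 * e%:R ^+ 2 <= c ^+ 2.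
  by have := cG0_sqr_ge R g0; rewrite mulnC exprM.
have cg2 : 4 * c ^+ 2 * gam ^+ 2 <= 1.
  rewrite (_ : 4 * _ * _ = (2 * (c * gam)) ^+ 2); last by ring.
  rewrite exprn_ile1 ?mulr_ge0 ?(ltW c0) ?(ltW gam0)//.
  exact: double_le1.
have g20 : 0 <= gam ^+ 2 by rewrite exprn_ge0 ?(ltW gam0).
have [k1 k2] := small_constant G0 F0 e0 g20 cc cg2.
have Gg : 0 <= 2 ^+ e * gam ^+ 2 by rewrite mulr_ge0.
have bb : 0 <= b ^+ 2 <= 2 ^+ e * gam ^+ 2 by rewrite hb exprn_ge0.
have AA : 0 <= A <= 2 ^+ e by rewrite A0.
have h3 := numeric_main G0 P0 f0 F1 fF e0 PG Pf eF e2F Gg k1 l0 AA hX hY hZ bb.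
apply: le_trans (_ : _ <= 128 * ((2 ^+ e) ^+ 14 * ((#|V0|)`!)%:R ^+ 5 * e%:R ^+ 2) * (2 ^+ e * gam ^+ 2) * (1 + l) ^+ 2) _; last first.
  rewrite sqr_half_scaled.
  by rewrite ler_wpM2r// exprn_ge0 ?addr_ge0.
apply: le_trans h3; apply: ler_wpM2r NR.
have Z0 : 0 <= chainL R e v' 4 * chainL R e v' 5 by case/andP: hZ.
have Y0 : 0 <= (chainL R e v' 1 * chainL R e v' 2) ^+ 2 by case/andP: hY.
have l20 : 0 <= l ^+ 2 by rewrite exprn_ge0.
have A20 : 0 <= A ^+ 2 by rewrite exprn_ge0.
have b20 : 0 <= b ^+ 2 by rewrite exprn_ge0.
have AX0 := mulr_ge0 A0 X0.
apply: mulr_ge0 => //; apply: addr_ge0; first apply: addr_ge0.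
- by apply: mulr_ge0.
- by apply: mulr_ge0 => //; apply: mulr_ge0.
- by apply: mulr_ge0 => //; apply: mulr_ge0; apply: mulr_ge0.
Qed.

Variable t : R.
Hypotheses (t0 : 0 <= t) (cg : c * gam <= 1 / 2).
Local Notation kap := (c * gam / 2 * expR (3 * D%:R * t / sg)).

(** The factor exp (6 D l / sg) in the second moment is at most the square of exp (3 D t / sg),
    whence the 3 in [kap]. *)
Lemma weighted_moment (Y : {set {set 'I_n}} -> R) (N : nat) : (N <= 2 * e ^ 2)%N ->
  (forall l, 0 <= l -> E (fun om => Y om ^+ 2 * expR (l * W om)) <=
     N%:R ^+ 2 * smQ p M sg (chainL R e v') (mean p M / Psi) l * tiltc p (Kedges n) M sg D l) ->
  forall l, 0 <= l <= t ->
  E (fun om => `|Y om| * expR (l * W om)) <= (1 + l) * kap * mgf p (Kedges n) M sg l.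
Proof.
move=> hN HY l /andP[l0 lt].
have c0 := cG0_gt0 R hedge; have s0 := sigmaN_gt0.
have g0' := gam0.
apply: (@bE_abs_le _ _ _ _ _ (fun om => expR (l * W om))) => //.
- have l1 : 0 < 1 + l by rewrite ltr_wpDr.
  apply: mulr_gt0 => //; apply: mulr_gt0; last exact: expR_gt0.
  by apply: divr_gt0 => //; exact: mulr_gt0.
- apply: le_trans (HY l l0) _; rewrite /tiltc.
  have m0 : 0 <= mgf p (Kedges n) M sg l by exact: mgf_ge0.
  rewrite mulrA ler_wpM2r//.
  rewrite (_ : (1 + l) * kap = (1 + l) * (c * gam / 2) * expR (3 * D%:R * t / sg)); last by rewrite mulrA.
  rewrite exprMn.
  apply: le_trans (ler_wpM2r (expR_ge0 _) (smQ_copies l0 cg hN)) _.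
  rewrite ler_wpM2l ?sqr_ge0//.
  rewrite expr2 -expRD ler_expR -mulrDl ler_pM2r ?invr_gt0//.
  rewrite natrM (_ : 3 * D%:R * t + 3 * D%:R * t = t * (6 * D%:R)); last by ring.
  by rewrite ler_wpM2r// mulr_ge0.
Qed.
End CopyMoments.

(** * Final inequalities *)

Section FinalEstimates.
Variable R : realType.

Lemma Phi_opp_gt0 (t : R) : 0 <= t -> 0 < Phi R (- t).
Proof.
move=> t0; rewrite lt_neqAle Phi_ge0 andbT eq_sym; apply/eqP => h.
by have := mills_lower t0; rewrite h mulr0 leNgt npdf_gt0.
Qed.

Lemma Phi_opp_inv (t : R) : 0 <= t -> (Phi R (- t))^-1 <= 6 * (1 + t) * expR (t ^+ 2 / 2).
Proof.
move=> t0; have Q0 := Phi_opp_gt0 t0.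
have h := mills_lower t0.
have n0 : 0 < npdf t by exact: npdf_gt0.
have h1 : (Phi R (- t))^-1 <= 2 * (1 + t) * (npdf t)^-1.
  by rewrite ler_pdivlMr// mulrC ler_pdivrMr.
apply: le_trans h1 _; rewrite npdf_inv.
rewrite [leRHS](_ : _ = 2 * (1 + t) * (3 * expR (t ^+ 2 / 2))); last by ring.
rewrite ler_wpM2l ?mulr_ge0 ?addr_ge0//.
by rewrite ler_wpM2r ?expR_ge0 ?sqrt2pi_le3.
Qed.

(** The left side is at most 1 / Q. As c s >= 1/2, the exponential dominates exp (t^2 / 2) and the
    prefactor is at least 25 (1 + t^2), which exceeds 6 (1 + t). *)
Lemma final_trivial (P Q t c s : R) : 0 <= P <= 1 -> 0 < Q <= 1 -> 0 <= t ->
  Q^-1 <= 6 * (1 + t) * expR (t ^+ 2 / 2) -> 1 / 2 <= c * s ->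
  `|P / Q - 1| <= 50 * c * expR (c * t ^+ 2 * s) * (1 + t ^+ 2) * s.
Proof.
move=> /andP[P0 P1] /andP[Q0 Q1] t0 hQ cs.
have Q1' : 1 <= Q^-1 by rewrite -invr1 lef_pV2 ?posrE.
have h1 : `|P / Q - 1| <= Q^-1.
  have PQ0 : 0 <= P / Q by rewrite divr_ge0// ltW.
  have PQ1 : P / Q <= Q^-1 by rewrite ler_piMl// invr_ge0 ltW.
  by rewrite ler_norml; move: Q1' PQ0 PQ1; generalize (P / Q) Q^-1 => *; apply/andP; split; lra.
apply: le_trans h1 (le_trans hQ _).
have t20 : 0 <= t ^+ 2 by exact: sqr_ge0.
have he : expR (t ^+ 2 / 2) <= expR (c * t ^+ 2 * s).
  rewrite ler_expR (_ : c * t ^+ 2 * s = t ^+ 2 * (c * s)); last by ring.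
  by rewrite ler_wpM2l// -div1r.
rewrite [leRHS](_ : _ = (50 * (c * s) * (1 + t ^+ 2)) * expR (c * t ^+ 2 * s)); last by ring.
apply: ler_pM; rewrite ?mulr_ge0 ?addr_ge0 ?expR_ge0//.
apply: le_trans (_ : 25 * (1 + t ^+ 2) <= _).
  have h2 := sqr_ge0 (t - 1); have h3 : 2 * t <= 1 + t ^+ 2 by move: h2; lra.
  by move: h3 t20; generalize (t ^+ 2) => y *; lra.
rewrite ler_wpM2r ?addr_ge0//; move: cs; generalize (c * s) => *; lra.
Qed.

(** The half in [kap] turns 74 into 37, which is below 50. *)
Lemma final_nontrivial (c gam e3 e5 t X1 X2 : R) : 0 <= c -> 0 <= gam -> 0 <= t ->
  0 <= e3 <= e5 -> 0 <= X1 <= X2 ->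
  74 * (c * gam / 2 * e3) * ((1 + t) * (1 + t ^+ 2)) * X1
  <= 50 * c * X2 * (1 + t ^+ 2) * ((1 + t) * gam * e5).
Proof.
move=> c0 g0 t0 /andP[e30 e35] /andP[X10 X12].
pose w := c * gam * ((1 + t) * (1 + t ^+ 2)).
have w0 : 0 <= w by rewrite /w !mulr_ge0 ?addr_ge0 ?sqr_ge0.
rewrite [leLHS](_ : _ = 37 * (w * (e3 * X1))); last by rewrite /w; field.
rewrite [leRHS](_ : _ = 50 * (w * (e5 * X2))); last by rewrite /w; ring.
have a0 : 0 <= w * (e3 * X1) by apply: mulr_ge0 => //; exact: mulr_ge0.
have h : w * (e3 * X1) <= w * (e5 * X2) by rewrite ler_wpM2l// ler_pM.
by move: a0 h; generalize (w * (e3 * X1)) (w * (e5 * X2)) => *; lra.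
Qed.

Lemma relative_error (x y Q B : R) : 0 < Q -> Q = 1 - y -> `|x - y| <= B * Q ->
  `|(1 - x) / Q - 1| <= B.
Proof.
move=> Q0 QE h.
have -> : (1 - x) / Q - 1 = (y - x) / Q.
  have -> : y = 1 - Q by rewrite QE; ring.
  by field; rewrite lt0r_neq0.
by rewrite normrM normfV (gtr0_norm Q0) ler_pdivrMr// distrC.
Qed.

End FinalEstimates.

(** * The range where the constant times 1 / sqrt (q Psi_min) is at most 1/2 *)

Section NontrivialRegion.
Variables (R : realType) (V0 : finType) (g0 : rel V0).
Hypothesis hg0 : simple_graph V0 g0.
Hypothesis hedge : gedges V0 g0 != finset.set0.
Variables (n : nat) (p : R).
Hypotheses (p0 : 0 < p) (p1 : p < 1).
Hypothesis hn : (4 * #|V0| ^ 2 <= n)%N.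
Variable Gam : {set {set 'I_n}}.
Hypothesis hGam : Gam \in copies V0 g0 n.
Variable t : R.
Hypothesis t0 : 0 <= t.

Local Notation M := (copies V0 g0 n).
Local Notation c := (cG0 R V0 g0).
Local Notation Psi := (Psi_min R V0 g0 n p).
Local Notation sg := (sigmaN R V0 g0 n p).
Local Notation W := (cstd p M sg).
Local Notation gam := (Num.sqrt ((1 - p) * Psi))^-1.
Local Notation D := (Dcount V0 g0 n Gam).
Local Notation kap := (c * gam / 2 * expR (3 * D%:R * t / sg)).

Lemma gnp_P_gt : gnp_P R n p (fun om => Wstd R V0 g0 n p om > t) =
  1 - bE p (Kedges n) (fun om => (W om <= t)%R%:R).
Proof.
rewrite gnp_P_bE -[X in X - _](bE_cst p (Kedges n)) -bEB; apply: eq_bE => om _.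
by rewrite Wstd_cstd// ltNge; case: (_ <= t); rewrite ?subrr ?subr0.
Qed.

Lemma gnp_P_bounds (A : {set {set 'I_n}} -> bool) : 0 <= gnp_P R n p A <= 1.
Proof.
rewrite gnp_P_bE; apply/andP; split; first by apply: bE_ge0.
rewrite -[leRHS](bE_cst p (Kedges n)); apply: ler_bE => // om _.
by rewrite lern1 leq_b1.
Qed.

Lemma relative_error_nontrivial : c * gam <= 1 / 2 ->
  `|gnp_P R n p (fun om => Wstd R V0 g0 n p om > t) / (1 - Phi R t) - 1|
  <= 74 * kap * ((1 + t) * (1 + t ^+ 2)) * expR (kap * (t ^+ 2 * (1 + t))).
Proof.
move=> cg; rewrite gnp_P_gt -Phi_sym.
have s0 := sigmaN_gt0 hg0 hedge p0 p1 hn hGam.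
have Psi0 := Psi_min_gt0 p0 hedge (n_gt0 hedge hn).
have MV := @copy_Kedges _ _ hg0 n.
have sgE : sg ^+ 2 = bE p (Kedges n) (fun om => (cnt R M om - mean p M) ^+ 2).
  by rewrite (sigmaN_sqr hg0 hedge p0 p1 hn hGam) varN_var.
have HD k : k \in M -> (#|[set k' | nb M k k']| <= D)%N by move=> kM; exact: nb_Dcount.
have rho0 : 0 <= mean p M / Psi.
  by rewrite divr_ge0 ?(ltW Psi0)// (ltW (mean_copies_gt0 p0 hGam)).
have L0 := chainL_ge0 R g0.
have Me k : k \in M -> (#|k| <= nedges V0 g0)%N by move=> kM; rewrite (card_copy hg0 kM).
have chain := chain_copies hg0 hedge p0 hn.
have e0 := nedges_gt0 hedge.
have kap0 : 0 <= kap.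
  have c0 := ltW (cG0_gt0 R hedge).
  by rewrite !mulr_ge0 ?expR_ge0 ?invr_ge0 ?sqrtr_ge0.
have Ub := weighted_moment hg0 hedge p0 p1 hn hGam cg (leqnn _)
  (fun l l0 => Usum_moment p0 p1 MV s0 sgE HD rho0 L0 chain Me l0).
have eN : (nedges V0 g0 <= 2 * nedges V0 g0 ^ 2)%N.
  by rewrite expnS expn1 mulnA leq_pmull// muln_gt0.
have Rb := weighted_moment hg0 hedge p0 p1 hn hGam cg eN
  (fun l l0 => Rsum_moment p0 p1 MV s0 HD rho0 L0 chain Me l0).
have := normal_approximation p0 p1 MV s0 kap0 t0 (Ub t) (Rb t).
rewrite mulrAC => h.
exact: (relative_error (Phi_opp_gt0 t0) (Phi_sym t) h).
Qed.
End NontrivialRegion.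

Unset Implicit Arguments.
Set Strict Implicit.

Theorem theorem1p4 (R : realType) (V0 : finType) (g0 : rel V0)
  (hg0 : simple_graph V0 g0) (hedge : gedges V0 g0 != finset.set0)
  (n : nat) (p : R) (hp0 : 0 < p) (hp1 : p < 1)
  (hn : (4 * #|V0| ^ 2 <= n)%N)
  (Gam : {set {set 'I_n}}) (hGam : Gam \in copies V0 g0 n)
  (t : R) (ht : 0 <= t) :
  `| gnp_P R n p (fun om => Wstd R V0 g0 n p om > t) / (1 - Phi R t) - 1 |
    <= 50 * cG0 R V0 g0 * expR (cG0 R V0 g0 * t ^+ 2 * s_fun R V0 g0 n p Gam t)
       * (1 + t ^+ 2) * s_fun R V0 g0 n p Gam t.
Proof.
have n0 := n_gt0 hedge hn.
have Psi0 := Psi_min_gt0 hp0 hedge n0.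
have c1 := cG0_ge1 R hedge; have c0 := ltW (cG0_gt0 R hedge).
have q0 : 0 < 1 - p by rewrite subr_gt0.
have sg0 := sigmaN_gt0 hg0 hedge hp0 hp1 hn hGam.
have Q0 := Phi_opp_gt0 ht.
have [hs|hs] := leP (1 / 2) (cG0 R V0 g0 * s_fun R V0 g0 n p Gam t).
  apply: final_trivial => //.
  - exact: gnp_P_bounds.
  - by rewrite -Phi_sym Q0 Phi_le1.
  - by rewrite -Phi_sym; exact: Phi_opp_inv.
set c := cG0 R V0 g0 in c1 c0 hs *.
set gam := (Num.sqrt ((1 - p) * Psi_min R V0 g0 n p))^-1.
set x := 5 * (Dcount V0 g0 n Gam)%:R * t / sigmaN R V0 g0 n p.
have x0 : 0 <= x by rewrite /x !mulr_ge0 ?invr_ge0 ?(ltW sg0).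
have gam0 : 0 < gam by rewrite invr_gt0 sqrtr_gt0 mulr_gt0.
have e1 : 1 <= expR x by rewrite -[leLHS]expR0 ler_expR.
set m := Num.min (Num.sqrt (Psi_min R V0 g0 n p)) 1.
have m0 : 0 < m by rewrite lt_min sqrtr_gt0 Psi0 ltr01.
have sE : s_fun R V0 g0 n p Gam t = (1 + t / m) * gam * expR x by [].
(* [gam] is at most s(t), whose other two factors are at least 1. *)
have cg : c * gam <= 1 / 2.
  apply: ltW; apply: le_lt_trans hs; rewrite sE ler_wpM2l//.
  have tm : 0 <= t / m by rewrite divr_ge0 ?(ltW m0).
  have h : gam <= (1 + t / m) * gam by rewrite ler_peMl ?(ltW gam0)// lerDl.
  by apply: le_trans h _; rewrite ler_peMr// mulr_ge0 ?(ltW gam0)// addr_ge0.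
(* c gam <= 1/2 and c >= 1 force Psi_min >= 1. *)
have m1 : m = 1.
  apply/min_r; apply: le_trans (_ : Num.sqrt ((1 - p) * Psi_min R V0 g0 n p) <= _).
    rewrite -[leRHS]invrK -/gam -[leLHS]invr1 lef_pV2 ?posrE//.
    apply: le_trans (_ : c * gam <= 1); first by rewrite ler_peMl ?(ltW gam0).
    by apply: le_trans cg _; rewrite ler_pdivrMr// mul1r ler1n.
  apply: ler_wsqrtr; rewrite ler_piMl ?(ltW Psi0)//.
  by rewrite lerBlDr lerDl ltW.
have main := relative_error_nontrivial hg0 hedge hp0 hp1 hn hGam ht cg.
apply: (le_trans main); rewrite sE m1 divr1.
have e35 : expR (3 * (Dcount V0 g0 n Gam)%:R * t / sigmaN R V0 g0 n p) <= expR x.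
  rewrite ler_expR /x ler_pM2r ?invr_gt0// ler_wpM2r// ler_wpM2r//.
  by rewrite ler_nat.
apply: (final_nontrivial c0 (ltW gam0) ht).
  by rewrite expR_ge0.
rewrite expR_ge0 /= ler_expR.
rewrite (_ : c * t ^+ 2 * _ = c * gam * expR x * (t ^+ 2 * (1 + t))); last by ring.
rewrite ler_wpM2r ?mulr_ge0 ?addr_ge0//.
apply: ler_pM; rewrite ?expR_ge0// ?divr_ge0 ?mulr_ge0 ?(ltW gam0)//.
by rewrite ler_piMr ?mulr_ge0 ?(ltW gam0)// invf_le1 ?ler1n.
Qed.
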